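(* Let $\Phi$ be an increasing positive function on the integers $n\ge 2$ and let $H>0$. Then $$\lim_{N\to\infty}\ \min_{|a_n|\le\Phi(n)}\ \int_0^H\left|1+\sum_{n=2}^N a_n d(n)n^{it-1}\right|^2dt>0$$ if and only if $$\sum_{n=2}^\infty\frac{d(n)\log\Phi(n)}{n(\log n)^3}<\infty .$$
   Context: $d(n)$ denotes the number of positive divisors of $n$. For each $N$ the minimum is taken over all complex numbers $a_2,\dots,a_N$ with $|a_n|\le\Phi(n)$ for $2\le n\le N$. *)

(* Defs.v *)
From mathcomp Require Import all_boot all_order all_algebra.
From mathcomp Require Import all_classical all_reals all_analysis.
From mathcomp Require Export complex.

Set Implicit Arguments.
Unset Strict Implicit.
Unset Printing Implicit Defensive.

Import Order.TTheory GRing.Theory Num.Theory.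
Import numFieldNormedType.Exports.

Local Open Scope classical_set_scope.
Local Open Scope ring_scope.

Definition expC (R : realType) (z : R[i]) : R[i] :=
  let: Complex x y := z in Complex (expR x * cos y) (expR x * sin y).

(* n ^ z = exp (z log n); only meaningful for n >= 1, since ln 0 = 0. *)
Definition natpowC (R : realType) (n : nat) (z : R[i]) : R[i] :=
  expC (z * Complex (ln n%:R) 0).

Definition ndiv (n : nat) : nat := size (divisors n).

Definition dirpoly (R : realType) (a : nat -> R[i]) (N : nat) (t : R) : R[i] :=
  1 + \sum_(2 <= n < N.+1) a n * (ndiv n)%:R * natpowC n (Complex (-1) t).

(* Normc.normc : R[i] -> R is the modulus; `|z| would live in R[i]. *)
Definition energy (R : realType) (H : R) (N : nat) (a : nat -> R[i]) : R :=
  \int[lebesgue_measure]_(t in `[0, H]) (Normc.normc (dirpoly a N t) ^+ 2).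

(* The coefficients a_2, ..., a_N are the values of a : nat -> R[i]; values
   outside 2 <= n <= N are unconstrained and do not affect energy H N a. *)
Definition admissible (R : realType) (Phi : nat -> R) (N : nat) :
    set (nat -> R[i]) :=
  [set a | forall n, (2 <= n <= N)%N -> Normc.normc (a n) <= Phi n].

Definition is_minimum (R : realType) (A : set R) (m : R) : Prop :=
  A m /\ lbound A m.

(* Main.v *)
(* Put psi_j = log (Phi(2^(2^j)) / Phi(2)). The sum of d(n)/n over
   2^(2^j) <= n < 2^(2^(j+1)) has order 4^j and (log n)^3 has order 8^j there, so
   by monotonicity the series converges iff sum_j psi_j / 2^j < oo. The integral
   is replaced by Riemann sums of mesh eta, so that both implications become
   statements about polynomials in q = exp(i eta x) at the points x = log n.

   If sum_j psi_j / 2^j < oo, test 1 + sum_n a_n d(n) n^(it-1) against a product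
   of box kernels (1 + q + ... + q^(K-1)) / K whose widths add up to less than H
   and which is so small at x = log n that it beats Phi(n) d(n)/n, multiplied by a
   Chebyshev polynomial T(lam cos (h (x + c))) which is at most 1 in modulus for
   1/2 <= x <= X, bounded independently of X beyond, and very large at x = 0: the
   frequency 0 cannot be cancelled.

   If sum_j psi_j / 2^j = oo, let f be a minimizer and G its Fourier transform.
   By convexity sum_n Phi(n) d(n)/n |G(log n)| <= Re G(0). Since only positive x
   are controlled, pass to G(x) conj(G(-x)), and apply Cauchy's formula (on roots
   of unity) to its product with E(x) = prod_j E_j(x), where E_j is a truncated
   binomial series for a power v^-m with v = q^(e_j). On the circle |E| is at most
   a constant times min(Phi(n), n^(1/2)) near x = log n, whereas at the interior
   point q = exp(-eta y) it is at least 1 + c sum_j psi_j / 2^j. Hence G(0), and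
   with it the minimum, tends to 0. *)

Require Import Defs.
From mathcomp Require Import all_boot all_order all_algebra.
From mathcomp Require Import all_classical all_reals all_analysis.
From mathcomp Require Import complex.
From mathcomp Require Import ring lra zify.
Import Order.TTheory GRing.Theory Num.Theory.
Import numFieldNormedType.Exports.
Local Open Scope classical_set_scope.
Local Open Scope ring_scope.

Set Implicit Arguments.
Unset Strict Implicit.
Unset Printing Implicit Defensive.

(** The Riemann sums approximate the energy uniformly over admissible coefficients. Their mesh is
    [H / 2^r], so that widths [H / 2^j] are whole numbers of steps and every kernel is a polynomial
    in q. In the divergent case the Cauchy kernel decays only like 1/x; an extra box kernel of full
    length [H] supplies a second factor 1/x, which makes the tail beyond log N summable. A node is
    replaced by a point log n at distance at most 1/n; the Lipschitz error, multiplied by E, stays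
    summable because E is also capped by n^(1/2). In the convergent case the product of degree and
    frequency h of the Chebyshev factor is fixed at H/8. Its height at x = 0 and its global bound
    are then controlled by H and the shift c alone, and X may be chosen after them, so far out that
    the damping absorbs the global bound. One box factor is kept aside: its coefficients are at most
    1 / length, which turns an l1 bound for the other factors into a bound O(1/m) for each
    coefficient of the test polynomial and, by Cauchy-Schwarz, into a lower bound for the energy
    free of r and N. *)

Local Notation nc := (@Normc.normc _).

(** * The modulus on R[i] and unit complex numbers *)

Section ComplexModulus.
Variable R : realType.
Implicit Types (x y : R) (z w : R[i]).

Lemma ComplexM (a b c d : R) :
  Complex a b * Complex c d = Complex (a * c - b * d) (a * d + b * c).
Proof. by []. Qed.

Lemma nc_ge0 z : 0 <= nc z.
Proof. by case: z => a b; rewrite /= sqrtr_ge0. Qed.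

Lemma nc_sqr z : nc z ^+ 2 = complex.Re z ^+ 2 + complex.Im z ^+ 2.
Proof. by case: z => a b /=; rewrite sqr_sqrtr// addr_ge0 ?sqr_ge0. Qed.

Lemma ncM z w : nc (z * w) = nc z * nc w.
Proof. exact: Normc.normcM. Qed.

Lemma nc0 : nc (0 : R[i]) = 0.
Proof. exact: Normc.normc0. Qed.

Lemma nc1 : nc (1 : R[i]) = 1.
Proof. exact: Normc.normc1. Qed.

Lemma ncD z w : nc (z + w) <= nc z + nc w.
Proof. exact: le_normcD. Qed.

Lemma ncN z : nc (- z) = nc z.
Proof. exact: normcN. Qed.

Lemma ncBC z w : nc (z - w) = nc (w - z).
Proof. by rewrite -ncN opprB. Qed.

Lemma ncX z n : nc (z ^+ n) = nc z ^+ n.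
Proof. by elim: n => [|n IH]; rewrite ?expr0 ?nc1// !exprS ncM IH. Qed.

Lemma ncV z : nc z^-1 = (nc z)^-1.
Proof. exact: Normc.normcV. Qed.

Lemma nc_real x : nc (x%:C)%C = `|x|.
Proof. by rewrite /= expr0n addr0 sqrtr_sqr. Qed.

Lemma nc_nat n : nc (n%:R : R[i]) = n%:R.
Proof.
by rewrite -[n%:R]/(1 *+ n) normcMn nc1.
Qed.

Lemma ncZ x z : nc ((x%:C)%C * z) = `|x| * nc z.
Proof. by rewrite ncM nc_real. Qed.

Lemma nc_sum I (r : seq I) (P : pred I) (F : I -> R[i]) :
  nc (\sum_(i <- r | P i) F i) <= \sum_(i <- r | P i) nc (F i).
Proof.
elim/big_rec2: _ => [|i x z _ IH]; first by rewrite nc0.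
by apply: (le_trans (ncD _ _)); rewrite lerD2l.
Qed.

Lemma nc_prod I (r : seq I) (P : pred I) (F : I -> R[i]) :
  nc (\prod_(i <- r | P i) F i) = \prod_(i <- r | P i) nc (F i).
Proof.
by elim/big_rec2: _ => [|i x z _ IH]; rewrite ?nc1// ncM IH.
Qed.

Lemma ncB_ge z w : nc z - nc w <= nc (z - w).
Proof. by rewrite lerBlDr -{1}[z](subrK w) ncD. Qed.

Lemma ncD_ge z w : nc z - nc w <= nc (z + w).
Proof. by rewrite -(ncN w) -{2}[w]opprK ncB_ge. Qed.

Lemma nc_dist z w : `|nc z - nc w| <= nc (z - w).
Proof.
rewrite ler_norml ncB_ge andbT lerNl opprB ncBC; exact: ncB_ge.
Qed.

Lemma Re_le_nc z : complex.Re z <= nc z.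
Proof.
case: z => a b /=; apply: (le_trans (ler_norm _)).
by rewrite -sqrtr_sqr ler_wsqrtr// lerDl sqr_ge0.
Qed.

Lemma nc_conj z : nc (z^*)%C = nc z.
Proof. by case: z => a b; rewrite /= sqrrN. Qed.

Lemma ReM_conj_nc z : z * (z^*)%C = ((nc z ^+ 2)%:C)%C.
Proof.
by rewrite nc_sqr; case: z => a b; rewrite ComplexM /=; congr Complex; ring.
Qed.

End ComplexModulus.

Section Cis.
Variable R : realType.
Implicit Types (x y t : R).

Definition cis x : R[i] := Complex (cos x) (sin x).

Lemma cis0 : cis 0 = 1.
Proof. by rewrite /cis cos0 sin0. Qed.

Lemma cisD x y : cis (x + y) = cis x * cis y.
Proof.
by rewrite /cis cosD sinD ComplexM; congr Complex; ring.
Qed.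

Lemma nc_cis x : nc (cis x) = 1.
Proof. by rewrite /= cos2Dsin2 sqrtr1. Qed.

Lemma cis_neq0 x : cis x != 0.
Proof. by apply/eqP => h; move: (nc_cis x); rewrite h nc0 => /eqP; rewrite eq_sym oner_eq0. Qed.

Lemma cisX x n : cis x ^+ n = cis (n%:R * x).
Proof.
by elim: n => [|n IH]; rewrite ?mul0r ?cis0// exprS IH -cisD; congr cis; rewrite -natr1; ring.
Qed.

Lemma cisN x : cis (- x) = (cis x)^-1.
Proof.
by apply: (mulfI (cis_neq0 x)); rewrite -cisD subrr cis0 mulfV// cis_neq0.
Qed.

Lemma cis_conj x : ((cis x)^*)%C = cis (- x).
Proof. by rewrite /cis /= cosN sinN. Qed.

Lemma cisB x y : cis (x - y) = cis x / cis y.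
Proof. by rewrite cisD cisN. Qed.

Lemma cosB1 t : 1 - cos t = 2 * sin (t / 2) ^+ 2.
Proof.
have -> : cos t = cos ((t / 2) *+ 2) by congr cos; field.
by rewrite cos_mulr2n cos2sin2; ring.
Qed.

Lemma nc_1Bcis t : nc (1 - cis t) = 2 * `|sin (t / 2)|.
Proof.
apply: (@pexpIrn _ 2) => //; rewrite ?nnegrE ?nc_ge0 ?mulr_ge0//.
rewrite nc_sqr /= exprMn real_normK ?num_real//.
transitivity (2 * (1 - cos t)); last by rewrite cosB1; ring.
have := cos2Dsin2 t; move: (cos t) (sin t) => c s h.
by transitivity (c ^+ 2 + s ^+ 2 + 1 - 2 * c); [ring | rewrite h; ring].
Qed.

Lemma sin_le_id x : 0 <= x -> sin x <= x.
Proof.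
move=> x0.
have h z : z \in `]0, x[%R -> is_derive z 1 (@sin R) (cos z) by move=> _; exact: is_derive_sin.
have c : {within `[0, x], continuous (@sin R)}.
  by apply: continuous_subspaceT => z; exact: continuous_sin.
have [z _] := MVT_segment x0 h c.
rewrite sin0 !subr0 => ->.
by rewrite ler_piMl// cos_le1.
Qed.

Lemma norm_sin_le x : `|sin x| <= `|x|.
Proof.
wlog x0 : x / 0 <= x.
  move=> W; case: (leP 0 x) => [/W//|x0].
  by rewrite -normrN -sinN -[leRHS]normrN W// oppr_ge0 ltW.
case: (leP x 1) => x1; last first.
  by rewrite (ger0_norm x0) (le_trans (sin_max _))// ltW.
rewrite !ger0_norm ?sin_le_id//; apply: sin_ge0_pi; rewrite x0/=.
by rewrite (le_trans x1)// (le_trans _ (pi_ge2 R))// ler1n.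
Qed.

Lemma nc_1Bcis_le x : nc (1 - cis x) <= `|x|.
Proof.
rewrite nc_1Bcis; apply: (@le_trans _ _ (2 * `|x / 2|)).
  by rewrite ler_pM2l// norm_sin_le.
by rewrite normrM (@ger0_norm _ 2^-1)// mulrCA divff// mulr1.
Qed.

Lemma cos_ge_sqr x : 1 - x ^+ 2 / 2 <= cos x.
Proof.
have h := cosB1 x.
have h2 : sin (x / 2) ^+ 2 <= (x / 2) ^+ 2.
  rewrite -(real_normK (num_real (sin _))) -(real_normK (num_real (x / 2))).
  by rewrite ler_pXn2r ?nnegrE// norm_sin_le.
rewrite expr_div_n in h2; nra.
Qed.

(** From sin x = 2 sin (x/2) cos (x/2): the mean value theorem gives sin (x/2) >= (x/2) cos (x/2),
    and cos (x/2)^2 >= 1/2 because cos x >= 0. *)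
Lemma sin_ge_half x : 0 <= x <= pi / 2 -> x / 2 <= sin x.
Proof.
move=> /andP[x0 xp].
have e : sin x = 2 * (sin (x / 2) * cos (x / 2)).
  have -> : sin x = sin ((x / 2) *+ 2) by congr sin; field.
  by rewrite sin_mulr2n; ring.
pose c := cos (x / 2).
have pi0 : 0 < (pi : R) by exact: pi_gt0.
have c0 : 0 <= c by apply: cos_ge0_pihalf; apply/andP; split; lra.
have cx0 : 0 <= cos x by apply: cos_ge0_pihalf; apply/andP; split; lra.
have c2 : 1 / 2 <= c ^+ 2.
  have : cos x = cos ((x / 2) *+ 2) by congr cos; field.
  by rewrite cos_mulr2n -/c => h; lra.
have hx : 0 <= x / 2 by lra.
have h z : z \in `]0, x / 2[%R -> is_derive z 1 (@sin R) (cos z) by move=> _; exact: is_derive_sin.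
have cc : {within `[0, x / 2], continuous (@sin R)}.
  by apply: continuous_subspaceT => z; exact: continuous_sin.
have [z /[!in_itv]/= /andP[z0 zx]] := MVT_segment hx h cc.
rewrite sin0 !subr0 => sx.
have cz : c <= cos z.
  have := @ltr_cos R.
  move: zx; rewrite le_eqVlt => /orP[/eqP->//|zx] lc.
  by apply/ltW; rewrite lc// in_itv/=; apply/andP; split; lra.
rewrite e sx -/c.
have h3 : 1 / 2 <= cos z * c by apply: (le_trans c2); rewrite expr2 ler_wpM2r.
have := ler_wpM2l x0 h3; lra.
Qed.

Lemma nc_1Bcis_ge x : 0 <= x <= pi -> x / 2 <= nc (1 - cis x).
Proof.
move=> /andP[x0 xp]; rewrite nc_1Bcis.
have : x / 2 / 2 <= sin (x / 2) by apply: sin_ge_half; apply/andP; split; lra.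
have := ler_norm (sin (x / 2)); lra.
Qed.

Lemma nc_cisB x y : nc (cis x - cis y) <= `|x - y|.
Proof.
have -> : cis x - cis y = - cis y * (1 - cis (x - y)).
  by rewrite cisB; field; exact: cis_neq0.
by rewrite ncM ncN nc_cis mul1r nc_1Bcis_le.
Qed.

Lemma natpowC_cis n t : (0 < n)%N ->
  natpowC n (Complex (-1) t) = ((n%:R)^-1%:C)%C * cis (t * ln n%:R).
Proof.
move=> n0; rewrite /natpowC /expC.
have -> : Complex (-1) t * Complex (ln n%:R) 0 = Complex (- ln n%:R) (t * ln n%:R).
  by rewrite ComplexM; congr Complex; ring.
have hn : (n%:R : R) \is Num.pos by rewrite posrE ltr0n.
rewrite expRN lnK// /cis.
by rewrite ComplexM; congr Complex; ring.
Qed.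

End Cis.

(** * Riemann sums of the energy *)

Section Riemann.
Variable R : realType.
Notation mu := (@lebesgue_measure R).

Lemma lipschitz_continuous (h : R -> R) (K : R) :
  (forall s t, `|h s - h t| <= K * `|s - t|) -> continuous h.
Proof.
move=> hK x; apply/cvgrPdist_le => /= e e0.
near=> t.
apply: (le_trans (hK _ _)).
have K1 : 0 < `|K| + 1 by rewrite ltr_wpDl.
apply: (@le_trans _ _ ((`|K| + 1) * `|x - t|)).
  by rewrite ler_wpM2r// (le_trans (ler_norm K))// lerDl.
rewrite mulrC -ler_pdivlMr//.
near: t; apply: cvgr_dist_le; [exact: cvg_id | by rewrite divr_gt0].
Unshelve. all: by end_near. Qed.

(** Each cell of length [d] costs at most [K * d ^+ 2]. The rate is explicit because it must later
    be uniform over all admissible coefficients. *)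
Lemma riemann_sum_lipschitz (h : R -> R) (K H : R) (m : nat) :
  (forall s t, `|h s - h t| <= K * `|s - t|) -> 0 < H -> (0 < m)%N ->
  `|\int[mu]_(t in `[0, H]) h t
    - H / m%:R * \sum_(0 <= k < m) h (k%:R * (H / m%:R))| <= K * H ^+ 2 / m%:R.
Proof.
move=> hK H0 m0.
have hc := lipschitz_continuous hK.
have cint (g : R -> R) a b : continuous g -> mu.-integrable `[a, b] (EFin \o g).
  move=> gc; apply: continuous_compact_integrable; first exact: segment_compact.
  exact: continuous_subspaceT.
have oint (g : R -> R) a b : continuous g -> mu.-integrable `]a, b] (EFin \o g).
  move=> gc; apply: integrableS (cint g a b gc) => //.
  by apply: subset_itvr; rewrite bnd_simp.
pose d := H / m%:R.
have m0' : 0 < m%:R :> R by rewrite ltr0n.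
have d0 : 0 < d by rewrite divr_gt0.
have K0 : 0 <= K.
  have := hK 1 0; rewrite subr0 normr1 mulr1; exact: le_trans.
have cell x : 0 <= x ->
  `|\int[mu]_(t in `]x, x + d]) h t - d * h x| <= K * d ^+ 2.
  move=> x0.
  have leb : fine (mu `]x, x + d]) = d.
    by rewrite lebesgue_measure_itv/= lte_fin ltrDl d0/=; ring.
  have cc (c : R) : continuous (fun _ : R => c) by move=> ?; exact: cvg_cst.
  have cB : continuous (fun t => h t - h x).
    by move=> t; apply: cvgB; [exact: hc | exact: cvg_cst].
  have cA : continuous (fun t => `|h t - h x|).
    by move=> t; apply: cvg_norm; exact: cB.
  have -> : d * h x = \int[mu]_(t in `]x, x + d]) (h x).
    by rewrite Rintegral_cst//= leb mulrC.
  rewrite -RintegralB//; try exact: oint.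
  apply: (le_trans (le_normr_Rintegral _ (oint _ _ _ cB))) => //.
  have -> : K * d ^+ 2 = \int[mu]_(t in `]x, x + d]) (K * d).
    by rewrite Rintegral_cst//= leb; ring.
  apply: le_Rintegral => //; try exact: oint.
  move=> t /=; rewrite in_itv/= => /andP[xt td].
  apply: (le_trans (hK _ _)); rewrite ler_wpM2l//.
  by rewrite ger0_norm; [rewrite lerBlDl | rewrite subr_ge0 ltW].
(* The mesh [d] stays fixed while the number [k] of cells grows, so the induction adds one cell at a
   time. *)
suff main k : `|\int[mu]_(t in `[0, k%:R * d]) h t
    - d * \sum_(0 <= i < k) h (i%:R * d)| <= k%:R * (K * d ^+ 2).
  have := main m; rewrite /d mulrCA divff ?mulr1 ?gt_eqF// => h1.
  apply: (le_trans h1); rewrite le_eqVlt; apply/orP; left; apply/eqP.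
  by field; rewrite gt_eqF.
elim: k => [|k IH].
  rewrite big_geq// mulr0 subr0 !mul0r.
  by rewrite set_itv1 Rintegral_set1 normr0.
have kd : 0 <= k%:R * d by rewrite mulr_ge0// ltW.
have e : k.+1%:R * d = k%:R * d + d by rewrite -natr1; ring.
have := @Rintegral_itvB _ h (BLeft 0) (BRight (k.+1%:R * d)) (k%:R * d) (cint _ _ _ hc).
rewrite !bnd_simp => /(_ kd).
have -> : k%:R * d <= k.+1%:R * d by rewrite e lerDl ltW.
move=> /(_ isT) /eqP; rewrite subr_eq => /eqP ->.
have -> : k.+1%:R * (K * d ^+ 2) = k%:R * (K * d ^+ 2) + K * d ^+ 2.
  by rewrite -natr1; ring.
rewrite big_nat_recr//= mulrDr e.
set A := Rintegral _ _ _; set B := Rintegral _ _ _; set S := d * bigop _ _ _.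
have -> : A + B - (S + d * h (k%:R * d)) = (B - S) + (A - d * h (k%:R * d)) by ring.
apply: (le_trans (ler_normD _ _)); apply: lerD => //.
exact: cell.
Qed.

End Riemann.

(** * Uniform bounds for the Dirichlet polynomials and their discrete energy *)

Section DirichletPolynomial.
Variable R : realType.
Implicit Types (a b : nat -> R[i]) (s t H : R).

Definition divw (n : nat) : R := (ndiv n)%:R / n%:R.

Lemma divw_ge0 n : 0 <= divw n.
Proof. by rewrite divr_ge0. Qed.

Lemma dirpolyE a N t :
  dirpoly a N t = 1 + \sum_(2 <= n < N.+1) a n * ((divw n)%:C)%C * cis (t * ln n%:R).
Proof.
rewrite /dirpoly; congr (_ + _); apply: eq_big_nat => n /andP[n2 _].
rewrite natpowC_cis; last by case: n n2.
rewrite !mulrA; congr (_ * _); rewrite -mulrA; congr (_ * _).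
by rewrite /divw rmorphM /= rmorph_nat.
Qed.

Lemma nc_dirpoly a N t :
  nc (dirpoly a N t) <= 1 + \sum_(2 <= n < N.+1) nc (a n) * divw n.
Proof.
rewrite dirpolyE; apply: (le_trans (ncD _ _)); rewrite nc1 lerD2l.
apply: (le_trans (nc_sum _ _ _)); apply: ler_sum => n _.
by rewrite !ncM nc_cis nc_real mulr1 ger0_norm// divw_ge0.
Qed.

Lemma nc_dirpolyB_time a N s t :
  nc (dirpoly a N s - dirpoly a N t) <=
  (\sum_(2 <= n < N.+1) nc (a n) * divw n * ln n%:R) * `|s - t|.
Proof.
rewrite !dirpolyE opprD addrACA subrr add0r -sumrB mulr_suml.
apply: (le_trans (nc_sum _ _ _)); rewrite !big_nat; apply: ler_sum => n /andP[n2 _].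
rewrite -mulrBr !ncM nc_real (ger0_norm (divw_ge0 n)) -[leRHS]mulrA.
rewrite ler_wpM2l ?mulr_ge0 ?nc_ge0 ?divw_ge0//.
apply: (le_trans (nc_cisB _ _)); rewrite -mulrBl normrM mulrC ger0_norm//.
by rewrite ln_ge0// ler1n; case: n n2.
Qed.

Lemma nc_dirpolyB_coef a b N t :
  nc (dirpoly a N t - dirpoly b N t) <=
  \sum_(2 <= n < N.+1) nc (a n - b n) * divw n.
Proof.
rewrite !dirpolyE opprD addrACA subrr add0r -sumrB.
apply: (le_trans (nc_sum _ _ _)); apply: ler_sum => n _.
by rewrite -!mulrBl !ncM nc_cis nc_real mulr1 ger0_norm// divw_ge0.
Qed.

Lemma nc_sqrB (z w : R[i]) :
  `|nc z ^+ 2 - nc w ^+ 2| <= nc (z - w) * (nc z + nc w).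
Proof.
rewrite subr_sqr normrM (ger0_norm (addr_ge0 (nc_ge0 _) (nc_ge0 _))).
by rewrite ler_wpM2r ?addr_ge0 ?nc_ge0// nc_dist.
Qed.

Definition denergy (H : R) (N : nat) a (m : nat) : R :=
  H / m%:R * \sum_(0 <= k < m) nc (dirpoly a N (k%:R * (H / m%:R))) ^+ 2.

(** Uniform bound for the modulus of [dirpoly] on the admissible set. *)
Definition coef_mass (Phi : nat -> R) (N : nat) : R :=
  1 + \sum_(2 <= n < N.+1) Phi n * divw n.

Lemma nc_dirpoly_admissible Phi N a t : admissible Phi N a ->
  nc (dirpoly a N t) <= coef_mass Phi N.
Proof.
move=> ha; apply: (le_trans (nc_dirpoly _ _ _)); rewrite lerD2l !big_nat.
by apply: ler_sum => n h; rewrite ler_wpM2r ?divw_ge0//; apply: ha.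
Qed.

(** [K] is chosen before [a]: a discrete minimizer changes with [m], so only a uniform error lets it
    be compared with the true energy. *)
Lemma denergy_cvg (Phi : nat -> R) H N : 0 < H ->
  exists K : R, forall a, admissible Phi N a -> forall m, (0 < m)%N ->
  `|energy H N a - denergy H N a m| <= K / m%:R.
Proof.
move=> H0.
pose L := \sum_(2 <= n < N.+1) Phi n * divw n * ln n%:R.
exists (L * (coef_mass Phi N *+ 2) * H ^+ 2) => a ha m m0.
apply: riemann_sum_lipschitz => // s t.
apply: (le_trans (nc_sqrB _ _)).
have h1 : nc (dirpoly a N s - dirpoly a N t) <= L * `|s - t|.
  apply: (le_trans (nc_dirpolyB_time _ _ _ _)).
  rewrite ler_wpM2r// /L !big_nat; apply: ler_sum => n h.
  rewrite ler_wpM2r//; last by rewrite ler_wpM2r ?divw_ge0//; apply: ha.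
  by rewrite ln_ge0// ler1n; case: n h.
have h2 u := nc_dirpoly_admissible u ha.
rewrite mulrAC; apply: ler_pM; rewrite ?addr_ge0 ?nc_ge0//.
by rewrite mulr2n lerD.
Qed.

(** The constant is free of [m], so the estimate passes to the limit and also gives continuity of
    [energy] in the coefficients. *)
Lemma denergy_lipschitz (Phi : nat -> R) H N m a b : 0 < H -> (0 < m)%N ->
  admissible Phi N a -> admissible Phi N b ->
  `|denergy H N a m - denergy H N b m| <=
    H * (coef_mass Phi N *+ 2) * \sum_(2 <= n < N.+1) nc (a n - b n) * divw n.
Proof.
move=> H0 m0 ha hb.
have m0' : 0 < m%:R :> R by rewrite ltr0n.
have Hm0 : 0 <= H / m%:R by rewrite divr_ge0// ltW.
rewrite /denergy -mulrBr -sumrB normrM (ger0_norm Hm0).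
rewrite -!mulrA ler_wpM2l ?(ltW H0)// ler_pdivrMl//.
apply: (le_trans (ler_norm_sum _ _ _)).
set X := leRHS.
have -> : X = \sum_(0 <= k < m) ((coef_mass Phi N *+ 2) * \sum_(2 <= n < N.+1) nc (a n - b n) * divw n).
  by rewrite sumr_const_nat subn0 -[RHS]mulr_natl.
apply: ler_sum => k _; apply: (le_trans (nc_sqrB _ _)).
rewrite mulrC; apply: ler_pM; rewrite ?addr_ge0 ?nc_ge0//.
  by rewrite mulr2n lerD// nc_dirpoly_admissible.
exact: nc_dirpolyB_coef.
Qed.

End DirichletPolynomial.

(** * Sums of the divisor function *)

Section DivisorSums.
Variable R : realType.

Lemma sum_dyadic_inv_le k : \sum_(2 ^ k <= a < 2 ^ k.+1) (a%:R : R)^-1 <= 1.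
Proof.
have p0 : 0 < (2 ^ k)%:R :> R by rewrite ltr0n expn_gt0.
apply: (@le_trans _ _ (\sum_(2 ^ k <= a < 2 ^ k.+1) ((2 ^ k)%:R : R)^-1)).
  rewrite !big_nat; apply: ler_sum => a /andP[ka _].
  have a0 : 0 < a%:R :> R by rewrite ltr0n (leq_trans _ ka)// expn_gt0.
  by rewrite lef_pV2 ?posrE// ler_nat.
rewrite sumr_const_nat expnS mul2n -addnn addnK -[X in X <= _]mulr_natr.
by rewrite mulVf// gt_eqF.
Qed.

Lemma sum_dyadic_inv_ge k : 1 / 2 <= \sum_(2 ^ k <= a < 2 ^ k.+1) (a%:R : R)^-1.
Proof.
have p0 : 0 < (2 ^ k.+1)%:R :> R by rewrite ltr0n expn_gt0.
apply: (@le_trans _ _ (\sum_(2 ^ k <= a < 2 ^ k.+1) ((2 ^ k.+1)%:R : R)^-1)).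
  rewrite sumr_const_nat -[X in _ <= X]mulr_natr [in X in _ <= _ * X]expnS mul2n -addnn addnK.
  rewrite expnS natrM le_eqVlt; apply/orP; left; apply/eqP.
  by field; rewrite pnatr_eq0 expn_eq0.
rewrite !big_nat; apply: ler_sum => a /andP[ka ak].
have a0 : 0 < a%:R :> R by rewrite ltr0n (leq_trans _ ka)// expn_gt0.
by rewrite lef_pV2 ?posrE// ler_nat ltnW.
Qed.

Lemma sum_inv_le K : \sum_(1 <= a < 2 ^ K) (a%:R : R)^-1 <= K%:R.
Proof.
elim: K => [|K IH]; first by rewrite expn0 big_geq.
rewrite (big_cat_nat (n := (2 ^ K))) ?expn_gt0 ?leq_pexp2l//=.
by rewrite -natr1 lerD// sum_dyadic_inv_le.
Qed.

Lemma sum_inv_ge p d : d%:R / 2 <= \sum_(2 ^ p <= a < 2 ^ (p + d)) (a%:R : R)^-1.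
Proof.
elim: d => [|d IH]; first by rewrite addn0 big_geq// mul0r.
rewrite (big_cat_nat (n := (2 ^ (p + d)))) ?leq_pexp2l ?leq_addr ?leq_add2l//=.
by rewrite -natr1 mulrDl lerD// addnS sum_dyadic_inv_ge.
Qed.

(** Factorizations n = a b with both factors in one range. Unlike [ndiv], its sum weighted by 1/n is
    exactly the square of a harmonic sum. *)
Definition npairs (p q n : nat) : nat :=
  \sum_(p <= a < q) \sum_(p <= b < q) (a * b == n)%N.

Lemma sum_mul_eq_le p q a n : (0 < n)%N ->
  (\sum_(p <= b < q) (a * b == n)%N <= (a %| n))%N.
Proof.
move=> n0; have [an|an] := boolP (a %| n)%N; last first.
  rewrite big1// => b _; case: eqP => // e.
  by move: an; rewrite -e dvdn_mulr.
have a0 : (0 < a)%N by rewrite (dvdn_gt0 n0).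
apply: (@leq_trans (\sum_(p <= b < q) (b == n %/ a)%N)).
  apply: leq_sum => b _; case: eqP => // e; rewrite -e mulKn// eqxx//.
by rewrite -big_mkcond/= sum1_count count_uniq_mem ?iota_uniq//; case: (_ \in _).
Qed.

Lemma npairs_le_ndiv p q n : (0 < p)%N -> (0 < n)%N -> (npairs p q n <= ndiv n)%N.
Proof.
move=> p0 n0; apply: (@leq_trans (\sum_(p <= a < q) (a %| n)%N)).
  by apply: leq_sum => a _; exact: sum_mul_eq_le.
rewrite -big_mkcond/= sum1_count -size_filter /ndiv uniq_leq_size ?filter_uniq ?iota_uniq//.
by move=> a; rewrite mem_filter -dvdn_divisors// => /andP[].
Qed.

Lemma ndiv_le_npairs X n : (0 < n < X)%N -> (ndiv n <= npairs 1 X n)%N.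
Proof.
move=> /andP[n0 nX].
apply: (@leq_trans (\sum_(1 <= a < X) (a %| n)%N)).
  rewrite -big_mkcond/= sum1_count -size_filter /ndiv uniq_leq_size ?divisors_uniq//.
  move=> a; rewrite mem_filter -dvdn_divisors// mem_index_iota => an.
  by rewrite an (dvdn_gt0 n0 an) (leq_ltn_trans (dvdn_leq n0 an)).
rewrite /npairs !big_nat; apply: leq_sum => a /andP[a0 aX].
case: (boolP (a %| n)%N) => //= /dvdnP[b e].
rewrite (bigD1_seq b) ?iota_uniq//=; last first.
  rewrite mem_index_iota; move: n0 nX; rewrite e muln_gt0 => /andP[b0 _].
  by rewrite b0; apply: leq_ltn_trans; rewrite leq_pmulr.
by rewrite e mulnC eqxx.
Qed.

(** After exchanging the sums, each pair (a, b) contributes 1/(a b) once, at n = a b, which by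
    hypothesis lies in the range of n. *)
Lemma sum_npairs (X Y p q : nat) : (0 < p)%N ->
  (forall a b, (p <= a < q)%N -> (p <= b < q)%N -> (X <= a * b < Y)%N) ->
  \sum_(X <= n < Y) (npairs p q n)%:R / n%:R = (\sum_(p <= a < q) (a%:R : R)^-1) ^+ 2.
Proof.
move=> p0 h; rewrite expr2 mulr_suml.
under eq_bigr => n _ do rewrite natr_sum mulr_suml.
rewrite exchange_big_nat/=; apply: eq_big_nat => a ha.
under eq_bigr => n _ do rewrite natr_sum mulr_suml.
rewrite exchange_big_nat/= mulr_sumr; apply: eq_big_nat => b hb.
rewrite (eq_bigr (fun n => if n == (a * b)%N then (n%:R : R)^-1 else 0)) => [|n _].
  by rewrite -big_mkcond big_nat1_eq h// natrM invfM.
by rewrite eq_sym; case: eqP => _; rewrite ?mul1r ?mul0r.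
Qed.

Lemma sum_divw_le K : \sum_(1 <= n < 2 ^ K) divw R n <= K%:R ^+ 2.
Proof.
(* Divisors of n < 2^K lie below 2^K, and products of two such numbers stay below 2^(2K), so the
   range of n is enlarged before the sum factors. *)
apply: (@le_trans _ _ (\sum_(1 <= n < 2 ^ (K + K)) (npairs 1 (2 ^ K) n)%:R / n%:R)).
  rewrite [leRHS](big_cat_nat (n := (2 ^ K))) ?expn_gt0 ?leq_pexp2l ?leq_addr//=.
  rewrite ler_wpDr//; first by apply: sumr_ge0 => n _; rewrite divr_ge0.
  rewrite !big_nat; apply: ler_sum => n hn.
  by rewrite ler_wpM2r ?invr_ge0// ler_nat ndiv_le_npairs.
rewrite sum_npairs//; last first.
  move=> a b /andP[a1 aK] /andP[b1 bK].
  by rewrite muln_gt0 a1 b1 expnD ltn_mul.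
apply: lerXn2r; rewrite ?nnegrE ?ler0n//; last exact: sum_inv_le.
by apply: sumr_ge0 => a _; rewrite invr_ge0.
Qed.

(** Endpoints of blocks on which log n varies by a factor of 2; each endpoint is the square of the
    one before. *)
Definition tower (j : nat) : nat := (2 ^ (2 ^ j))%N.

Lemma towerS j : (tower j.+1 = tower j * tower j)%N.
Proof. by rewrite /tower expnS mul2n -addnn expnD. Qed.

Lemma tower_ge2 j : (2 <= tower j)%N.
Proof. by rewrite /tower -{1}[2%N]expn1 leq_exp2l// expn_gt0. Qed.

Lemma tower_mono i j : (i <= j)%N -> (tower i <= tower j)%N.
Proof. by move=> ij; rewrite /tower !leq_exp2l. Qed.

Lemma ltn_tower j : (j < tower j)%N.
Proof. exact: (ltn_trans (@ltn_expl 2 j isT) (@ltn_expl 2 (2 ^ j) isT)). Qed.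

Lemma sum_divw_tower_le j : \sum_(tower j <= n < tower j.+1) divw R n <= 4 ^+ j.+1.
Proof.
have -> : 4 ^+ j.+1 = (2 ^ j.+1)%:R ^+ 2 :> R.
  by rewrite natrX -exprM mulnC exprM; congr (_ ^+ _); ring.
apply: le_trans (sum_divw_le _).
rewrite [leRHS](big_cat_nat (n := (tower j))) ?tower_mono// ?(leq_trans _ (tower_ge2 j))//=.
by rewrite ler_wpDl//; apply: sumr_ge0 => n _; exact: divw_ge0.
Qed.

(** Products of two numbers of block [j] fall into block [j.+1], so the block sum dominates the
    square of a harmonic sum over [2 ^ j] dyadic intervals. *)
Lemma sum_divw_tower_ge j : 4 ^+ j / 4 <= \sum_(tower j.+1 <= n < tower j.+2) divw R n.
Proof.
apply: (@le_trans _ _ (\sum_(tower j.+1 <= n < tower j.+2) (npairs (tower j) (tower j.+1) n)%:R / n%:R)); last first.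
  rewrite !big_nat; apply: ler_sum => n /andP[hn _].
  rewrite ler_wpM2r ?invr_ge0// ler_nat npairs_le_ndiv//.
    by rewrite (leq_trans _ (tower_ge2 j)).
  by rewrite (leq_trans _ hn)// (leq_trans _ (tower_ge2 j.+1)).
rewrite sum_npairs//; last 2 first.
- by rewrite (leq_trans _ (tower_ge2 j)).
- move=> a b /andP[a1 aK] /andP[b1 bK].
  by rewrite (towerS j) (towerS j.+1) leq_mul//= ltn_mul.
have -> : 4 ^+ j / 4 = ((2 ^ j)%:R / 2) ^+ 2 :> R.
  rewrite natrX expr_div_n -exprM mulnC exprM; congr (_ ^+ _ / _); ring.
have := sum_inv_ge (2 ^ j) (2 ^ j); rewrite addnn -mul2n -expnS.
by move=> h; apply: lerXn2r; rewrite ?nnegrE ?divr_ge0// (le_trans _ h) ?divr_ge0.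
Qed.

Lemma ln2_ge : 1 / 2 <= ln 2 :> R.
Proof.
have h : ln (1 + - 2^-1) <= - 2^-1 :> R by apply: le_ln1Dx; lra.
have e : 1 + - 2^-1 = 2^-1 :> R by field.
by move: h; rewrite e lnV ?posrE//; lra.
Qed.

Lemma ln2_le : ln 2 <= 1 :> R.
Proof. by have := @le_ln1Dx R 1 ltac:(lra); have -> : 1 + 1 = 2 :> R by ring. Qed.

Lemma ln_tower j : ln (tower j)%:R = 2 ^+ j * ln 2 :> R.
Proof. by rewrite /tower natrX lnXn// -[LHS]mulr_natl natrX. Qed.

Lemma ln_ge_tower j n : (tower j <= n)%N -> 2 ^+ j / 2 <= ln n%:R :> R.
Proof.
move=> h; apply: (@le_trans _ _ (ln (tower j)%:R)).
  rewrite ln_tower; have p : 0 < 2 ^+ j :> R by rewrite exprn_gt0.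
  by have := ler_wpM2l (ltW p) ln2_ge; lra.
rewrite ler_ln ?posrE ?ler_nat// ltr0n ?(leq_trans _ (tower_ge2 j))//.
by rewrite (leq_trans _ h)// (leq_trans _ (tower_ge2 j)).
Qed.

Lemma ln_le_tower j n : (0 < n <= tower j)%N -> ln n%:R <= 2 ^+ j :> R.
Proof.
move=> /andP[n0 h]; apply: (@le_trans _ _ (ln (tower j)%:R)).
  by rewrite ler_ln ?posrE ?ler_nat// ltr0n// (leq_trans n0).
rewrite ln_tower; have p : 0 < 2 ^+ j :> R by rewrite exprn_gt0.
by have := ler_wpM2l (ltW p) ln2_le; lra.
Qed.

Lemma sum_tower (F : nat -> R) J :
  \sum_(2 <= n < tower J) F n = \sum_(0 <= j < J) \sum_(tower j <= n < tower j.+1) F n.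
Proof.
elim: J => [|J IH]; first by rewrite !big_geq.
rewrite big_nat_recr//= -IH (big_cat_nat (n := (tower J))) ?tower_ge2//.
exact: tower_mono.
Qed.

Lemma sum_half_le J : \sum_(0 <= j < J) ((2 : R) ^+ j)^-1 <= 2.
Proof.
suff : \sum_(0 <= j < J) ((2 : R) ^+ j)^-1 = 2 - 2 / 2 ^+ J.
  by move=> ->; rewrite lerBlDr lerDl divr_ge0// exprn_ge0.
elim: J => [|J IH]; first by rewrite big_geq// expr0 divr1 subrr.
by rewrite big_nat_recr//= IH exprS; field; rewrite expf_neq0.
Qed.

End DivisorSums.

(** * The series as a condition on the blocks *)

Section SeriesCriterion.
Variables (R : realType) (Phi : nat -> R).
Hypothesis Phi_gt0 : forall n : nat, (2 <= n)%N -> 0 < Phi n.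
Hypothesis Phi_incr : forall m n : nat, (2 <= m)%N -> (m <= n)%N -> Phi m <= Phi n.

(** Subtracting [ln (Phi 2)] makes the terms nonnegative, so that convergence is boundedness; the
    subtracted part is a multiple of a convergent series. *)
Definition lratio (n : nat) : R := ln (Phi n) - ln (Phi 2).

Lemma lratio_mono m n : (2 <= m)%N -> (m <= n)%N -> lratio m <= lratio n.
Proof.
move=> m2 mn; rewrite lerD2r ler_ln ?posrE ?Phi_gt0 ?Phi_incr//.
exact: leq_trans mn.
Qed.

Lemma lratio_ge0 n : (2 <= n)%N -> 0 <= lratio n.
Proof. by move=> n2; rewrite -[leLHS](subrr (ln (Phi 2))) lratio_mono. Qed.

Lemma expR_lratio n : (2 <= n)%N -> expR (lratio n) = Phi n / Phi 2.
Proof. by move=> n2; rewrite expRB !lnK// posrE Phi_gt0. Qed.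

Definition wlog3 (n : nat) : R := divw R n / ln n%:R ^+ 3.

Lemma ln_gt0n n : (2 <= n)%N -> 0 < ln n%:R :> R.
Proof. by move=> n2; rewrite ln_gt0// ltr1n. Qed.

Lemma wlog3_ge0 n : (2 <= n)%N -> 0 <= wlog3 n.
Proof. by move=> n2; rewrite divr_ge0 ?divw_ge0// exprn_ge0// ltW// ln_gt0n. Qed.

(** The block sum of d(n)/n is at most 4^(j+1) and log n >= 2^j / 2, whence 32 = 4 * 8. *)
Lemma wlog3_block_le j (F : nat -> R) C : 0 <= C ->
  (forall n, (tower j <= n < tower j.+1)%N -> F n <= C) ->
  \sum_(tower j <= n < tower j.+1) wlog3 n * F n <= 32 * C / 2 ^+ j.
Proof.
move=> C0 hF; have p0 : 0 < 2 ^+ j :> R by rewrite exprn_gt0.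
apply: (@le_trans _ _ (\sum_(tower j <= n < tower j.+1) divw R n * (8 * C / 8 ^+ j))).
  rewrite !big_nat; apply: ler_sum => n /andP[jn nj].
  have n2 : (2 <= n)%N by apply: leq_trans jn; exact: tower_ge2.
  apply: (@le_trans _ _ (wlog3 n * C)).
    by rewrite ler_wpM2l ?wlog3_ge0// hF ?jn.
  rewrite /wlog3 -[leLHS]mulrA ler_wpM2l ?divw_ge0//.
  rewrite -mulrA mulrCA [leLHS]mulrC ler_wpM2l//.
  have := @ln_ge_tower R j n jn => h.
  have e : 8 / 8 ^+ j = ((2 ^+ j / 2) ^+ 3)^-1 :> R.
    have -> : 8 = 2 ^+ 3 :> R by ring.
    rewrite expr_div_n -!exprM mulnC; field; by rewrite expf_neq0.
  rewrite e lef_pV2 ?posrE ?exprn_gt0 ?ln_gt0n ?divr_gt0//.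
  by apply: lerXn2r; rewrite ?nnegrE ?(ltW (ln_gt0n n2))// divr_ge0// ltW.
rewrite -mulr_suml.
apply: (@le_trans _ _ (4 ^+ j.+1 * (8 * C / 8 ^+ j))).
  by rewrite ler_wpM2r ?sum_divw_tower_le// divr_ge0 ?mulr_ge0// exprn_ge0.
rewrite le_eqVlt; apply/orP; left; apply/eqP.
have -> : 8 = 4 * 2 :> R by ring.
by rewrite exprS exprMn; field; rewrite !expf_neq0.
Qed.

(** The block sum of d(n)/n is at least 4^j / 4 and log n <= 2^(j+2); their quotient is 1 / (128 *
    2^(j+1)). *)
Lemma wlog3_block_ge j (F : nat -> R) C : 0 <= C ->
  (forall n, (tower j.+1 <= n < tower j.+2)%N -> C <= F n) ->
  C / 2 ^+ j.+1 / 128 <= \sum_(tower j.+1 <= n < tower j.+2) wlog3 n * F n.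
Proof.
move=> C0 hF; have p0 : 0 < 2 ^+ j :> R by rewrite exprn_gt0.
apply: (@le_trans _ _ (\sum_(tower j.+1 <= n < tower j.+2) divw R n * (C / 8 ^+ j.+2))).
  rewrite -mulr_suml.
  apply: (@le_trans _ _ (4 ^+ j / 4 * (C / 8 ^+ j.+2))).
    rewrite le_eqVlt; apply/orP; left; apply/eqP.
    have -> : 8 = 4 * 2 :> R by ring.
    by rewrite exprMn !exprS; field; rewrite !expf_neq0.
  by rewrite ler_wpM2r ?sum_divw_tower_ge// divr_ge0// exprn_ge0.
rewrite !big_nat; apply: ler_sum => n /andP[jn nj].
have n2 : (2 <= n)%N by apply: leq_trans jn; exact: tower_ge2.
apply: (@le_trans _ _ (wlog3 n * C)); last by rewrite ler_wpM2l ?wlog3_ge0// hF ?jn.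
rewrite /wlog3 -[leRHS]mulrA ler_wpM2l ?divw_ge0// mulrC ler_wpM2r//.
have h : ln n%:R <= 2 ^+ j.+2 :> R by apply: ln_le_tower; rewrite (ltnW nj) andbT ltnW.
have -> : 8 ^+ j.+2 = (2 ^+ j.+2) ^+ 3 :> R.
  by rewrite -exprM mulnC exprM; congr (_ ^+ _); ring.
rewrite lef_pV2 ?posrE ?exprn_gt0 ?ln_gt0n//.
by apply: lerXn2r; rewrite ?nnegrE ?(ltW (ln_gt0n n2))// exprn_ge0.
Qed.

Definition Psi (j : nat) : R := lratio (tower j).

Lemma Psi_ge0 j : 0 <= Psi j.
Proof. by rewrite lratio_ge0// tower_ge2. Qed.

Lemma Psi_mono i j : (i <= j)%N -> Psi i <= Psi j.
Proof. by move=> ij; rewrite lratio_mono ?tower_ge2 ?tower_mono. Qed.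

Lemma lratio_cvg_iff :
  cvgn (fun N : nat => \sum_(2 <= n < N.+1)
             (ndiv n)%:R * ln (Phi n) / (n%:R * ln n%:R ^+ 3)) <->
  exists B, forall J, \sum_(0 <= j < J) Psi j / 2 ^+ j <= B.
Proof.
pose W N := \sum_(2 <= n < N.+1) wlog3 n * 1.
pose V N := \sum_(2 <= n < N.+1) wlog3 n * lratio n.
have sumS (F : nat -> R) N : (forall n, (2 <= n)%N -> 0 <= F n) ->
    \sum_(2 <= n < N.+1) F n <= \sum_(2 <= n < N.+2) F n.
  move=> F0; case: N => [|N]; first by rewrite [leLHS]big_geq// big_geq.
  by rewrite [leRHS]big_nat_recr//= lerDl F0.
have ndS (F : nat -> R) : (forall n, (2 <= n)%N -> 0 <= F n) ->
    nondecreasing_seq (fun N => \sum_(2 <= n < N.+1) F n).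
  by move=> F0; apply/nondecreasing_seqP => n; exact: sumS.
have towerS_le (F : nat -> R) N : (forall n, (2 <= n)%N -> 0 <= F n) ->
    \sum_(2 <= n < N.+1) F n <= \sum_(2 <= n < tower N.+1) F n.
  move=> F0; have := ndS F F0 N (tower N.+1).-1.
  have t := ltn_tower N.+1.
  rewrite prednK ?(leq_trans _ t)//; apply.
  by rewrite -ltnS prednK// ?(leq_trans _ t)// ltnW.
have W0 n : (2 <= n)%N -> 0 <= wlog3 n * 1 by move=> n2; rewrite mulr1 wlog3_ge0.
have V0 n : (2 <= n)%N -> 0 <= wlog3 n * lratio n.
  by move=> n2; rewrite mulr_ge0 ?wlog3_ge0 ?lratio_ge0.
have Wcvg : cvgn W.
  apply: nondecreasing_is_cvgn; first exact: ndS.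
  exists (32 * 2) => _ [N _ <-]; apply: (le_trans (towerS_le _ N W0)).
  rewrite sum_tower; apply: (@le_trans _ _ (\sum_(0 <= j < N.+1) 32 * 1 / 2 ^+ j)).
    by apply: ler_sum => j _; apply: wlog3_block_le.
  by rewrite -mulr_sumr mulr1 ler_pM2l// (sum_half_le R).
have SE : (fun N : nat => \sum_(2 <= n < N.+1)
             (ndiv n)%:R * ln (Phi n) / (n%:R * ln n%:R ^+ 3)) =
          (fun N => V N + ln (Phi 2) * W N).
  apply/funext => N; rewrite /V /W mulr_sumr -big_split/=.
  apply: eq_big_nat => n /andP[n2 _].
  rewrite /wlog3 /divw /lratio; field.
  by rewrite gt_eqF ?ln_gt0n//= pnatr_eq0; case: n n2.
have cW : cvgn (fun N => ln (Phi 2) * W N).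
  by apply: (@is_cvgM _ _ _ _ (fun=> ln (Phi 2)) W) => //; exact: is_cvg_cst.
rewrite SE; split=> [cS|[B hB]].
- have cV : cvgn V.
    have -> : V = (fun N => (V N + ln (Phi 2) * W N) - ln (Phi 2) * W N).
      by apply/funext => N; rewrite addrK.
    exact: is_cvgB.
  exists (128 * limn V) => J.
  have hV := nondecreasing_cvgn_le (ndS _ V0) cV.
  apply: (@le_trans _ _ (128 * \sum_(2 <= n < tower J) wlog3 n * lratio n)); last first.
    rewrite ler_pM2l//; have := hV (tower J).-1.
    by rewrite /V prednK// (leq_trans _ (tower_ge2 J)).
  (* The lower bound is available from block 1 on; for j = 0 the left side vanishes because
     [tower 0 = 2]. *)
  rewrite sum_tower mulr_sumr !big_nat; apply: ler_sum => -[|j] _.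
    rewrite /Psi /lratio /tower expn0 expn1 subrr mul0r mulr_ge0//.
    by rewrite big_nat; apply: sumr_ge0 => n /andP[n2 _]; exact: V0.
  have := @wlog3_block_ge j lratio (Psi j.+1) (Psi_ge0 _).
  move=> /(_ _)/wrap[n /andP[hn _]|].
    by apply: lratio_mono => //; exact: tower_ge2.
  by move: (_ / 2 ^+ j.+1) (\sum_(_ <= _ < _) _) => a b; lra.
- have cV : cvgn V.
    apply: nondecreasing_is_cvgn; first exact: ndS.
    exists (64 * B) => _ [N _ <-]; apply: (le_trans (towerS_le _ N V0)).
    rewrite sum_tower.
    apply: (@le_trans _ _ (\sum_(0 <= j < N.+1) 64 * (Psi j.+1 / 2 ^+ j.+1))).
      apply: ler_sum => j _.
      have -> : 64 * (Psi j.+1 / 2 ^+ j.+1) = 32 * Psi j.+1 / 2 ^+ j.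
        by rewrite exprS; field; rewrite expf_neq0.
      apply: wlog3_block_le; first exact: Psi_ge0.
      move=> n /andP[hn nj]; apply: lratio_mono; last exact: ltnW.
      by apply: leq_trans hn; exact: tower_ge2.
    rewrite -mulr_sumr ler_pM2l//; apply: le_trans (hB N.+2).
    by rewrite [leRHS]big_nat_recl//= lerDr divr_ge0 ?Psi_ge0// exprn_ge0.
  exact: is_cvgD.
Qed.

End SeriesCriterion.

(** * Existence of minimizers *)

Section Minimum.
Variable R : realType.

(** Compactness of a closed bounded set in a real space of even dimension. The Lipschitz hypothesis
    also says that [F] ignores coefficients outside 2 <= n <= N. *)
Lemma polydisc_min (Phi : nat -> R) N (F : (nat -> R[i]) -> R) K (w : nat -> R) :
  (forall n, (2 <= n <= N)%N -> 0 <= Phi n) -> 0 <= K -> (forall n, 0 <= w n) ->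
  (forall a b, admissible Phi N a -> admissible Phi N b ->
    `|F a - F b| <= K * \sum_(2 <= n < N.+1) nc (a n - b n) * w n) ->
  exists2 a, admissible Phi N a & forall b, admissible Phi N b -> F a <= F b.
Proof.
move=> Phi0 K0 w0 hF.
pose D := N.*2.+1.
pose toC (v : 'rV[R]_D.+1) (n : nat) : R[i] :=
  Complex (v ord0 (inord n.*2)) (v ord0 (inord n.*2.+1)).
pose ofC (a : nat -> R[i]) : 'rV[R]_D.+1 :=
  \row_k (if odd k then complex.Im (a k./2) else complex.Re (a k./2)).
have toCK a n : (n <= N)%N -> toC (ofC a) n = a n.
  move=> nN.
  have h1 : (n.*2 < D.+1)%N by rewrite /D; lia.
  have h2 : (n.*2.+1 < D.+1)%N by rewrite /D; lia.
  rewrite /toC /ofC !mxE !inordK//.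
  rewrite /= odd_double /= uphalf_double half_double.
  by case: (a n).
(* A common bound for all coordinates: compactness also needs the unconstrained ones confined, and
   zero is used for them. *)
pose c := \sum_(2 <= n < N.+1) Phi n.
have c0 : 0 <= c.
  by rewrite /c big_nat; apply: sumr_ge0 => n /andP[n2 nN]; apply: Phi0; rewrite n2 -ltnS.
pose A : set 'rV[R]_D.+1 :=
  [set v | forall n, (2 <= n <= N)%N -> v ord0 (inord n.*2) ^+ 2 + v ord0 (inord n.*2.+1) ^+ 2 <= Phi n ^+ 2].
pose B : set 'rV[R]_D.+1 := [set v | forall i, `[- c, c]%classic (v ord0 i)].
have cB : compact B by apply: (@rV_compact _ _ (fun=> `[- c, c]%classic)) => _; exact: segment_compact.
have cA : closed A.
  have -> : A = \bigcap_n [set v : 'rV[R]_D.+1 | (2 <= n <= N)%N -> v ord0 (inord n.*2) ^+ 2 + v ord0 (inord n.*2.+1) ^+ 2 <= Phi n ^+ 2].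
    apply/seteqP; split=> v /=; first by move=> h n _ /=; exact: h.
    by move=> h n; exact: (h n I).
  apply: closed_bigI => n _.
  case: (boolP (2 <= n <= N)%N) => hn; last first.
    rewrite (_ : mkset _ = setT); first exact: closedT.
    by apply/seteqP; split.
  rewrite (_ : mkset _ = (fun v : 'rV[R]_D.+1 => v ord0 (inord n.*2) * v ord0 (inord n.*2) + v ord0 (inord n.*2.+1) * v ord0 (inord n.*2.+1)) @^-1` [set x | x <= Phi n ^+ 2]); last first.
    by apply/seteqP; split=> v /=; rewrite -!expr2; [apply | move=> h _].
  apply: preimage_closed; last exact: closed_le.
  have csq (k : 'I_D.+1) : continuous (fun v : 'rV[R]_D.+1 => v ord0 k * v ord0 k).
    by move=> v; apply: continuousM; exact: coord_continuous.
  by move=> v _; exact: (continuousD (csq (inord n.*2) v) (csq (inord n.*2.+1) v)).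
have cAB : compact (A `&` B) by rewrite setIC; exact: compact_closedI.
have adm v : A v -> admissible Phi N (toC v).
  move=> Av n hn; rewrite -(ger0_norm (Phi0 n hn)) -sqrtr_sqr /=.
  by rewrite ler_wsqrtr// Av.
have admAB a : admissible Phi N a -> (forall n, ~~ (2 <= n <= N)%N -> a n = 0) ->
    (A `&` B) (ofC a).
  move=> ha a0; split.
    move=> n hn; have nN : (n <= N)%N by case/andP: hn.
    have := toCK a n nN; have := ha n hn; rewrite /toC.
    set x := _ ord0 _; set y := _ ord0 _ => h1 h2.
    move: h1; rewrite -h2 -ler_sqr ?nnegrE ?nc_ge0 ?Phi0//.
    by rewrite nc_sqr.
  move=> k; rewrite /ofC mxE /= in_itv/=.
  have hk : nc (a k./2) <= c.
    case: (boolP (2 <= k./2 <= N)%N) => hk; last by rewrite a0// nc0.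
    apply: (le_trans (ha _ hk)).
    rewrite /c (bigD1_seq k./2) ?iota_uniq//=; last by rewrite mem_index_iota ltnS.
    rewrite lerDl big_nat_cond; apply: sumr_ge0 => n /andP[h _].
    by apply: Phi0; rewrite -ltnS.
  have hr : complex.Re (a k./2) ^+ 2 <= c ^+ 2 /\ complex.Im (a k./2) ^+ 2 <= c ^+ 2.
    have : nc (a k./2) ^+ 2 <= c ^+ 2 by apply: lerXn2r; rewrite ?nnegrE ?nc_ge0.
    rewrite nc_sqr; have := sqr_ge0 (complex.Re (a k./2)); have := sqr_ge0 (complex.Im (a k./2)).
    by move=> ? ? ?; split; lra.
  rewrite -ler_norml; have -> : c = `|c| by rewrite ger0_norm.
  by rewrite -ler_sqr ?nnegrE// !real_normK ?num_real//; case: ifP => _; case: hr.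
have AB0 : (A `&` B) !=set0.
  exists (ofC (fun=> 0)); apply: admAB => //.
  by move=> n hn; rewrite nc0 Phi0.
have cF : {within A `&` B, continuous (F \o toC)}.
  apply/subspace_continuousP => v [Av Bv].
  apply/cvgrPdist_le => e e0.
  pose S := \sum_(2 <= n < N.+1) 2 * w n.
  have S0 : 0 <= S by apply: sumr_ge0 => n _; rewrite mulr_ge0.
  have KS0 : 0 < K * S + 1 by rewrite ltr_wpDl// mulr_ge0.
  pose d := e / (K * S + 1); have d0 : 0 < d by rewrite divr_gt0.
  rewrite near_withinE; apply: filterS (nbhsx_ballx v d d0) => u vu [Au Bu] /=.
  have hu k : `|v ord0 k - u ord0 k| <= d.
    have := vu; rewrite -ball_normE /= => /ltW; apply: le_trans.
    have -> : v ord0 k - u ord0 k = (v - u) ord0 k by rewrite !mxE.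
    rewrite [leRHS]/Num.Def.normr /= mx_normrE; apply/bigmax_geP; right => /=.
    by exists (ord0, k).
  apply: (le_trans (hF _ _ (adm _ Av) (adm _ Au))).
  apply: (@le_trans _ _ (K * \sum_(2 <= n < N.+1) d * (2 * w n))).
    rewrite ler_wpM2l//; apply: ler_sum => n _; rewrite mulrA ler_wpM2r//.
    rewrite /toC /=; have := hu (inord n.*2); have := hu (inord n.*2.+1).
    set x := _ - _; set y := _ - _ => hx hy.
    apply: (@le_trans _ _ (`|x| + `|y|)); last by lra.
    rewrite -[leRHS]ger0_norm ?addr_ge0// -sqrtr_sqr ler_wsqrtr//.
    rewrite -(real_normK (num_real x)) -(real_normK (num_real y)).
    have := normr_ge0 x; have := normr_ge0 y; move: `|x| `|y| => p q hp hq.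
    by have := mulr_ge0 hp hq; nra.
  rewrite -mulr_sumr -/S mulrCA /d mulrAC ler_pdivrMr// ler_pM2l//.
  by rewrite lerDl.
have [v vAB hv] := compact_EVT_min AB0 cAB cF.
rewrite inE in vAB.
exists (toC v); first by apply: adm; case: vAB.
(* An arbitrary competitor may be unbounded outside 2 <= n <= N; it is cut off there, which does not
   change [F]. *)
move=> b hb; pose b' n := if (2 <= n <= N)%N then b n else 0.
have hb' : admissible Phi N b' by move=> n hn; rewrite /b' hn; exact: hb.
have b'AB : (A `&` B) (ofC b').
  by apply: admAB => // n hn; rewrite /b' (negbTE hn).
have := hv (ofC b'); rewrite inE => /(_ b'AB) /= h; apply: (le_trans h).
have adb : admissible Phi N (toC (ofC b')) by apply: adm; case: b'AB.
suff : `|F (toC (ofC b')) - F b| <= 0.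
  by rewrite normr_le0 subr_eq0 => /eqP ->.
apply: (le_trans (hF _ _ adb hb)).
rewrite big_nat big1 ?mulr0// => n /andP[n2 nN].
by rewrite toCK// /b' n2 -ltnS nN /= subrr nc0 mul0r.
Qed.

End Minimum.

(** * The divergent case *)

Section TruncatedInversePower.
Variable R : realType.
Implicit Types (u v : R[i]) (r : R).

Lemma bin_le_exp2 n k : ('C(n, k) <= 2 ^ n)%N.
Proof.
elim: n k => [|n IH] [|k]; rewrite ?bin0 ?expn_gt0//.
by rewrite binS expnS mul2n -addnn leq_add.
Qed.

(** Partial sum of the power series of (1 - u)^-(m+1). *)
Definition invseries (m n : nat) u : R[i] := \sum_(0 <= k < n.+1) 'C(m + k, k)%:R * u ^+ k.

Lemma invseries0S n u : (1 - u) * invseries 0 n u = 1 - u ^+ n.+1.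
Proof.
elim: n => [|n IH]; first by rewrite /invseries big_nat1 bin0 expr0 expr1; ring.
have -> : invseries 0 n.+1 u = invseries 0 n u + u ^+ n.+1.
  by rewrite /invseries big_nat_recr//= binn mul1r.
by rewrite mulrDr IH [in RHS]exprS; ring.
Qed.

(** Multiplication by 1 - u lowers the exponent by one; Pascal's rule leaves a single boundary term
    from the truncation. *)
Lemma invseriesSS m n u :
  (1 - u) * invseries m.+1 n u = invseries m n u - 'C(m.+1 + n, n)%:R * u ^+ n.+1.
Proof.
elim: n => [|n IH]; first by rewrite /invseries !big_nat1 !bin0 expr0 expr1; ring.
have e k : invseries k n.+1 u = invseries k n u + 'C(k + n.+1, n.+1)%:R * u ^+ n.+1.
  by rewrite /invseries big_nat_recr.
rewrite !e mulrDr IH [u ^+ n.+2]exprS.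
have -> : 'C(m.+1 + n.+1, n.+1)%:R = 'C(m + n.+1, n.+1)%:R + 'C(m.+1 + n, n)%:R :> R[i].
  by rewrite -natrD (addSnnS m n) addSn binS.
ring.
Qed.

(** Since |1 - u| = 1, lowering the exponent costs nothing, and the boundary terms collected on the
    way add up to one binomial coefficient. *)
Lemma nc_invseries m n u : nc (1 - u) = 1 ->
  nc (invseries m n u) <= 1 + 'C(m + n.+1, n.+1)%:R * nc u ^+ n.+1.
Proof.
move=> hu; have hM w : nc w = nc ((1 - u) * w) by rewrite ncM hu mul1r.
elim: m => [|m IH].
  rewrite hM invseries0S binn mul1r -ncX.
  by apply: (le_trans (ncD _ _)); rewrite nc1 ncN.
rewrite hM invseriesSS.
apply: (le_trans (ncD _ _)); rewrite ncN ncM nc_nat ncX.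
have -> : 'C(m.+1 + n.+1, n.+1)%:R = 'C(m + n.+1, n.+1)%:R + 'C(m.+1 + n, n)%:R :> R.
  by rewrite -natrD (addSnnS m n) addSn binS.
by rewrite mulrDl addrA lerD2r.
Qed.

(* Binomial series of v^-m = (1 - (1 - v))^-m, truncated at degree m. On |v| = 1
   near v = 1 its modulus exceeds 1 only by O(|1 - v|^2), uniformly in m, whereas
   for real v < 1 it is at least 1 + m (1 - v). *)
Definition invpow (m : nat) : {poly R[i]} :=
  if m is m'.+1 then \sum_(0 <= k < m.+1) 'C(m' + k, k)%:R *: (1 - 'X) ^+ k else 1.

Lemma horner_invpowS m v : (invpow m.+1).[v] = invseries m m.+1 (1 - v).
Proof.
rewrite /invpow horner_sum; apply: eq_bigr => k _.
by rewrite hornerZ horner_exp !hornerE.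
Qed.

Lemma nc_invpowS m v : nc v = 1 ->
  nc (invpow m.+1).[v] <= 1 + 4 ^+ m.+1 * nc (1 - v) ^+ m.+2.
Proof.
move=> hv; rewrite horner_invpowS.
apply: (le_trans (nc_invseries _ _ _)); first by rewrite opprB addrC subrK.
rewrite lerD2l ler_wpM2r ?exprn_ge0 ?nc_ge0//.
(* A binomial coefficient of 2m+2 is at most 2^(2m+2), which is 4^(m+1). *)
apply: (@le_trans _ _ (2 ^ (m + m.+2))%:R); first by rewrite ler_nat bin_le_exp2.
by rewrite natrX -[4]/(2 * 2)%:R natrM -expr2 -exprM mulnS mul2n -addnn addnS addnS.
Qed.

Lemma nc_invpow_near m v : nc v = 1 -> 4 * nc (1 - v) <= 1 ->
  nc (invpow m).[v] <= 1 + 4 * nc (1 - v) ^+ 2.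
Proof.
case: m => [|m] hv h4; first by rewrite hornerC nc1 lerDl mulr_ge0// sqr_ge0.
apply: (le_trans (nc_invpowS _ hv)); rewrite lerD2l.
have t0 := nc_ge0 (1 - v); set t := nc (1 - v) in h4 t0 *.
have -> : 4 ^+ m.+1 * t ^+ m.+2 = (4 * t ^+ 2) * (4 * t) ^+ m.
  by rewrite exprMn !exprS; ring.
by rewrite ler_piMr ?mulr_ge0 ?sqr_ge0// exprn_ile1// mulr_ge0.
Qed.

Lemma nc_invpow_le m v : nc v = 1 -> nc (invpow m).[v] <= 32 ^+ m.
Proof.
case: m => [|m] hv; first by rewrite hornerC nc1.
apply: (le_trans (nc_invpowS _ hv)).
have t0 := nc_ge0 (1 - v).
have t2 : nc (1 - v) <= 2 by apply: (le_trans (ncD _ _)); rewrite nc1 ncN hv.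
apply: (@le_trans _ _ (1 + 4 ^+ m.+1 * 2 ^+ m.+2)).
  rewrite lerD2l ler_wpM2l ?exprn_ge0//.
  by apply: lerXn2r; rewrite ?nnegrE.
have -> : 4 ^+ m.+1 * 2 ^+ m.+2 = 2 * 8 ^+ m.+1 :> R.
  rewrite [2 ^+ _]exprS mulrCA -exprMn; congr (_ * _ ^+ _); ring.
have h8 : 1 <= 8 ^+ m.+1 :> R by rewrite exprn_ege1//; lra.
have -> : 32 = 4 * 8 :> R by ring.
rewrite exprMn.
have h4 : 4 <= 4 ^+ m.+1 :> R by rewrite exprS ler_peMr// exprn_ege1//; lra.
nra.
Qed.

(** All terms are nonnegative for real [r], and the terms k = 0 and k = 1 alone give the left
    side. *)
Lemma nc_invpow_real m r : 0 <= r <= 1 ->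
  1 + m%:R * (1 - r) <= nc (invpow m).[(r%:C)%C].
Proof.
move=> /andP[r0 r1]; case: m => [|m]; first by rewrite hornerC nc1 mul0r addr0.
rewrite horner_invpowS.
have -> : invseries m m.+1 (1 - (r%:C)%C) =
   ((\sum_(0 <= k < m.+2) 'C(m + k, k)%:R * (1 - r) ^+ k)%:C)%C.
  rewrite /invseries rmorph_sum; apply: eq_bigr => k _.
  by rewrite rmorphM rmorph_nat rmorphXn rmorphB rmorph1.
rewrite nc_real.
apply: (le_trans _ (ler_norm _)).
rewrite big_nat_recl// big_nat_recl//= bin0 expr0 mul1r addrA bin1 addn1 expr1 lerDl.
by apply: sumr_ge0 => k _; rewrite mulr_ge0// exprn_ge0// subr_ge0.
Qed.

End TruncatedInversePower.

(** * Cauchy's formula on roots of unity *)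

Section FiniteCauchy.
Variable R : realType.
Implicit Types (P : {poly R[i]}) (r x : R).

Definition rnode (M l : nat) : R := pi *+ 2 * l%:R / M%:R.

Lemma cis_neq1 x : 0 < `|x| < pi *+ 2 -> cis x != 1.
Proof.
move=> hx; apply/eqP => h.
suff : 0 < nc (1 - cis x) by rewrite h subrr nc0 ltxx.
rewrite nc_1Bcis mulr_gt0// normr_gt0.
wlog x0 : x hx {h} / 0 <= x.
  move=> W; case: (leP 0 x) => [/W//|x0]; first exact.
  by rewrite -oppr_eq0 -sinN -mulNr W ?normrN// oppr_ge0 ltW.
apply/lt0r_neq0/sin_gt0_pi.
move: hx; rewrite ger0_norm// => /andP[? h]; rewrite mulr2n in h.
by apply/andP; split; lra.
Qed.

Lemma rnode_orth M k i : (k < M)%N -> (i < M)%N ->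
  \sum_(0 <= l < M) cis (rnode M l) ^+ k * cis (- rnode M l) ^+ i
    = (if k == i then M%:R else 0) :> R[i].
Proof.
move=> kM iM; have M0 : (0 < M)%N by exact: leq_ltn_trans kM.
have M0' : 0 < M%:R :> R by rewrite ltr0n.
pose z := pi *+ 2 * (k%:R - i%:R) / M%:R : R.
have e l : cis (rnode M l) ^+ k * cis (- rnode M l) ^+ i = cis z ^+ l :> R[i].
  rewrite !cisX -cisD; congr cis; rewrite /rnode /z; field.
  by rewrite gt_eqF.
rewrite (eq_bigr (fun l => cis z ^+ l)) => [|l _]; last exact: e.
have [eki|nki] := eqVneq k i.
  rewrite (eq_bigr (fun=> 1)) => [|l _].
    by rewrite sumr_const_nat subn0.
  by rewrite /z eki subrr mulr0 mul0r cis0 expr1n.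
have z1 : cis z != 1.
  apply: cis_neq1; rewrite /z normrM normrM normfV !(ger0_norm (ltW M0')) ger0_norm; last first.
    by rewrite mulrn_wge0 ?pi_ge0.
  have pi2 : 0 < pi *+ 2 :> R by rewrite mulrn_wgt0 ?pi_gt0.
  have ki0 : 0 < `|k%:R - i%:R| :> R by rewrite normr_gt0 subr_eq0 eqr_nat.
  rewrite !mulr_gt0 ?invr_gt0//= ltr_pdivrMr// ltr_pM2l//.
  rewrite ltr_norml; move: kM iM; rewrite -!(ltr_nat R) => kM iM.
  have k0 := ler0n R k; have i0 := ler0n R i.
  by apply/andP; split; lra.
have zM : cis z ^+ M = 1.
  have eM : rnode M M = pi *+ 2 by rewrite /rnode mulfK// gt_eqF.
  by rewrite -(e M) eM cisN /cis cos2pi sin2pi invr1 !expr1n mulr1.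
apply: (mulfI (x := 1 - cis z)); first by rewrite subr_eq0 eq_sym.
rewrite mulr0 big_mkord -(opprB _ 1) mulNr -subrX1 zM subrr oppr0.
by [].
Qed.

(** Orthogonality of the roots of unity recovers every coefficient exactly once [M] is at least the
    size of [P]; the inner sum is the truncated Cauchy kernel. *)
Lemma horner_rnode P M r : (0 < M)%N -> (size P <= M)%N ->
  M%:R * P.[(r%:C)%C] =
  \sum_(0 <= l < M) P.[cis (rnode M l)] *
     \sum_(0 <= i < M) ((r%:C)%C * cis (- rnode M l)) ^+ i.
Proof.
move=> M0 sP.
rewrite (horner_coef_wide _ sP) -(big_mkord xpredT (fun k => P`_k * (r%:C)%C ^+ k)).
rewrite mulr_sumr.
under [RHS]eq_bigr => l _.
  rewrite (horner_coef_wide _ sP) -(big_mkord xpredT (fun k => P`_k * cis (rnode M l) ^+ k)).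
  rewrite mulr_suml.
  over.
rewrite exchange_big_nat/= ; apply: eq_big_nat => k /andP[_ kM].
under eq_bigr => l _ do rewrite mulr_sumr.
rewrite exchange_big_nat/=.
rewrite (eq_big_nat _ _ (F2 := fun i => if i == k then M%:R * (P`_k * (r%:C)%C ^+ k) else 0)).
  by rewrite -big_mkcond big_nat1_eq /= kM.
move=> i /andP[_ iM].
transitivity (P`_k * (r%:C)%C ^+ i * \sum_(0 <= l < M) cis (rnode M l) ^+ k * cis (- rnode M l) ^+ i).
  rewrite mulr_sumr; apply: eq_bigr => l _; rewrite exprMn.
  by rewrite -!mulrA; congr (_ * _); rewrite mulrCA.
rewrite rnode_orth// [k == i]eq_sym; case: eqP => [->|_]; last by rewrite mulr0.
by rewrite mulrC.
Qed.

(** The truncated kernel is (1 - w^M) / (1 - w) with |w| = r < 1, and the numerator is at most 2. *)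
Lemma nc_horner_rnode P M r : (0 < M)%N -> (size P <= M)%N -> 0 <= r < 1 ->
  nc P.[(r%:C)%C] <=
  2 / M%:R * \sum_(0 <= l < M) nc P.[cis (rnode M l)] / nc (1 - (r%:C)%C * cis (rnode M l)).
Proof.
move=> M0 sP /andP[r0 r1].
have M0' : 0 < M%:R :> R by rewrite ltr0n.
rewrite mulrAC ler_pdivlMr// mulrC -nc_nat -ncM (horner_rnode _ M0 sP) mulr_sumr.
apply: (le_trans (nc_sum _ _ _)); apply: ler_sum => l _.
rewrite ncM mulrCA ler_wpM2l ?nc_ge0//.
set w := (r%:C)%C * cis (- rnode M l).
have nw : nc w = r by rewrite /w ncM nc_cis mulr1 nc_real ger0_norm.
have -> : nc (1 - (r%:C)%C * cis (rnode M l)) = nc (1 - w).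
  by rewrite /w /cis cosN sinN !ComplexM /=; congr Num.sqrt; ring.
have w1 : 0 < nc (1 - w).
  have := ncB_ge 1 w; rewrite nc1 nw; apply: lt_le_trans; by rewrite subr_gt0.
rewrite ler_pdivlMr// -ncM big_mkord mulrC.
have -> : (1 - w) * (\sum_(i < M) w ^+ i) = 1 - w ^+ M.
  by rewrite -[RHS]opprB subrX1 -[RHS]mulNr opprB.
apply: (le_trans (ncD _ _)); rewrite nc1 ncN ncX nw.
by have := exprn_ile1 M r0 (ltW r1); lra.
Qed.

End FiniteCauchy.

(** * The multiplier E *)

Section Multiplier.
Variable R : realType.
Implicit Types (x y r : R) (b e : nat -> nat).

Lemma prod_1D_ge (I : eqType) (s : seq I) (F : I -> R) : (forall i, 0 <= F i) ->
  1 + \sum_(i <- s) F i <= \prod_(i <- s) (1 + F i).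
Proof.
move=> F0; elim: s => [|i s IH]; first by rewrite !big_nil addr0.
rewrite !big_cons; apply: (@le_trans _ _ ((1 + F i) * (1 + \sum_(j <- s) F j))).
  have : 0 <= F i * \sum_(j <- s) F j by rewrite mulr_ge0// sumr_ge0.
  lra.
by rewrite ler_wpM2l// addr_ge0.
Qed.

Lemma prod_1D_le_exp (I : eqType) (s : seq I) (F : I -> R) : (forall i, 0 <= F i) ->
  \prod_(i <- s) (1 + F i) <= expR (\sum_(i <- s) F i).
Proof.
move=> F0; elim: s => [|i s IH]; first by rewrite !big_nil expR0.
rewrite !big_cons expRD; apply: ler_pM => //; rewrite ?addr_ge0//.
  by apply: prodr_ge0 => j _; rewrite addr_ge0.
exact: expR_ge1Dx.
Qed.

(** The exponents are increments of [b], so that the first K factors together are bounded by 32^(b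
    K). *)
Definition multiplier b e J : {poly R[i]} :=
  \prod_(0 <= j < J) (invpow R (b j.+1 - b j) \Po 'X^(e j)).

Lemma horner_multiplier b e J (v : R[i]) :
  (multiplier b e J).[v] = \prod_(0 <= j < J) (invpow R (b j.+1 - b j)).[v ^+ e j].
Proof.
by rewrite /multiplier horner_prod; apply: eq_bigr => j _; rewrite horner_comp hornerXn.
Qed.

Lemma expR_half_le : expR (1 / 2) <= 2 :> R.
Proof.
have h : expR (- (1 / 2)) >= 1 + - (1 / 2) :> R by exact: expR_ge1Dx.
have p := expR_gt0 (1 / 2 : R).
have e : expR (1 / 2) * expR (- (1 / 2)) = 1 :> R by rewrite expRxMexpNx_1.
nra.
Qed.

Variables (b e : nat -> nat) (J : nat) (eta : R).
Hypothesis b0 : b 0 = 0%N.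
Hypothesis b_mono : forall j, (b j <= b j.+1)%N.
Hypothesis eta0 : 0 <= eta.
Hypothesis he : forall j, (j < J)%N -> (e j)%:R * eta <= (1 / 16) / 2 ^+ j.

Lemma nc_cis_pow_near x j : 
  nc (1 - cis x ^+ j) <= j%:R * `|x|.
Proof. by rewrite cisX (le_trans (nc_1Bcis_le _))// normrM ger0_norm. Qed.

Lemma b_homo i j : (i <= j)%N -> (b i <= b j)%N.
Proof. exact: (homo_leq leqnn leq_trans b_mono). Qed.

Lemma nc_prod_invpow_le K (v : R[i]) : nc v = 1 ->
  \prod_(0 <= j < K) nc (invpow R (b j.+1 - b j)).[v ^+ e j] <= 32 ^+ b K.
Proof.
move=> hv; elim: K => [|K IH]; first by rewrite big_geq// b0 expr0.
have e1 : b K.+1 = (b K + (b K.+1 - b K))%N by rewrite subnKC.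
rewrite big_nat_recr//= [in leRHS]e1 exprD.
apply: ler_pM => //; rewrite ?nc_ge0//.
  by apply: prodr_ge0 => j _; exact: nc_ge0.
by rewrite nc_invpow_le// ncX hv expr1n.
Qed.

Lemma nc_multiplier_le (v : R[i]) : nc v = 1 ->
  nc (multiplier b e J).[v] <= 32 ^+ b J.
Proof. by move=> hv; rewrite horner_multiplier nc_prod nc_prod_invpow_le. Qed.

(** At height 2^K the factors j < K are bounded trivially. The later ones sit near v = 1, where the
    excess over 1 is quadratic and decays geometrically in j - K. *)
Lemma nc_multiplier_near x K : `|x| <= 2 ^+ K ->
  nc (multiplier b e J).[cis (eta * x)] <= 2 * 32 ^+ b K.
Proof.
move=> hx; set v := cis _; have hv : nc v = 1 by rewrite nc_cis.
case: (leqP J K) => [JK|KJ].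
  apply: (le_trans (nc_multiplier_le hv)).
  apply: (@le_trans _ _ (32 ^+ b K)).
    by apply: ler_weXn2l; [lra | exact: b_homo].
  by rewrite ler_peMl ?exprn_ge0//; lra.
rewrite horner_multiplier nc_prod (big_cat_nat (n := K))//=; last exact: ltnW.
rewrite mulrC; apply: ler_pM.
- by apply: prodr_ge0 => j _; exact: nc_ge0.
- by apply: prodr_ge0 => j _; exact: nc_ge0.
(* |1 - v| is at most t/16, hence the excess 4 |1 - v|^2 is at most t/64; the product is below exp
   (1/32), so below 2. *)
- apply: (@le_trans _ _ (\prod_(K <= j < J) (1 + (1 / 64) * 2 ^- (j - K)))).
    rewrite !big_nat; apply: ler_prod => j /andP[Kj jJ]; rewrite nc_ge0/=.
    set t := 2 ^- (j - K).
    have t0 : 0 < t by rewrite invr_gt0 exprn_gt0.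
    have t1 : t <= 1 by rewrite invf_le1 ?exprn_gt0// exprn_ege1//; lra.
    have hth : nc (1 - v ^+ e j) <= 1 / 16 * t.
      apply: (le_trans (nc_cis_pow_near _ _)).
      rewrite normrM (ger0_norm eta0) mulrA.
      apply: (@le_trans _ _ (1 / 16 / 2 ^+ j * 2 ^+ K)).
        by apply: ler_pM => //; [rewrite mulr_ge0 | exact: he].
      rewrite /t -{1}(subnK Kj) exprD; set p := 2 ^+ (j - K); set q := 2 ^+ K.
      rewrite le_eqVlt; apply/orP; left; apply/eqP; field.
      by rewrite !expf_neq0.
    have th0 := nc_ge0 (1 - v ^+ e j).
    apply: (le_trans (nc_invpow_near _ _ _)).
    + by rewrite ncX hv expr1n.
    + lra.
    + move: th0 hth; set th := nc _ => th0 hth.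
      rewrite lerD2l; nra.
  apply: (le_trans (prod_1D_le_exp _ _)) => [j|].
    by rewrite mulr_ge0// ?invr_ge0 ?exprn_ge0//; lra.
  apply: le_trans expR_half_le; rewrite ler_expR -mulr_sumr.
  have : \sum_(K <= j < J) ((2 : R) ^- (j - K)) <= 2.
    rewrite -{1}[K]add0n big_addn.
    under eq_bigr => j _ do rewrite addnK.
    exact: sum_half_le.
  lra.
- exact: nc_prod_invpow_le.
Qed.

Lemma nc_multiplier_real r : 0 <= r <= 1 ->
  1 + \sum_(0 <= j < J) (b j.+1 - b j)%:R * (1 - r ^+ e j) <= nc (multiplier b e J).[(r%:C)%C].
Proof.
move=> /andP[r0 r1]; rewrite horner_multiplier nc_prod.
have h0 j : 0 <= (b j.+1 - b j)%:R * (1 - r ^+ e j).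
  by rewrite mulr_ge0// subr_ge0 exprn_ile1.
apply: (le_trans (prod_1D_ge _ h0)).
apply: ler_prod => j _; rewrite addr_ge0//= -rmorphXn nc_invpow_real//.
by rewrite exprn_ge0//= exprn_ile1.
Qed.

(** Summation by parts; the boundary term 2 b(K) / 2^K is nonnegative and is dropped. *)
Lemma sum_increments_dyadic K :
  \sum_(0 <= j < K) (b j)%:R / 2 ^+ j <= \sum_(0 <= j < K) (b j.+1 - b j)%:R / 2 ^+ j :> R.
Proof.
suff -> : \sum_(0 <= j < K) (b j.+1 - b j)%:R / 2 ^+ j =
    2 * (b K)%:R / 2 ^+ K + \sum_(0 <= j < K) (b j)%:R / 2 ^+ j :> R.
  by rewrite lerDr divr_ge0 ?exprn_ge0// mulr_ge0.
elim: K => [|K IH]; first by rewrite !big_geq// b0 mulr0 mul0r addr0.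
rewrite !big_nat_recr//= IH natrB// exprS; field.
by rewrite expf_neq0.
Qed.

End Multiplier.

(** * Equally spaced nodes compared with the points log n *)

Section NodeSums.
Variable R : realType.
Implicit Types (u v : R).

Lemma count_in_interval u v L : u <= v ->
  \sum_(0 <= l < L) (if u <= l%:R < v then 1 else 0 : R) <= v - u + 1.
Proof.
move=> uv.
(* The added alternative records that, while L is still inside the interval, at most L - u integers
   have been counted. *)
suff [] : \sum_(0 <= l < L) (if u <= l%:R < v then 1 else 0 : R) <= v - u + 1 /\
  (\sum_(0 <= l < L) (if u <= l%:R < v then 1 else 0 : R) <= 0 \/
   \sum_(0 <= l < L) (if u <= l%:R < v then 1 else 0 : R) <= L%:R - u) by [].
elim: L => [|L [IH1 IH2]]; first by rewrite big_geq//; split; [lra | left].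
rewrite big_nat_recr//= -natr1; move: IH1 IH2; set S := bigop _ _ _ => IH1 IH2.
case: ifP => [/andP[uL Lv]|_].
  have h : S <= L%:R - u by case: IH2 => // ?; lra.
  by split; [lra | right; lra].
by rewrite addr0; split => //; case: IH2 => h; [left | right; lra].
Qed.

Variable Delta : R.
Hypothesis Delta_gt0 : 0 < Delta.

(** The integer n with log n <= Delta l < log (n+1). *)
Definition nodefloor (l : nat) : nat := Num.truncn (expR (Delta * l%:R)).

Lemma nodefloorP l :
  (nodefloor l)%:R <= expR (Delta * l%:R) < (nodefloor l).+1%:R.
Proof. by apply: truncn_itv; exact: expR_ge0. Qed.

Lemma nodefloor_gt0 l : (0 < nodefloor l)%N.
Proof.
have /andP[_ h] := nodefloorP l.
have : 1 <= expR (Delta * l%:R) by rewrite -expR0 ler_expR mulr_ge0// ltW.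
by move=> h1; have := le_lt_trans h1 h; rewrite ltr1n.
Qed.

Lemma nodefloor_ln l :
  ln (nodefloor l)%:R <= Delta * l%:R < ln (nodefloor l).+1%:R.
Proof.
have /andP[h1 h2] := nodefloorP l; have n0 := nodefloor_gt0 l.
rewrite -{1}[Delta * _]expRK -{2}[Delta * _]expRK.
by rewrite ler_ln ?ltr_ln ?posrE ?ltr0n ?expR_gt0// h1.
Qed.

Lemma ln_succ_le n : (0 < n)%N -> ln n.+1%:R - ln n%:R <= n%:R^-1 :> R.
Proof.
move=> n0; have n0' : 0 < n%:R :> R by rewrite ltr0n.
rewrite -ln_div ?posrE ?ltr0n//.
have -> : n.+1%:R / n%:R = 1 + n%:R^-1 :> R by rewrite -natr1 mulrDl mulfV ?gt_eqF// mul1r.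
by apply: le_ln1Dx; rewrite (lt_trans (ltrN10 _))// invr_gt0.
Qed.

(** At most (log (n+1) - log n) / Delta + 1 nodes have integer part n; times Delta this is at most
    2/n, because Delta <= 1/N <= 1/n. *)
Lemma sum_nodes_le (V : nat -> R) L N : (forall n, 0 <= V n) -> Delta * N%:R <= 1 ->
  \sum_(0 <= l < L | (nodefloor l <= N)%N) Delta * V (nodefloor l) <=
  \sum_(1 <= n < N.+1) 2 / n%:R * V n.
Proof.
move=> V0 DN.
pose F l n := if nodefloor l == n then Delta * V n else 0.
apply: (@le_trans _ _ (\sum_(0 <= l < L) \sum_(1 <= n < N.+1) F l n)).
  rewrite [leLHS]big_mkcond; apply: ler_sum => l _; case: ifP => lN.
    rewrite (bigD1_seq (nodefloor l)) ?iota_uniq//=; last first.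
      by rewrite mem_index_iota nodefloor_gt0 ltnS.
    rewrite /F eqxx lerDl; apply: sumr_ge0 => n _.
    by case: ifP => // _; rewrite mulr_ge0// ltW.
  by apply: sumr_ge0 => n _; rewrite /F; case: ifP => // _; rewrite mulr_ge0// ltW.
rewrite exchange_big_nat/= !big_nat; apply: ler_sum => n /andP[n0 nN].
have n0' : 0 < n%:R :> R by rewrite ltr0n.
pose u := ln n%:R / Delta; pose v := ln n.+1%:R / Delta.
have uv : u <= v.
  by rewrite ler_pM2r ?invr_gt0// ler_ln ?posrE ?ltr0n// ler_nat.
apply: (@le_trans _ _ (\sum_(0 <= l < L) (Delta * V n) * (if u <= l%:R < v then 1 else 0))).
  apply: ler_sum => l _; rewrite /F; case: eqP => [ln|_]; last first.
    by case: ifP; rewrite ?mulr0// mulr1 mulr_ge0// ltW.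
  have := nodefloor_ln l; rewrite ln /u /v ler_pdivrMr// ltr_pdivlMr// mulrC => ->.
  by rewrite mulr1.
rewrite -mulr_sumr; have c := count_in_interval L uv.
have DV : 0 <= Delta * V n by rewrite mulr_ge0// ltW.
apply: (le_trans (ler_wpM2l DV c)).
rewrite mulrAC ler_wpM2r//.
rewrite /u /v -mulrBl mulrDr mulr1 mulrCA mulfV ?gt_eqF// mulr1.
have h1 := ln_succ_le n0.
have h2 : Delta <= n%:R^-1.
  rewrite -[leRHS]mul1r ler_pdivlMr//; apply: le_trans DN.
  by rewrite ler_pM2l// ler_nat -ltnS.
lra.
Qed.

(** Telescoping: Delta / x^2 <= 2/x - 2/(x + Delta) as soon as Delta <= x. *)
Lemma sum_nodes_tail L N : (1 <= N)%N -> Delta <= ln N.+1%:R ->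
  \sum_(0 <= l < L | (N < nodefloor l)%N) Delta / (Delta * l%:R) ^+ 2 <= 2 / ln N.+1%:R.
Proof.
move=> N1 DX; set X := ln _ in DX *.
have X0 : 0 < X by exact: lt_le_trans DX.
(* The maximum with [X] keeps the right side constant until the nodes enter the tail. *)
suff h : \sum_(0 <= l < L | (N < nodefloor l)%N) Delta / (Delta * l%:R) ^+ 2 <=
    2 / X - 2 / Num.max X (Delta * L%:R).
  apply: (le_trans h); rewrite lerBlDr lerDl divr_ge0//.
  by rewrite le_max ltW.
elim: L => [|L IH]; first by rewrite big_geq// mulr0 (max_l (ltW X0)) subrr.
rewrite big_mkcond big_nat_recr//= -big_mkcond/=.
have mono : Num.max X (Delta * L%:R) <= Num.max X (Delta * L.+1%:R).
  by rewrite ge_max !le_max lexx/= ler_pM2l// ler_nat leqnSn orbT.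
have m0 : 0 < Num.max X (Delta * L%:R) by rewrite lt_max X0.
have m1 : 0 < Num.max X (Delta * L.+1%:R) by rewrite lt_max X0.
case: ifP => hL; last first.
  rewrite addr0; apply: (le_trans IH); rewrite lerD2l lerN2 ler_pM2l//.
  by rewrite lef_pV2 ?posrE.
have /andP[h1 _] := nodefloor_ln L.
have XL : X <= Delta * L%:R.
  apply: le_trans h1; rewrite ler_ln ?posrE ?ltr0n ?nodefloor_gt0//.
  by rewrite ler_nat.
have x0 : 0 < Delta * L%:R by exact: lt_le_trans XL.
have e1 : Num.max X (Delta * L%:R) = Delta * L%:R by rewrite max_r.
have e2 : Num.max X (Delta * L.+1%:R) = Delta * L%:R + Delta.
  by rewrite max_r -natr1 mulrDr mulr1// (le_trans XL)// lerDl ltW.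
move: IH; rewrite e1 e2; move: XL x0; set x := Delta * L%:R => XL x0 IH.
suff : Delta / x ^+ 2 <= 2 / x - 2 / (x + Delta) by move: IH; lra.
have xD : 0 < x + Delta by rewrite addr_gt0.
have -> : 2 / x - 2 / (x + Delta) = 2 * Delta / (x * (x + Delta)).
  by field; rewrite !gt_eqF.
rewrite ler_pdivlMr; last exact: (mulr_gt0 x0 xD).
have -> : Delta / x ^+ 2 * (x * (x + Delta)) = Delta * ((x + Delta) / x).
  by field; rewrite gt_eqF.
rewrite [leRHS]mulrC ler_pM2l// ler_pdivrMr//.
have := le_trans DX XL; lra.
Qed.

(** The sum of n^(-3/2), by telescoping with 2 / sqrt n. *)
Lemma sum_inv_sqrt3 N :
  \sum_(1 <= n < N.+1) Num.sqrt n%:R / (n%:R ^+ 2) <= 3 :> R.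
Proof.
suff h : (0 < N)%N -> \sum_(1 <= n < N.+1) Num.sqrt n%:R / (n%:R ^+ 2) <= 3 - 2 / Num.sqrt N%:R :> R.
  case: N h => [_|N h]; first by rewrite big_geq.
  by apply: (le_trans (h isT)); rewrite lerBlDr lerDl divr_ge0 ?sqrtr_ge0.
elim: N => // N IH _; case: N IH => [_|N /(_ isT) IH].
  by rewrite big_nat1 sqrtr1 expr1n; lra.
rewrite big_nat_recr//=; move: IH; set S := bigop _ _ _ => IH.
set p := Num.sqrt N.+1%:R in IH *; set q := Num.sqrt N.+2%:R.
have p0 : 0 < p by rewrite sqrtr_gt0 ltr0n.
have pq : p <= q by rewrite ler_wsqrtr// ler_nat.
have q0 : 0 < q by exact: lt_le_trans pq.
have p2 : p ^+ 2 = N.+1%:R by rewrite sqr_sqrtr.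
have q2 : q ^+ 2 = N.+2%:R by rewrite sqr_sqrtr.
have d : q ^+ 2 - p ^+ 2 = 1 by rewrite p2 q2 -[N.+2%:R]natr1; ring.
rewrite -q2.
suff : q / q ^+ 2 ^+ 2 <= 2 / p - 2 / q by lra.
have -> : 2 / p - 2 / q = 2 * (q ^+ 2 - p ^+ 2) / (p * q * (q + p)).
  by field; rewrite !gt_eqF// addr_gt0.
have -> : q / q ^+ 2 ^+ 2 = 1 / (q * q * q) by field; rewrite gt_eqF.
rewrite d mulr1 ler_pdivlMr ?mulr_gt0 ?addr_gt0// mulrAC ler_pdivrMr ?mulr_gt0// mul1r.
have h1 : p * q * (q + p) <= q * q * (q + q).
  apply: ler_pM; [by rewrite mulr_ge0// ltW | by rewrite addr_ge0// ltW | by rewrite ler_pM2r | by rewrite lerD2l].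
by apply: (le_trans h1); rewrite le_eqVlt; apply/orP; left; apply/eqP; ring.
Qed.

End NodeSums.

(** * First-order condition for a discrete minimizer *)

Section Variation.
Variable R : realType.

Lemma Re_sum I (r : seq I) (P : pred I) (F : I -> R[i]) :
  complex.Re (\sum_(i <- r | P i) F i) = \sum_(i <- r | P i) complex.Re (F i).
Proof. by elim/big_rec2: _ => [//|i x z _ <-]; case: (F i) z => ? ? [? ?]. Qed.

Lemma conjcM (z w : R[i]) : ((z * w)^*)%C = (z^*)%C * (w^*)%C.
Proof. by case: z w => [a b] [c d]; rewrite /= !ComplexM /=; congr Complex; ring. Qed.

Lemma conjc_ofR (x : R) : (((x%:C)%C)^*)%C = (x%:C)%C.
Proof. by rewrite /= oppr0. Qed.

Lemma ofRM (x y : R) : ((x * y)%:C)%C = (x%:C)%C * (y%:C)%C.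
Proof. exact: rmorphM. Qed.

Lemma ReZ (c : R) (z : R[i]) : complex.Re ((c%:C)%C * z) = c * complex.Re z.
Proof. by case: z => x y; rewrite ComplexM /= mul0r subr0. Qed.

Lemma nc_sqrD (z w : R[i]) (s : R) :
  nc (z + (s%:C)%C * w) ^+ 2 =
  nc z ^+ 2 + s * (2 * complex.Re ((z^*)%C * w)) + s ^+ 2 * nc w ^+ 2.
Proof.
rewrite !nc_sqr; case: z => x y; case: w => x' y' /=; ring.
Qed.

Lemma linear_coef_ge0 (X Y : R) : 0 <= Y ->
  (forall s, 0 < s <= 1 -> 0 <= s * X + s ^+ 2 * Y) -> 0 <= X.
Proof.
move=> Y0 h; rewrite leNgt; apply/negP => X0.
pose s := Num.min 1 (- X / (2 * (Y + 1))).
have Y1 : 0 < 2 * (Y + 1) by lra.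
have s0 : 0 < s by rewrite lt_min ltr01 divr_gt0// oppr_gt0.
have s1 : s <= 1 by rewrite ge_min lexx.
have sX : s * (2 * (Y + 1)) <= - X by rewrite -ler_pdivlMr// ge_min lexx orbT.
have := h s; rewrite s0 s1 => /(_ isT).
have -> : s * X + s ^+ 2 * Y = s * (X + s * Y) by ring.
rewrite pmulr_rge0// => h2.
have : 0 <= s * Y by rewrite mulr_ge0// ltW.
lra.
Qed.

Variables (Phi : nat -> R) (H : R) (N m : nat) (a : nat -> R[i]).
Hypothesis Phi_gt0 : forall n : nat, (2 <= n)%N -> 0 < Phi n.
Hypothesis H_gt0 : 0 < H.
Hypothesis m_gt0 : (0 < m)%N.
Hypothesis a_adm : admissible Phi N a.
Hypothesis a_min : forall b, admissible Phi N b -> denergy H N a m <= denergy H N b m.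

Definition sample (k : nat) : R[i] := ((H / m%:R)%:C)%C * dirpoly a N (k%:R * (H / m%:R)).

(** Discrete Fourier transform of the minimizer. At log n it is the derivative of the discrete
    energy in the n-th coefficient, up to conjugation and the factor 2 d(n)/n. *)
Definition dtransform (x : R) : R[i] :=
  \sum_(0 <= k < m) sample k * cis (- (k%:R * (H / m%:R) * x)).

Let eta := H / m%:R.
Let eta_gt0 : 0 < eta.
Proof. by rewrite divr_gt0// ltr0n. Qed.

(** The admissible coefficient pointing against the transform; where the transform vanishes,
    division by zero makes it 0, which is admissible as well. *)
Let a' n : R[i] := - (((Phi n)%:C)%C * (dtransform (ln n%:R) / ((nc (dtransform (ln n%:R)))%:C)%C)).

Let a'_adm : admissible Phi N a'.
Proof.
move=> n /andP[n2 _]; rewrite /a' ncN ncM nc_real ger0_norm ?(ltW (Phi_gt0 _))//.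
rewrite ncM ncV nc_real ger0_norm ?nc_ge0//.
have := nc_ge0 (dtransform (ln n%:R)); rewrite le_eqVlt => /orP[/eqP <-|h].
  by rewrite mul0r mulr0 ltW ?Phi_gt0.
by rewrite mulfV ?gt_eqF// mulr1.
Qed.

Let mix (s : R) n := a n + (s%:C)%C * (a' n - a n).

Let mix_adm s : 0 < s <= 1 -> admissible Phi N (mix s).
Proof.
move=> /andP[s0 s1] n hn.
have -> : mix s n = ((1 - s)%:C)%C * a n + (s%:C)%C * a' n.
  by rewrite /mix rmorphB rmorph1; ring.
apply: (le_trans (ncD _ _)); rewrite !ncZ !ger0_norm ?subr_ge0 ?(ltW s0)//.
have h1 := a_adm hn; have h2 := a'_adm hn.
have -> : Phi n = (1 - s) * Phi n + s * Phi n by ring.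
by apply: lerD; [rewrite ler_wpM2l// subr_ge0 | rewrite ler_pM2l].
Qed.

Let dirpoly_mix s t :
  dirpoly (mix s) N t = dirpoly a N t + (s%:C)%C * (dirpoly a' N t - dirpoly a N t).
Proof.
rewrite !dirpolyE opprD addrACA subrr add0r -addrA; congr (_ + _).
rewrite -sumrB mulr_sumr -big_split/=; apply: eq_bigr => n _.
by rewrite /mix; ring.
Qed.

Let sum_conj :
  (eta%:C)%C * \sum_(0 <= k < m) ((dirpoly a N (k%:R * eta))^*)%C * dirpoly a' N (k%:R * eta) =
  ((dtransform 0)^*)%C -
  ((\sum_(2 <= n < N.+1) Phi n * divw R n * nc (dtransform (ln n%:R)))%:C)%C.
Proof.
have conjG x : ((dtransform x)^*)%C =
    (eta%:C)%C * \sum_(0 <= k < m) ((dirpoly a N (k%:R * eta))^*)%C * cis (k%:R * eta * x).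
  rewrite /dtransform rmorph_sum mulr_sumr; apply: eq_bigr => k _.
  rewrite /sample -/eta.
  have -> : cis (k%:R * eta * x) = ((cis (- (k%:R * eta * x)))^*)%C by rewrite cis_conj opprK.
  by rewrite -[LHS]/((_^*)%C) !conjcM conjc_ofR mulrA.
rewrite (conjG 0).
under eq_bigr => k _ do rewrite [dirpoly a' _ _]dirpolyE mulrDr mulr1 mulr_sumr.
rewrite big_split/= mulrDr; congr (_ + _).
  by congr (_ * _); apply: eq_bigr => k _; rewrite mulr0 cis0 mulr1.
rewrite exchange_big_nat/= mulr_sumr rmorph_sum -sumrN; apply: eq_bigr => n _.
transitivity (a' n * ((divw R n)%:C)%C * ((dtransform (ln n%:R))^*)%C).
  rewrite conjG !mulr_sumr; apply: eq_bigr => k _; ring.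
rewrite /a'; set G := dtransform _.
have [G0|G0] := eqVneq (nc G) 0.
  by rewrite (Normc.eq0_normc G0) nc0 !mul0r !mulr0 oppr0 !mul0r.
have G0' : ((nc G)%:C)%C != 0 by rewrite fmorph_eq0.
transitivity (- (((Phi n)%:C)%C * ((divw R n)%:C)%C * (G * (G^*)%C) / ((nc G)%:C)%C)).
  by field.
rewrite ReM_conj_nc expr2 (ofRM (nc G)).
rewrite -[X in _ = - X]/(((Phi n * divw R n * nc G)%:C)%C) (ofRM (Phi n * divw R n)) (ofRM (Phi n)).
by field.
Qed.

(* First-order condition for the minimizer along the segment towards a', where a' n
   is - Phi n times the phase of the transform at ln n. *)
Lemma variational_ineq :
  denergy H N a m + \sum_(2 <= n < N.+1) Phi n * divw R n * nc (dtransform (ln n%:R))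
  <= complex.Re (dtransform 0).
Proof.
pose f k := dirpoly a N (k%:R * eta); pose f' k := dirpoly a' N (k%:R * eta).
pose X := eta * \sum_(0 <= k < m) complex.Re (((f k)^*)%C * (f' k - f k)).
pose Y := eta * \sum_(0 <= k < m) nc (f' k - f k) ^+ 2.
have Y0 : 0 <= Y by rewrite mulr_ge0 ?(ltW eta_gt0)// sumr_ge0// => k _; rewrite sqr_ge0.
have X0 : 0 <= 2 * X.
  apply: (linear_coef_ge0 Y0) => s hs.
  have := a_min (mix_adm hs); rewrite /denergy -/eta -subr_ge0.
  under [X in _ * X - _]eq_bigr => k _ do rewrite dirpoly_mix nc_sqrD.
  rewrite -mulrBr -sumrB => h; apply: (le_trans h); rewrite le_eqVlt; apply/orP; left; apply/eqP.
  rewrite /X /Y !mulr_sumr -big_split/=; apply: eq_bigr => k _.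
  by rewrite -/(f k) -/(f' k); ring.
have EX : X = complex.Re (dtransform 0) -
   \sum_(2 <= n < N.+1) Phi n * divw R n * nc (dtransform (ln n%:R)) - denergy H N a m.
  have h := congr1 (@complex.Re R) sum_conj; rewrite ReZ Re_sum in h.
  have e1 : complex.Re ((dtransform 0)^*)%C = complex.Re (dtransform 0).
    by case: (dtransform 0).
  have e2 (z : R[i]) (c : R) : complex.Re (z - (c%:C)%C) = complex.Re z - c.
    by case: z.
  rewrite e2 e1 in h; rewrite -h /X /denergy -/eta -mulrBr -sumrB.
  congr (_ * _); apply: eq_bigr => k _; rewrite -/(f k) -/(f' k).
  rewrite mulrBr; have -> : ((f k)^*)%C * f k = ((nc (f k) ^+ 2)%:C)%C.
    by rewrite mulrC ReM_conj_nc.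
  by rewrite e2.
by move: X0; rewrite EX; lra.
Qed.

End Variation.

(** * Polynomials on the circle, box kernels and the Cauchy kernel *)

Section Kernel.
Variable R : realType.
Implicit Types (x y r B H eta : R) (c : nat -> R[i]) (z : R[i]).

Lemma horner_polyN c m z : (\poly_(k < m) c k).[z] = \sum_(0 <= k < m) c k * z ^+ k.
Proof. by rewrite horner_poly big_mkord. Qed.

Lemma nc_horner_poly c m z B : \sum_(0 <= k < m) nc (c k) <= B -> nc z <= 1 ->
  nc (\poly_(k < m) c k).[z] <= B.
Proof.
move=> cB z1; rewrite horner_polyN; apply: le_trans cB.
apply: (le_trans (nc_sum _ _ _)); apply: ler_sum => k _.
by rewrite ncM ncX ler_piMr ?nc_ge0// exprn_ile1// nc_ge0.
Qed.

Lemma nc_horner_polyB_cis c m B x y : \sum_(0 <= k < m) nc (c k) <= B ->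
  nc ((\poly_(k < m) c k).[cis x] - (\poly_(k < m) c k).[cis y]) <= B * (m%:R * `|x - y|).
Proof.
move=> cB; rewrite !horner_polyN -sumrB.
have h0 : 0 <= m%:R * `|x - y| by rewrite mulr_ge0.
apply: le_trans (ler_wpM2r h0 cB); rewrite mulr_suml.
apply: (le_trans (nc_sum _ _ _)); rewrite !big_nat; apply: ler_sum => k /andP[_ km].
rewrite -mulrBr ncM ler_wpM2l ?nc_ge0// !cisX (le_trans (nc_cisB _ _))//.
by rewrite -mulrBr normrM ger0_norm// ler_wpM2r// ler_nat ltnW.
Qed.

Lemma sub1X_le r k : 0 <= r <= 1 -> 1 - r ^+ k <= k%:R * (1 - r).
Proof.
move=> /andP[r0 r1]; elim: k => [|k IH]; first by rewrite expr0 subrr mul0r.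
have h1 : r ^+ k <= 1 by exact: exprn_ile1.
rewrite exprS -natr1; have := ler_wpM2r (_ : 0 <= 1 - r) h1.
rewrite subr_ge0 => /(_ r1); lra.
Qed.

Lemma nc_horner_polyB_real c m B r : \sum_(0 <= k < m) nc (c k) <= B -> 0 <= r <= 1 ->
  nc ((\poly_(k < m) c k).[1] - (\poly_(k < m) c k).[(r%:C)%C]) <= B * (m%:R * (1 - r)).
Proof.
move=> cB hr; have /andP[r0 r1] := hr; rewrite !horner_polyN -sumrB.
have h0 : 0 <= m%:R * (1 - r) by rewrite mulr_ge0// subr_ge0.
apply: le_trans (ler_wpM2r h0 cB); rewrite mulr_suml.
apply: (le_trans (nc_sum _ _ _)); rewrite !big_nat; apply: ler_sum => k /andP[_ km].
rewrite -mulrBr ncM ler_wpM2l ?nc_ge0//.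
have -> : 1 ^+ k - ((r%:C)%C) ^+ k = ((1 - r ^+ k)%:C)%C.
  by rewrite expr1n -rmorphXn rmorphB rmorph1.
rewrite nc_real ger0_norm ?subr_ge0 ?exprn_ile1//.
apply: (le_trans (sub1X_le _ hr)).
by rewrite ler_wpM2r ?subr_ge0// ler_nat ltnW.
Qed.

(** Conjugating the coefficients reflects x to -x on the circle and keeps the modulus at real
    points. *)
Lemma nc_horner_conj c m z :
  nc (\poly_(k < m) ((c k)^*)%C).[z] = nc (\poly_(k < m) c k).[(z^*)%C].
Proof.
rewrite -nc_conj; congr nc; rewrite !horner_polyN rmorph_sum.
apply: eq_bigr => k _; rewrite rmorphM rmorphXn; congr (_ * _).
exact: conjcK.
Qed.

Lemma nc_1BZcisN r x : nc (1 - (r%:C)%C * cis (- x)) = nc (1 - (r%:C)%C * cis x).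
Proof. by rewrite /cis cosN sinN !ComplexM /=; congr Num.sqrt; ring. Qed.

Lemma nc_1BcisN x : nc (1 - cis (- x)) = nc (1 - cis x).
Proof. by rewrite !nc_1Bcis mulNr sinN normrN. Qed.

(** The nodes l and 2M - l are conjugate and share the Cauchy kernel, so only angles in [0, pi]
    remain, where chord and arc are comparable. *)
Lemma nc_horner_sym (P : {poly R[i]}) M r (Bd : nat -> R) : (0 < M)%N -> (size P <= M.*2)%N -> 0 <= r < 1 ->
  (forall l, (l <= M)%N ->
    nc P.[cis (rnode R M.*2 l)] / nc (1 - (r%:C)%C * cis (rnode R M.*2 l)) <= Bd l /\
    nc P.[cis (- rnode R M.*2 l)] / nc (1 - (r%:C)%C * cis (rnode R M.*2 l)) <= Bd l) ->
  nc P.[(r%:C)%C] <= 2 / M%:R * \sum_(0 <= l < M.+1) Bd l.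
Proof.
move=> M0 sP hr hB.
have M0' : 0 < M%:R :> R by rewrite ltr0n.
have Bd0 l : (l <= M)%N -> 0 <= Bd l.
  by move=> /hB[h _]; apply: le_trans h; rewrite divr_ge0 ?nc_ge0.
have MM : (0 < M.*2)%N by rewrite double_gt0.
apply: (le_trans (nc_horner_rnode MM sP hr)).
pose h l := nc P.[cis (rnode R M.*2 l)] / nc (1 - (r%:C)%C * cis (rnode R M.*2 l)).
have -> : 2 / M.*2%:R = M%:R^-1 :> R by rewrite -mul2n natrM; field; rewrite gt_eqF.
rewrite mulrC [leRHS]mulrC mulrA ler_pM2r ?invr_gt0//.
rewrite (big_cat_nat (n := M.+1))//; last by lia.
rewrite mulr_natr mulr2n; apply: lerD.
  by rewrite !big_nat; apply: ler_sum => l /andP[_ lM]; case: (hB l).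
rewrite big_nat_rev -{1}[M.+1]add0n big_addn.
apply: (@le_trans _ _ (\sum_(0 <= l < M - 1) Bd l.+1)).
  rewrite (_ : (M.*2 - M.+1 = M - 1)%N); last by lia.
  rewrite !big_nat; apply: ler_sum => l /andP[_ lM].
  have -> : (M.+1 + M.*2 - (l + M.+1).+1 = M.*2 - l.+1)%N by lia.
  have e : cis (rnode R M.*2 (M.*2 - l.+1)) = cis (- rnode R M.*2 l.+1).
    have -> : rnode R M.*2 (M.*2 - l.+1) = - rnode R M.*2 l.+1 + pi *+ 2.
      rewrite /rnode natrB; last by lia.
      by field; rewrite pnatr_eq0 -lt0n.
    by rewrite cisD [cis (pi *+ 2)]/cis cos2pi sin2pi mulr1.
  have [_] := hB l.+1 ltac:(lia).
  by rewrite e nc_1BZcisN.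
rewrite [leRHS]big_nat_recl// ler_wpDl ?Bd0//.
rewrite (big_cat_nat (n := (M - 1)%N) (p := M))//=; last by lia.
by rewrite lerDl big_nat; apply: sumr_ge0 => l /andP[_ lM]; exact: Bd0.
Qed.

Lemma sub_expRN_ge x : 0 <= x <= 1 -> x / 2 <= 1 - expR (- x).
Proof.
move=> /andP[x0 x1]; have h := expR_ge1Dx x.
have e : expR x * expR (- x) = 1 by rewrite expRxMexpNx_1.
have p := expR_gt0 (- x).
nra.
Qed.

Definition boxpoly m : {poly R[i]} := \poly_(k < m) ((m%:R^-1)%:C)%C.

Lemma nc_boxpoly_le1 m z : nc z <= 1 -> nc (boxpoly m).[z] <= 1.
Proof.
case: m => [|m] z1; first by rewrite /boxpoly horner_polyN big_geq// nc0.
apply: nc_horner_poly => //.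
rewrite sumr_const_nat subn0 nc_real ger0_norm ?invr_ge0//.
by rewrite -[X in X <= _]mulr_natr mulVf// pnatr_eq0.
Qed.

Lemma boxpoly_geom m z : (0 < m)%N -> (1 - z) * (boxpoly m).[z] = ((m%:R^-1)%:C)%C * (1 - z ^+ m).
Proof.
move=> m0; rewrite /boxpoly horner_poly -mulr_sumr mulrCA; congr (_ * _).
by rewrite -[RHS]opprB subrX1 -[RHS]mulNr opprB.
Qed.

Lemma nc_boxpoly_cis m x : (0 < m)%N -> 0 < `|x| <= pi ->
  nc (boxpoly m).[cis x] <= 4 / (m%:R * `|x|).
Proof.
move=> m0 /andP[x0 xpi]; have m0' : 0 < m%:R :> R by rewrite ltr0n.
have h : `|x| / 2 <= nc (1 - cis x).
  have -> : nc (1 - cis x) = nc (1 - cis `|x|).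
    by case: (leP 0 x) => hx; [rewrite ger0_norm | rewrite ltr0_norm// nc_1BcisN].
  by apply: nc_1Bcis_ge; rewrite ltW.
have h0 : 0 < nc (1 - cis x) by apply: lt_le_trans h; rewrite divr_gt0.
have e := congr1 nc (boxpoly_geom (cis x) m0); rewrite !ncM nc_real ger0_norm ?invr_ge0// in e.
have h2 : nc (1 - cis x ^+ m) <= 2.
  by apply: (le_trans (ncD _ _)); rewrite nc1 ncN ncX nc_cis expr1n.
have h3 : `|x| / 2 * nc (boxpoly m).[cis x] <= m%:R^-1 * 2.
  apply: (@le_trans _ _ (nc (1 - cis x) * nc (boxpoly m).[cis x])).
    by rewrite ler_wpM2r ?nc_ge0.
  by rewrite e ler_wpM2l// invr_ge0.
rewrite invfM mulrA mulrC ler_pdivlMl//.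
move: h3; move: (nc (boxpoly m).[cis x]) (m%:R^-1) => u v; lra.
Qed.

Lemma nc_boxpoly_real m r : (0 < m)%N -> 0 <= r <= 1 -> r ^+ m <= nc (boxpoly m).[(r%:C)%C].
Proof.
move=> m0 /andP[r0 r1].
have -> : (boxpoly m).[(r%:C)%C] = ((\sum_(0 <= k < m) m%:R^-1 * r ^+ k)%:C)%C.
  rewrite /boxpoly horner_polyN rmorph_sum; apply: eq_bigr => k _.
  by rewrite rmorphM rmorphXn.
rewrite nc_real; apply: le_trans (ler_norm _).
have -> : r ^+ m = \sum_(0 <= k < m) m%:R^-1 * r ^+ m.
  rewrite sumr_const_nat subn0 -[RHS]mulr_natr mulrAC mulVf ?mul1r//.
  by rewrite pnatr_eq0 -lt0n.
rewrite !big_nat; apply: ler_sum => k /andP[_ km]; rewrite ler_wpM2l ?invr_ge0//.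
by apply: ler_wiXn2l => //; exact: ltnW.
Qed.

Lemma nc_cauchy_le1 eta y x : 0 < eta -> 0 < y -> eta * y <= 1 ->
  eta / nc (1 - ((expR (- (eta * y)))%:C)%C * cis x) <= 2 / y.
Proof.
move=> e0 y0 ey; set r := expR _.
have r1 : eta * y / 2 <= 1 - r by apply: sub_expRN_ge; rewrite ey mulr_ge0// ltW.
have h : 1 - r <= nc (1 - (r%:C)%C * cis x).
  by have := ncB_ge 1 ((r%:C)%C * cis x); rewrite nc1 ncM nc_cis mulr1 nc_real ger0_norm// expR_ge0.
have ey0 : 0 < eta * y by rewrite mulr_gt0.
have p : 0 < nc (1 - (r%:C)%C * cis x) by lra.
rewrite ler_pdivrMr// mulrAC ler_pdivlMr//.
move: (nc _) h p => u h p; lra.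
Qed.

(** Moving the pole from radius 1 to r at most halves the distance: |1 - w| <= |1 - r w| + (1 - r)
    <= 2 |1 - r w| for |w| = 1. *)
Lemma nc_cauchy_le2 eta y x : 0 < eta -> 0 < y -> 0 < x -> eta * x <= pi ->
  eta / nc (1 - ((expR (- (eta * y)))%:C)%C * cis (eta * x)) <= 4 / x.
Proof.
move=> e0 y0 x0 xpi; set r := expR _.
have r1 : r <= 1 by rewrite expR_le1 oppr_le0 mulr_ge0// ltW.
have r0 : 0 < r by exact: expR_gt0.
have ex0 : 0 < eta * x by rewrite mulr_gt0.
have h1 : eta * x / 2 <= nc (1 - cis (eta * x)).
  by apply: nc_1Bcis_ge; rewrite xpi ltW.
have h2 : nc (1 - cis (eta * x)) <= 2 * nc (1 - (r%:C)%C * cis (eta * x)).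
  have -> : 1 - cis (eta * x) = (1 - (r%:C)%C * cis (eta * x)) - ((1 - r)%:C)%C * cis (eta * x).
    by rewrite rmorphB rmorph1; ring.
  apply: (le_trans (ncD _ _)); rewrite ncN ncM nc_cis mulr1 nc_real ger0_norm ?subr_ge0//.
  have := ncB_ge 1 ((r%:C)%C * cis (eta * x)); rewrite nc1 ncM nc_cis mulr1 nc_real.
  rewrite (ger0_norm (ltW r0)); move: (nc _) => u; lra.
have p : 0 < nc (1 - (r%:C)%C * cis (eta * x)) by lra.
rewrite ler_pdivrMr// mulrAC ler_pdivlMr//.
move: (nc (1 - (r%:C)%C * _)) h2 p => u h2 p; lra.
Qed.

End Kernel.

(** * The discrete minimum tends to 0 in the divergent case *)

Section DivergentCase.
Variables (R : realType) (Phi : nat -> R) (H : R).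
Hypothesis Phi_gt0 : forall n : nat, (2 <= n)%N -> 0 < Phi n.
Hypothesis Phi_incr : forall m n : nat, (2 <= m)%N -> (m <= n)%N -> Phi m <= Phi n.
Hypothesis H_gt0 : 0 < H.

Lemma tower_block n : (2 <= n)%N -> exists k, (tower k <= n < tower k.+1)%N.
Proof.
move=> n2; have l0 : (0 < trunc_log 2 n)%N by rewrite trunc_log_gt0.
exists (trunc_log 2 (trunc_log 2 n)); rewrite /tower.
have /andP[h1 h2] := trunc_log_bounds (isT : 1 < 2)%N (ltnW n2 : 0 < n)%N.
have /andP[h3 h4] := trunc_log_bounds (isT : 1 < 2)%N l0.
apply/andP; split; first by apply: leq_trans h1; rewrite leq_exp2l.
by apply: (leq_trans h2); rewrite leq_exp2l.
Qed.

(** The reason for a dyadic mesh: widths h / 2^(a0 + j) are exact multiples of it. *)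
Lemma exp2_sub_scale (h : R) r j a0 : (j + a0 <= r)%N ->
  (2 ^ (r - j - a0))%:R * (h / (2 ^ r)%:R) = h / 2 ^+ a0 / 2 ^+ j.
Proof.
move=> hr; rewrite -subnDA -{2}(subnK hr) expnD natrM !natrX exprD; field.
by rewrite !expf_neq0.
Qed.

Lemma denergy0 N m : (0 < m)%N -> denergy H N (fun=> 0) m = H.
Proof.
move=> m0; rewrite /denergy (eq_bigr (fun=> 1)) => [|k _].
  rewrite sumr_const_nat subn0; field.
  by rewrite pnatr_eq0 -lt0n.
by rewrite dirpolyE big1 ?addr0 ?nc1 ?expr1n// => n _; rewrite !mul0r.
Qed.

(** Termwise |u| <= (1 + |u|^2) / 2. *)
Lemma sum_nc_sample N m a : (0 < m)%N -> denergy H N a m <= H ->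
  \sum_(0 <= k < m) nc (sample H N m a k) <= H.
Proof.
move=> m0 hE; have m0' : 0 < m%:R :> R by rewrite ltr0n.
have e0 : 0 < H / m%:R by rewrite divr_gt0.
apply: (@le_trans _ _ (\sum_(0 <= k < m) ((H / m%:R) / 2 + (H / m%:R * nc (dirpoly a N (k%:R * (H / m%:R))) ^+ 2) / 2))).
  apply: ler_sum => k _; rewrite /sample ncM nc_real gtr0_norm//.
  move: (nc (dirpoly _ _ _)) => u.
  have := mulr_ge0 (ltW e0) (sqr_ge0 (u - 1)); move: (H / m%:R) => v; nra.
rewrite big_split/=.
have -> : \sum_(0 <= k < m) H / m%:R / 2 = H / 2.
  by rewrite sumr_const_nat subn0 -[LHS]mulr_natr; field; rewrite gt_eqF.
rewrite -mulr_suml -mulr_sumr -/(denergy H N a m); lra.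
Qed.

(** The three terms come from the nodes below log 2, those up to log (N+1), and the tail. None
    depends on [J], [N] or the mesh. *)
Definition log_integral_bound (y : R) : R :=
  8 * H ^+ 2 / y + 256 * (H / Phi 2 + 3 * H ^+ 2) + 32 * H.

Section Core.
Variables (r N J a0 : nat) (b : nat -> nat) (a : nat -> R[i]) (eps y : R).
Hypothesis b0 : b 0 = 0%N.
Hypothesis b_mono : forall j, (b j <= b j.+1)%N.
Hypothesis b_Phi : forall k n, (tower k <= n)%N -> 32 ^+ b k.+1 <= Phi n / Phi 2.
Hypothesis b_sqrt : forall k n, (tower k <= n)%N -> 32 ^+ b k.+1 <= Num.sqrt n%:R :> R.
Hypothesis Ha0 : H / 2 ^+ a0 <= 1 / 16.
Hypothesis Jr : (J + a0 <= r)%N.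
Hypothesis y_gt0 : 0 < y.
Hypothesis y_le1 : y <= 1.
Hypothesis Hy_le1 : H * y <= 1.
Hypothesis Hy_eps : H * (H * y) <= eps / 2.
Hypothesis N_ge2 : (2 <= N)%N.
Hypothesis N_large : 32 ^+ b J <= ln N.+1%:R :> R.
Let m := (2 ^ r)%N.
Hypothesis a_adm : admissible Phi N a.
Hypothesis a_min : forall a', admissible Phi N a' -> denergy H N a m <= denergy H N a' m.
Hypothesis eps_gt0 : 0 < eps.
Hypothesis eps_le : eps <= denergy H N a m.

Let eta := H / m%:R.
Let e j := (2 ^ (r - j - a0))%N.
Let g (n : nat) := nc (dtransform H N m a (ln n%:R)).
Let p : {poly R[i]} := \poly_(k < m) sample H N m a k.
Let pc : {poly R[i]} := \poly_(k < m) ((sample H N m a k)^*)%C.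
Let E := multiplier R b e J.
(* On the unit circle |pc(q)| = |p(q^-1)|, so p * pc is small for both signs of x. *)
Let P := p * pc * boxpoly R m * E.
Let rho := expR (- (eta * y)).

Let m_gt0 : (0 < m)%N. Proof. by rewrite expn_gt0. Qed.
Let m_gt0' : 0 < m%:R :> R. Proof. by rewrite ltr0n. Qed.
Let eta_gt0 : 0 < eta. Proof. by rewrite divr_gt0. Qed.
Let m_eta : m%:R * eta = H. Proof. by rewrite /eta mulrCA mulfV ?mulr1// gt_eqF. Qed.

Let e_eta j : (j < J)%N -> (e j)%:R * eta = H / 2 ^+ a0 / 2 ^+ j.
Proof.
by move=> jJ; apply: exp2_sub_scale; apply: leq_trans Jr; rewrite leq_add2r ltnW.
Qed.

Let he j : (j < J)%N -> (e j)%:R * eta <= (1 / 16) / 2 ^+ j.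
Proof. by move=> jJ; rewrite e_eta// ler_pM2r// invr_gt0 exprn_gt0. Qed.

Let dtransformE x : dtransform H N m a x = p.[cis (- (eta * x))].
Proof.
rewrite /p horner_polyN /dtransform; apply: eq_bigr => k _.
by rewrite cisX; congr (_ * cis _); rewrite -/eta; ring.
Qed.

Let energy_le : denergy H N a m <= H.
Proof.
apply: le_trans (_ : denergy H N (fun=> 0) m <= H); last by rewrite denergy0.
apply: a_min => n /andP[n2 _].
by rewrite nc0 ltW ?Phi_gt0.
Qed.

Let mass := sum_nc_sample m_gt0 energy_le.

Let dtransform_le x : nc (dtransform H N m a x) <= H.
Proof. by rewrite dtransformE; apply: nc_horner_poly; rewrite ?nc_cis. Qed.

Let dtransform_lip x x' :
  nc (dtransform H N m a x) <= nc (dtransform H N m a x') + H ^+ 2 * `|x - x'|.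
Proof.
rewrite -lerBlDl; apply: (le_trans (ncB_ge _ _)); rewrite !dtransformE.
apply: (le_trans (nc_horner_polyB_cis _ _ mass)).
rewrite -opprD normrN -mulrBr normrM gtr0_norm// [X in H * X]mulrA m_eta.
by rewrite mulrA expr2.
Qed.

Let nc_pair x : nc p.[cis x] * nc pc.[cis x] = nc p.[cis x] * nc p.[cis (- x)].
Proof. by rewrite /pc nc_horner_conj cis_conj. Qed.

Let nc_pair_le x : nc p.[cis (eta * x)] * nc pc.[cis (eta * x)] <= H * nc (dtransform H N m a x)
  /\ nc p.[cis (- (eta * x))] * nc pc.[cis (- (eta * x))] <= H * nc (dtransform H N m a x).
Proof.
rewrite !nc_pair opprK -dtransformE.
have h : nc p.[cis (eta * x)] <= H by apply: nc_horner_poly; rewrite ?nc_cis.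
by split; [|rewrite mulrC]; rewrite ler_wpM2r ?nc_ge0.
Qed.

Let ncP z : nc P.[z] = nc p.[z] * nc pc.[z] * nc (boxpoly R m).[z] * nc E.[z].
Proof. by rewrite /P !hornerM !ncM. Qed.

(** For n = 1 nothing controls the transform and the Cauchy kernel is bounded through [y]. For n >=
    2 the second summand is the cost of replacing a node by log n. *)
Let V (n : nat) : R := if (n < 2)%N then 4 * H ^+ 2 / y else
  128 * (g n * (Phi n / Phi 2) + H ^+ 2 * (Num.sqrt n%:R / n%:R)).

Let Phi2_gt0 : 0 < Phi 2. Proof. exact: Phi_gt0. Qed.

Let V_ge0 n : 0 <= V n.
Proof.
rewrite /V; case: ltnP => n2; first by rewrite divr_ge0 ?(ltW y_gt0)// mulr_ge0// sqr_ge0.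
rewrite mulr_ge0// addr_ge0//.
  by rewrite mulr_ge0 ?nc_ge0// ltW// divr_gt0// Phi_gt0.
by rewrite mulr_ge0 ?sqr_ge0// divr_ge0// sqrtr_ge0.
Qed.

Let sum_V : \sum_(1 <= n < N.+1) 2 / n%:R * V n <=
  8 * H ^+ 2 / y + 256 * (H / Phi 2 + 3 * H ^+ 2).
Proof.
rewrite big_ltn; last by rewrite ltnS ltnW.
apply: lerD; first by rewrite /V /= divr1 !mulrA -natrM.
have hvar := variational_ineq Phi_gt0 H_gt0 m_gt0 a_adm a_min.
have hRe : complex.Re (dtransform H N m a 0) <= H.
  exact: le_trans (Re_le_nc _) (dtransform_le 0).
have hD : 0 <= denergy H N a m by exact: le_trans (ltW eps_gt0) eps_le.
apply: (@le_trans _ _ (256 * ((\sum_(2 <= n < N.+1) Phi n * divw R n * g n) / Phi 2 +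
    H ^+ 2 * \sum_(2 <= n < N.+1) Num.sqrt n%:R / n%:R ^+ 2))).
  rewrite mulr_suml mulr_sumr -big_split/= mulr_sumr !big_nat.
  apply: ler_sum => n /andP[n2 _]; have n0 : (0 < n)%N by exact: ltnW.
  have n0' : 0 < n%:R :> R by rewrite ltr0n.
  rewrite /V ltnNge n2 /=.
  have -> : 2 / n%:R * (128 * (g n * (Phi n / Phi 2) + H ^+ 2 * (Num.sqrt n%:R / n%:R))) =
    256 * (Phi n * n%:R^-1 * g n / Phi 2 + H ^+ 2 * (Num.sqrt n%:R / n%:R ^+ 2)).
    by field; rewrite !gt_eqF.
  rewrite ler_pM2l; last by rewrite ltr0n.
  (* The nodes carry weight 1/n whereas the variational inequality carries d(n)/n; d(n) >= 1 closes
     the gap. *)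
  rewrite lerD2r ler_pM2r ?invr_gt0// ler_wpM2r ?nc_ge0//.
  rewrite ler_pM2l ?Phi_gt0// /divw -[X in X <= _]mul1r ler_pM2r ?invr_gt0//.
  by rewrite ler1n /ndiv; case: (divisors n) (divisors_id n0) => //; rewrite divisors_id.
rewrite ler_pM2l; last by rewrite ltr0n.
apply: lerD.
  by rewrite ler_pM2r ?invr_gt0//; move: hvar; rewrite -/g; lra.
rewrite mulrC ler_wpM2r ?sqr_ge0//.
apply: le_trans (sum_inv_sqrt3 R N).
rewrite [leRHS]big_ltn; last by rewrite ltnS ltnW.
by rewrite lerDr divr_ge0 ?sqrtr_ge0.
Qed.

Let node_bound (Delta : R) l s : 0 < Delta -> eta * (Delta * l%:R) <= pi ->
  s = eta * (Delta * l%:R) \/ s = - (eta * (Delta * l%:R)) ->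
  nc P.[cis s] * (eta / nc (1 - (rho%:C)%C * cis (eta * (Delta * l%:R)))) <=
  if (nodefloor Delta l <= N)%N then V (nodefloor Delta l)
  else 16 * H * 32 ^+ b J / (Delta * l%:R) ^+ 2.
Proof.
move=> D0; set x := Delta * l%:R => xpi hs.
have x0 : 0 <= x by rewrite mulr_ge0// ltW.
have sx : s = eta * (if s == eta * x then x else - x).
  by case: eqP => // hne; rewrite mulrN; case: hs.
set x' := (if _ then _ else _) in sx.
have x'x : `|x'| = x by rewrite /x'; case: ifP => _; rewrite ?normrN ger0_norm.
have hpp : nc p.[cis s] * nc pc.[cis s] <= H * nc (dtransform H N m a x).
  by have [h1 h2] := nc_pair_le x; case: hs => ->.
have hpp0 : 0 <= nc p.[cis s] * nc pc.[cis s] by rewrite mulr_ge0 ?nc_ge0.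
have hpH : nc p.[cis s] * nc pc.[cis s] <= H ^+ 2.
  by apply: (le_trans hpp); rewrite expr2 ler_pM2l.
set K := eta / nc _.
have K0 : 0 <= K by rewrite divr_ge0 ?nc_ge0// ltW.
have K1 : K <= 2 / y.
  apply: nc_cauchy_le1 => //; rewrite /eta mulrAC ler_pdivrMr// mul1r.
  by apply: (le_trans Hy_le1); rewrite ler1n.
have K2 : 0 < x -> K <= 4 / x by move=> xp; exact: nc_cauchy_le2.
clearbody K.
have D1 : nc (boxpoly R m).[cis s] <= 1 by apply: nc_boxpoly_le1; rewrite nc_cis.
have D2 : 0 < x -> nc (boxpoly R m).[cis s] <= 4 / (H * x).
  move=> xp; have sabs : `|s| = eta * x by rewrite sx normrM gtr0_norm// x'x.
  have := @nc_boxpoly_cis R m s m_gt0; rewrite sabs xpi mulr_gt0// => /(_ isT).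
  by rewrite mulrA m_eta.
have E2 k : x <= 2 ^+ k -> nc E.[cis s] <= 2 * 32 ^+ b k.
  by move=> hx; rewrite sx; apply: (nc_multiplier_near b0 b_mono (ltW eta_gt0) he); rewrite x'x.
have E0 : nc E.[cis s] <= 32 ^+ b J by apply: nc_multiplier_le; rewrite ?nc_cis.
have /andP[nf1 nf2] := nodefloor_ln D0 l; rewrite -/x in nf1 nf2.
have nf0 := nodefloor_gt0 D0 l.
rewrite ncP.
have -> : nc p.[cis s] * nc pc.[cis s] * nc (boxpoly R m).[cis s] * nc E.[cis s] * K =
    nc p.[cis s] * nc pc.[cis s] * (nc (boxpoly R m).[cis s] * K * nc E.[cis s]) by ring.
(* Box kernel and Cauchy kernel each contribute one factor 1/x. *)
have far : 1 / 2 <= x -> nc (boxpoly R m).[cis s] * K <= 16 / H / x ^+ 2.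
  move=> hx; have xp : 0 < x by lra.
  have -> : 16 / H / x ^+ 2 = 4 / (H * x) * (4 / x) by field; rewrite !gt_eqF.
  by apply: ler_pM; rewrite ?nc_ge0 ?D2 ?K2.
have ln2x : (2 <= nodefloor Delta l)%N -> 1 / 2 <= x.
  move=> h; apply: le_trans nf1; apply: (le_trans (ln2_ge R)).
  by rewrite ler_ln ?posrE ?ltr0n// ler_nat.
case: leqP => hN; last first.
  have hx : 1 / 2 <= x by apply: ln2x; apply: leq_trans N_ge2 (ltnW hN).
  have xp : 0 < x by lra.
  have -> : 16 * H * 32 ^+ b J / x ^+ 2 = H ^+ 2 * (16 / H / x ^+ 2 * 32 ^+ b J).
    by field; rewrite !gt_eqF.
  apply: ler_pM => //; first by rewrite !mulr_ge0 ?nc_ge0.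
  by apply: ler_pM; rewrite ?mulr_ge0 ?nc_ge0 ?far.
rewrite /V; case: ltnP => n2.
  have n1 : nodefloor Delta l = 1%N by apply/eqP; rewrite eqn_leq nf0 -ltnS n2.
  have hx1 : x <= 2 ^+ 0.
    rewrite expr0; apply: ltW; apply: (lt_le_trans nf2); rewrite n1; exact: ln2_le.
  have hE := E2 0%N hx1; rewrite b0 expr0 mulr1 in hE.
  have -> : 4 * H ^+ 2 / y = H ^+ 2 * (1 * (2 / y) * 2) by field; rewrite gt_eqF.
  apply: ler_pM => //; first by rewrite !mulr_ge0 ?nc_ge0.
  by apply: ler_pM; rewrite ?mulr_ge0 ?nc_ge0//; apply: ler_pM; rewrite ?nc_ge0.
set n := nodefloor Delta l in nf0 nf1 nf2 ln2x hN n2 *.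
have hx : 1 / 2 <= x by exact: ln2x.
have [k /andP[kn nk]] := tower_block n2.
have hxk : x <= 2 ^+ k.+1.
  by apply: ltW; apply: (lt_le_trans nf2); apply: ln_le_tower.
have hE := E2 _ hxk.
have hfar : nc (boxpoly R m).[cis s] * K <= 64 / H.
  apply: (le_trans (far hx)).
  rewrite ler_pdivrMr; last by rewrite exprn_gt0//; lra.
  have -> : 16 / H = 64 / H * (1 / 2) ^+ 2 by field; rewrite gt_eqF.
  by rewrite ler_pM2l ?divr_gt0//; apply: lerXn2r; rewrite ?nnegrE//; lra.
have n0' : 0 < n%:R :> R by rewrite ltr0n.
(* The node is within 1/n of log n and the transform is Lipschitz with constant H^2. *)
have hG : nc (dtransform H N m a x) <= g n + H ^+ 2 / n%:R.
  apply: (le_trans (dtransform_lip x (ln n%:R))); rewrite lerD2l ler_wpM2l ?sqr_ge0//.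
  rewrite ger0_norm ?subr_ge0//; apply: le_trans (ln_succ_le R nf0).
  by rewrite lerD2r ltW.
have G0 := nc_ge0 (dtransform H N m a x).
apply: (@le_trans _ _ (H * (g n + H ^+ 2 / n%:R) * (64 / H * (2 * 32 ^+ b k.+1)))).
  apply: ler_pM => //; first by rewrite !mulr_ge0 ?nc_ge0.
    by apply: (le_trans hpp); rewrite ler_pM2l.
  by apply: ler_pM; rewrite ?mulr_ge0 ?nc_ge0.
set w := 32 ^+ b k.+1.
have -> : H * (g n + H ^+ 2 / n%:R) * (64 / H * (2 * w)) = 128 * (g n * w + H ^+ 2 * (w / n%:R)).
  by field; rewrite !gt_eqF.
rewrite ler_pM2l; last by rewrite ltr0n.
apply: lerD.
  by rewrite ler_wpM2l ?nc_ge0// b_Phi.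
by rewrite ler_wpM2l ?sqr_ge0// ler_pM2r ?invr_gt0// b_sqrt.
Qed.

Let rho_itv : 0 <= rho < 1.
Proof. by rewrite expR_ge0 expR_lt1 oppr_lt0 mulr_gt0. Qed.

Let nc_p_ge z : nc (p.[1] - p.[z]) <= eps / 2 -> eps / 2 <= nc p.[z].
Proof.
move=> hz.
have p1 : eps <= nc p.[1].
  have -> : p.[1] = dtransform H N m a 0 by rewrite dtransformE mulr0 oppr0 cis0.
  apply: le_trans (Re_le_nc _).
  apply: le_trans (variational_ineq Phi_gt0 H_gt0 m_gt0 a_adm a_min).
  rewrite -[leLHS]addr0 lerD//.
  rewrite big_nat; apply: sumr_ge0 => n /andP[n2 _].
  by rewrite !mulr_ge0 ?nc_ge0 ?divw_ge0// ltW// Phi_gt0.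
by have := ncB_ge p.[1] p.[z]; move: (nc _) (nc _) (nc _) p1 hz => u v w; lra.
Qed.

(** At the interior point every factor is bounded below: by [Hy_eps] the transform stays above eps /
    2, the box is at least rho^m = exp (-H y), and E collects the increments of [b]. *)
Let horner_P_ge : (eps / 2) ^+ 2 * expR (- (H * y)) *
  (1 + y * (H / 2 ^+ a0) / 2 * \sum_(0 <= j < J) (b j)%:R / 2 ^+ j) <= nc P.[(rho%:C)%C].
Proof.
have /andP[rho0 rho1] := rho_itv.
have rho01 : 0 <= rho <= 1 by rewrite rho0 ltW.
have hp : eps / 2 <= nc p.[(rho%:C)%C].
  apply: nc_p_ge; apply: (le_trans (nc_horner_polyB_real mass rho01)).
  apply: le_trans Hy_eps; rewrite ler_pM2l// -m_eta -mulrA ler_wpM2l//.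
  by have := expR_ge1Dx (- (eta * y)); rewrite -/rho; lra.
have hpc : nc pc.[(rho%:C)%C] = nc p.[(rho%:C)%C] by rewrite nc_horner_conj conjc_ofR.
rewrite ncP hpc; have e20 : 0 <= eps / 2 by rewrite divr_ge0// ltW.
have S0 : 0 <= \sum_(0 <= j < J) (b j)%:R / 2 ^+ j :> R.
  by apply: sumr_ge0 => j _; rewrite divr_ge0// exprn_ge0.
have Ha1 : 0 < H / 2 ^+ a0 by rewrite divr_gt0// exprn_gt0.
apply: ler_pM.
- by rewrite mulr_ge0 ?sqr_ge0 ?expR_ge0.
- by rewrite addr_ge0// mulr_ge0// divr_ge0// mulr_ge0// ltW.
- apply: ler_pM; rewrite ?sqr_ge0 ?expR_ge0//.
    by rewrite expr2; apply: ler_pM.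
  have -> : expR (- (H * y)) = rho ^+ m.
    by rewrite /rho -expRM_natl -m_eta; congr expR; ring.
  exact: nc_boxpoly_real.
- apply: le_trans (nc_multiplier_real b e J rho01).
  rewrite lerD2l.
  apply: (@le_trans _ _ (y * (H / 2 ^+ a0) / 2 * \sum_(0 <= j < J) (b j.+1 - b j)%:R / 2 ^+ j)).
    rewrite ler_wpM2l//; first by rewrite divr_ge0// mulr_ge0// ltW.
    exact: sum_increments_dyadic.
  rewrite mulr_sumr !big_nat; apply: ler_sum => j /andP[_ jJ].
  have p2 : 0 < 2 ^+ j :> R by rewrite exprn_gt0.
  have -> : rho ^+ e j = expR (- (y * (H / 2 ^+ a0 / 2 ^+ j))).
    by rewrite /rho -expRM_natl -e_eta//; congr expR; ring.
  have hu : 0 <= y * (H / 2 ^+ a0 / 2 ^+ j) <= 1.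
    rewrite mulr_ge0 ?divr_ge0 ?(ltW y_gt0) ?(ltW H_gt0) ?exprn_ge0//=.
    apply: mulr_ile1 => //; rewrite ?divr_ge0 ?(ltW y_gt0) ?(ltW H_gt0) ?exprn_ge0//.
    rewrite ler_pdivrMr// mul1r; apply: (le_trans Ha0).
    apply: (@le_trans _ _ 1); first by lra.
    by rewrite exprn_ege1//; lra.
  have := sub_expRN_ge hu.
  move=> /(ler_wpM2l (ler0n R (b j.+1 - b j))); apply: le_trans.
  by rewrite le_eqVlt; apply/orP; left; apply/eqP; ring.
Qed.

(** The lower bound at rho meets the upper bound from the circle: if the discrete minimum is at
    least [eps], the dyadic sum of [b] is bounded independently of [J]. *)
Lemma log_integral_core : (eps / 2) ^+ 2 * expR (- (H * y)) *
  (1 + y * (H / 2 ^+ a0) / 2 * \sum_(0 <= j < J) (b j)%:R / 2 ^+ j) <= log_integral_bound y.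
Proof.
apply: (le_trans horner_P_ge).
have lnN : 1 / 2 <= ln N.+1%:R :> R.
  apply: (le_trans (ln2_ge R)); rewrite ler_ln ?posrE ?ltr0n// ler_nat.
  exact: leqW.
(* The first entry makes the formula on [M.*2] roots exact, the second ensures [Delta * N <= 1]. *)
pose M := maxn (size P) (Num.truncn (pi * N%:R / eta)).+1.
have M0 : (0 < M)%N by rewrite leq_max orbT.
have M0' : 0 < M%:R :> R by rewrite ltr0n.
have sP : (size P <= M.*2)%N by rewrite -addnn; apply: leq_trans (leq_addr _ _); exact: leq_maxl.
pose Delta := pi / (M%:R * eta).
have pi0 := pi_gt0 R.
have D0 : 0 < Delta by rewrite divr_gt0// mulr_gt0.
have N0 : 0 < N%:R :> R by rewrite ltr0n ltnW.
have DN : Delta * N%:R <= 1.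
  have -> : Delta * N%:R = (pi * N%:R / eta) / M%:R by rewrite /Delta; field; rewrite !gt_eqF.
  rewrite ler_pdivrMr// mul1r.
  have h0 : 0 <= pi * N%:R / eta by apply: divr_ge0; [apply: mulr_ge0|]; exact: ltW.
  have /andP[_ h] := truncn_itv h0.
  apply: (le_trans (ltW h)); rewrite ler_nat; exact: leq_maxr.
have DX : Delta <= ln N.+1%:R.
  apply: le_trans lnN; rewrite -(ler_pM2r N0); apply: (le_trans DN).
  have : 2 <= N%:R :> R by rewrite ler_nat.
  lra.
have node l : rnode R M.*2 l = eta * (Delta * l%:R).
  by rewrite /rnode /Delta -mul2n natrM -mulr_natl; field; rewrite !gt_eqF.
have nodepi l : (l <= M)%N -> eta * (Delta * l%:R) <= pi.
  move=> lM; have -> : eta * (Delta * l%:R) = pi * (l%:R / M%:R).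
    by rewrite /Delta; field; rewrite !gt_eqF.
  have lM1 : l%:R / M%:R <= 1 :> R by rewrite ler_pdivrMr// mul1r ler_nat.
  by rewrite ler_piMr// ltW.
pose W l := if (nodefloor Delta l <= N)%N then V (nodefloor Delta l)
  else 16 * H * 32 ^+ b J / (Delta * l%:R) ^+ 2.
have W0 l : 0 <= W l.
  rewrite /W; case: ifP => _ //; rewrite divr_ge0 ?sqr_ge0// mulr_ge0 ?exprn_ge0// mulr_ge0//.
  exact: ltW.
apply: (le_trans (@nc_horner_sym _ P M rho (fun l => W l / eta) M0 sP rho_itv _)).
  move=> l lM; rewrite !node.
  have hW s : s = eta * (Delta * l%:R) \/ s = - (eta * (Delta * l%:R)) ->
      nc P.[cis s] / nc (1 - (rho%:C)%C * cis (eta * (Delta * l%:R))) <= W l / eta.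
    move=> hs; rewrite ler_pdivlMr// -mulrA [X in _ * X]mulrC.
    exact: node_bound (nodepi l lM) hs.
  by split; apply: hW; [left|right].
rewrite -mulr_suml.
(* 2 / (M eta) is at most pi / (M eta), which is [Delta]. *)
apply: (@le_trans _ _ (Delta * \sum_(0 <= l < M.+1) W l)).
  rewrite [X in _ * X]mulrC mulrA ler_wpM2r ?sumr_ge0//.
  have -> : 2 / M%:R / eta = 2 / (M%:R * eta) by field; rewrite !gt_eqF.
  apply: ler_wpM2r; last exact: pi_ge2.
  by rewrite invr_ge0; apply: mulr_ge0; exact: ltW.
rewrite mulr_sumr (bigID (fun l => (nodefloor Delta l <= N)%N))/=.
rewrite /log_integral_bound; apply: lerD.
  apply: le_trans sum_V; apply: le_trans (sum_nodes_le D0 M.+1 V_ge0 DN).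
  by apply: ler_sum => l hl; rewrite /W hl.
apply: (@le_trans _ _ (16 * H * 32 ^+ b J *
   \sum_(0 <= l < M.+1 | (N < nodefloor Delta l)%N) Delta / (Delta * l%:R) ^+ 2)).
  rewrite mulr_sumr (eq_bigl (fun l => (N < nodefloor Delta l)%N)); last by move=> l; rewrite ltnNge.
  apply: ler_sum => l hl; rewrite /W leqNgt hl /=.
  by rewrite le_eqVlt; apply/orP; left; apply/eqP; rewrite mulrCA.
have c0 : 0 < 16 * H * 32 ^+ b J :> R by rewrite !mulr_gt0// exprn_gt0.
apply: (le_trans (ler_wpM2l (ltW c0) (sum_nodes_tail D0 M.+1 (ltnW N_ge2) DX))).
have X0 : 0 < ln N.+1%:R :> R by lra.
rewrite mulrA ler_pdivrMr//.
have := ler_wpM2l (ltW H_gt0) N_large; lra.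
Qed.

End Core.
Let psi := Psi Phi.

(* 32 <= e^4 bounds 32^(rate k) by Phi / Phi 2, and 32^(2^k / 10) <= sqrt (tower k). *)
Let rate (k : nat) : nat := minn (Num.truncn (psi k / 4)) (2 ^ k %/ 10).

(** Shifted by one: nodes of block k reach up to 2^(k+1), where E may have size 32^(b (k+1)), and
    this must be bounded by [Phi] at the left end of the block. *)
Let b (K : nat) : nat := if K is k.+1 then rate k else 0.

Lemma expR4_ge : 32 <= expR 4 :> R.
Proof.
have h : 1 + 1 / 4 <= expR (1 / 4) :> R by exact: expR_ge1Dx.
have -> : 4 = 16%:R * (1 / 4) :> R by field.
rewrite expRM_natl; apply: (@le_trans _ _ ((1 + 1 / 4) ^+ 16)).
  have -> : (1 + 1 / 4 : R) ^+ 16 = ((((1 + 1 / 4) ^+ 2) ^+ 2) ^+ 2) ^+ 2 by rewrite -!exprM.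
  have -> : (1 + 1 / 4 : R) ^+ 2 = 25 / 16 by field.
  have h4 : 61 / 25 <= (25 / 16 : R) ^+ 2 by lra.
  have h8 : 59 / 10 <= ((25 / 16 : R) ^+ 2) ^+ 2 by nra.
  nra.
by apply: lerXn2r; rewrite ?nnegrE ?expR_ge0//; lra.
Qed.

Let rate_mono i j : (i <= j)%N -> (rate i <= rate j)%N.
Proof.
move=> ij; rewrite /rate leq_min !geq_min; apply/andP; split.
  by rewrite le_truncn// ler_pM2r ?invr_gt0// Psi_mono.
by rewrite leq_div2r ?orbT// leq_exp2l.
Qed.

Let b_mono j : (b j <= b j.+1)%N.
Proof. by case: j => [//|j]; apply: rate_mono. Qed.

Let b_Phi k n : (tower k <= n)%N -> 32 ^+ b k.+1 <= Phi n / Phi 2.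
Proof.
move=> kn; have n2 : (2 <= n)%N by apply: leq_trans kn; exact: tower_ge2.
rewrite -(expR_lratio Phi_gt0 n2); apply: (@le_trans _ _ (expR (psi k))); last first.
  by rewrite ler_expR; apply: lratio_mono => //; exact: tower_ge2.
apply: (@le_trans _ _ (expR 4 ^+ b k.+1)).
  by apply: lerXn2r; rewrite ?nnegrE ?expR_ge0// expR4_ge.
rewrite -expRM_natl ler_expR -ler_pdivlMr//.
have h0 : 0 <= psi k / 4 by rewrite divr_ge0// Psi_ge0.
have /andP[h _] := truncn_itv h0; apply: le_trans h.
by rewrite ler_nat geq_minl.
Qed.

Let b_sqrt k n : (tower k <= n)%N -> 32 ^+ b k.+1 <= Num.sqrt n%:R :> R.
Proof.
move=> kn; have h0 : 0 <= 32 ^+ b k.+1 :> R by rewrite exprn_ge0.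
rewrite -[leLHS](ger0_norm h0) -sqrtr_sqr ler_wsqrtr//.
apply: (@le_trans _ _ (tower k)%:R); last by rewrite ler_nat.
have hn : ((32 ^ b k.+1) ^ 2 <= tower k)%N.
  have e : (32 = 2 ^ 5)%N by [].
  rewrite e -!expnM /tower leq_exp2l//.
  have : (rate k <= 2 ^ k %/ 10)%N by exact: geq_minr.
  rewrite leq_divRL// => h; apply: leq_trans h; rewrite /b.
  by move: (rate k) => q; lia.
by rewrite -(ler_nat R) natrX natrX in hn.
Qed.

(** If the sum stayed bounded, rate k / 2^k would tend to 0; the cap 2^k / 10 would be inactive from
    some k on, so [rate] would be psi / 4 up to rounding and the sum of psi would be bounded too. *)
Lemma rate_unbounded :
  (forall B, exists J, B < \sum_(0 <= j < J) psi j / 2 ^+ j) ->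
  forall B : R, exists J, B < \sum_(0 <= j < J) (b j)%:R / 2 ^+ j.
Proof.
move=> unb B; apply: contrapT => /forallNP hB.
have {}hB J : \sum_(0 <= j < J) (b j)%:R / 2 ^+ j <= B.
  by rewrite leNgt; apply/negP; exact: hB.
pose u k : R := (rate k)%:R / 2 ^+ k.
have u0 k : 0 <= u k by rewrite divr_ge0// exprn_ge0.
have hu J : \sum_(0 <= k < J) u k <= 2 * B.
  have := hB J.+1; rewrite big_nat_recl//= mul0r add0r => h.
  rewrite -ler_pdivrMl// mulr_sumr; apply: le_trans h; apply: ler_sum => k _.
  rewrite /u exprS le_eqVlt; apply/orP; left; apply/eqP; field.
  by rewrite expf_neq0.
have cu : cvgn (series u).
  apply: nondecreasing_is_cvgn; first exact: nondecreasing_series.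
  by exists (2 * B) => _ [J _ <-]; rewrite /series/=.
have /cvgrPdist_lt/(_ (1 / 20) ltac:(lra)) := cvg_series_cvg_0 cu.
(* From k = 4 on, [2 ^ k %/ 10] is at least 2^k / 20, so an active cap would contradict u k <
   1/20. *)
move=> [k0 _ hk0]; pose k1 := maxn k0 4.
have good k : (k1 <= k)%N -> psi k / 2 ^+ k <= 4 * u k + 4 * 2 ^- k.
  rewrite geq_max => /andP[kk0 k4].
  have := hk0 k kk0; rewrite /= sub0r normrN ger0_norm//.
  have p : 0 < 2 ^+ k :> R by rewrite exprn_gt0.
  rewrite /u ltr_pdivrMr// => hlt.
  have h0 : 0 <= psi k / 4 by rewrite divr_ge0// Psi_ge0.
  have /andP[_ htr] := truncn_itv h0.
  have rE : rate k = Num.truncn (psi k / 4).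
    rewrite /rate; apply/minn_idPl; rewrite leqNgt; apply/negP => hbad.
    have rE : rate k = (2 ^ k %/ 10)%N by apply/minn_idPr; exact: ltnW.
    have k16 : (16 <= 2 ^ k)%N by rewrite -[16%N]/(2 ^ 4)%N leq_exp2l.
    have : (2 ^ k <= 20 * (2 ^ k %/ 10))%N.
      move: (2 ^ k)%N k16 => q hq; rewrite {1}(divn_eq q 10).
      have : (1 <= q %/ 10)%N by rewrite divn_gt0// (leq_trans _ hq).
      have := ltn_pmod q (isT : 0 < 10)%N.
      move: (q %/ 10)%N (q %% 10)%N => c d; lia.
    by rewrite -(ler_nat R) natrM -rE natrX; lra.
  rewrite -rE -[X in _ < X]natr1 in htr.
  have -> : 4 * ((rate k)%:R / 2 ^+ k) + 4 * 2 ^- k = 4 * ((rate k)%:R + 1) / 2 ^+ k :> R.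
    by ring.
  by rewrite ler_pM2r ?invr_gt0//; lra.
pose S0 := \sum_(0 <= k < k1) psi k / 2 ^+ k.
have [J] := unb (S0 + 8 * B + 8).
apply/negP; rewrite -leNgt.
have psi0 k : 0 <= psi k / 2 ^+ k by rewrite divr_ge0 ?exprn_ge0// Psi_ge0.
apply: (@le_trans _ _ (\sum_(0 <= k < k1 + J) psi k / 2 ^+ k)).
  rewrite [leRHS](big_cat_nat (n := J))//= ?leq_addl//.
  by rewrite lerDl sumr_ge0.
rewrite (big_cat_nat (n := k1))//= ?leq_addr// -/S0 -addrA lerD2l.
apply: (@le_trans _ _ (\sum_(k1 <= k < k1 + J) (4 * u k + 4 * 2 ^- k))).
  by rewrite !big_nat; apply: ler_sum => k /andP[hk _]; exact: good.
apply: (@le_trans _ _ (\sum_(0 <= k < k1 + J) (4 * u k + 4 * 2 ^- k))).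
  rewrite [leRHS](big_cat_nat (n := k1))//= ?leq_addr//.
  rewrite lerDr; apply: sumr_ge0 => k _.
  by rewrite addr_ge0 ?mulr_ge0// invr_ge0 exprn_ge0.
rewrite big_split/= -!mulr_sumr; apply: lerD.
  by have := hu (k1 + J)%N; lra.
by have := sum_half_le R (k1 + J); lra.
Qed.

Lemma denergy_small_of_divergent :
  (forall B, exists J, B < \sum_(0 <= j < J) psi j / 2 ^+ j) ->
  forall eps, 0 < eps -> exists2 N, (2 <= N)%N & exists r0, forall r a,
    (r0 <= r)%N -> admissible Phi N a ->
    (forall a', admissible Phi N a' -> denergy H N a (2 ^ r) <= denergy H N a' (2 ^ r)) ->
    denergy H N a (2 ^ r) < eps.
Proof.
move=> /rate_unbounded unb eps eps0.
pose a0 := (Num.truncn (16 * H)).+1.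
have Ha0 : H / 2 ^+ a0 <= 1 / 16.
  rewrite ler_pdivrMr ?exprn_gt0//.
  have h0 : 0 <= 16 * H by rewrite mulr_ge0// ltW.
  have /andP[_ h] := truncn_itv h0.
  have h2 : a0%:R <= 2 ^+ a0 :> R by rewrite -natrX ler_nat ltnW// ltn_expl.
  by rewrite -/a0 in h; lra.
pose y := Num.min 1 (Num.min (1 / H) (eps / (2 * H ^+ 2))).
have H2 : 0 < 2 * H ^+ 2 by rewrite mulr_gt0// exprn_gt0.
have y0 : 0 < y by rewrite !lt_min ltr01 !divr_gt0.
have y1 : y <= 1 by rewrite ge_min lexx.
have Hy : H * y <= 1.
  by rewrite mulrC -ler_pdivlMr// !ge_min lexx orbT.
have Hye : H * (H * y) <= eps / 2.
  have : y * (2 * H ^+ 2) <= eps by rewrite -ler_pdivlMr// !ge_min lexx !orbT.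
  by move: (H) (y) => h z; nra.
pose c1 := (eps / 2) ^+ 2 * expR (- (H * y)).
pose c2 := y * (H / 2 ^+ a0) / 2.
have c10 : 0 < c1 by rewrite mulr_gt0 ?expR_gt0// exprn_gt0// divr_gt0.
have c20 : 0 < c2 by rewrite divr_gt0// mulr_gt0// divr_gt0// exprn_gt0.
(* Order of choices: [y] depends on [H] and [eps] alone, [J] lifts the lower bound above
   [log_integral_bound y], and [tower K] makes log N exceed 32^(b J). *)
have [J hJ] := unb (log_integral_bound y / c1 / c2).
pose K := (Num.truncn (2 * 32 ^+ b J : R)).+1.
exists (tower K); first exact: tower_ge2.
exists (J + a0)%N => r a rJ a_adm a_min.
rewrite ltNge; apply/negP => eps_le.
have NL : 32 ^+ b J <= ln (tower K).+1%:R :> R.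
  apply: le_trans (@ln_ge_tower R K _ (leqnSn _)).
  have h0 : 0 <= 2 * 32 ^+ b J :> R by rewrite mulr_ge0// exprn_ge0.
  have /andP[_ h] := truncn_itv h0.
  have h2 : K%:R <= 2 ^+ K :> R by rewrite -natrX ler_nat ltnW// ltn_expl.
  apply: ltW; rewrite ltr_pdivlMr// mulrC; exact: lt_le_trans h h2.
have := @log_integral_core r (tower K) J a0 b a eps y erefl b_mono b_Phi b_sqrt Ha0
  rJ y0 y1 Hy Hye (tower_ge2 K) NL a_adm a_min eps0 eps_le.
rewrite -/c1 -/c2; apply/negP; rewrite -ltNge.
move: hJ; rewrite ltr_pdivrMr// ltr_pdivrMr// => hJ; apply: (lt_le_trans hJ).
by rewrite [leLHS]mulrC ler_pM2l// [leLHS]mulrC lerDr ler01.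
Qed.

End DivergentCase.

(** * The convergent case *)

Section Chebyshev.
Variable R : realType.
Implicit Types (c t x lam rho : R).

Fixpoint cheb (n : nat) c : R :=
  if n is n1.+1 then
    if n1 is n2.+1 then 2 * c * cheb n1 c - cheb n2 c else c
  else 1.

Lemma chebSS n c : cheb n.+2 c = 2 * c * cheb n.+1 c - cheb n c.
Proof. by []. Qed.

Lemma nat_two_step_ind (P : nat -> Prop) : P 0%N -> P 1%N ->
  (forall n, P n -> P n.+1 -> P n.+2) -> forall n, P n.
Proof.
move=> h0 h1 hS n; suff [] : P n /\ P n.+1 by [].
by elim: n => [//|n [hn hn1]]; split => //; exact: hS.
Qed.

Lemma cheb_cos n t : cheb n (cos t) = cos (n%:R * t).
Proof.
elim/nat_two_step_ind: n => [||n IH0 IH1]; first by rewrite mul0r cos0.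
  by rewrite mul1r.
rewrite chebSS IH0 IH1.
have -> : n.+2%:R * t = n.+1%:R * t + t by rewrite -[n.+2%:R]natr1; ring.
have -> : n%:R * t = n.+1%:R * t - t by rewrite -[n.+1%:R]natr1; ring.
by rewrite cosB cosD; ring.
Qed.

Lemma cheb_le1 n c : `|c| <= 1 -> `|cheb n c| <= 1.
Proof.
rewrite ler_norml => hc; rewrite -(@acosK R c) ?in_itv//.
by rewrite cheb_cos cos_max.
Qed.

Lemma chebN n c : cheb n (- c) = (-1) ^+ n * cheb n c.
Proof.
elim/nat_two_step_ind: n => [||n IH0 IH1]; first by rewrite expr0 mul1r.
  by rewrite expr1 /= mulN1r.
by rewrite !chebSS IH0 IH1 !exprS; ring.
Qed.

(** The left side is the tangent at c = 1, where the slope is n^2. *)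
Lemma cheb_ge n c : 1 <= c -> 1 + n%:R ^+ 2 * (c - 1) <= cheb n c.
Proof.
move=> c1.
(* The increments in n are at least (2n + 1)(c - 1) and add up to n^2 (c - 1). *)
suff [] : 1 + n%:R ^+ 2 * (c - 1) <= cheb n c /\
    cheb n c + (2 * n%:R + 1) * (c - 1) <= cheb n.+1 c by [].
elim: n => [|n [IH1 IH2]]; first by rewrite /=; split; lra.
have IH3 : 1 + n.+1%:R ^+ 2 * (c - 1) <= cheb n.+1 c.
  apply: le_trans IH2; rewrite -natr1; nra.
split => //; rewrite chebSS.
have h1 : 1 <= cheb n.+1 c.
  by apply: le_trans IH3; rewrite lerDl mulr_ge0 ?sqr_ge0// subr_ge0.
move: IH2 h1; move: (cheb n.+1 c) (cheb n c) => v w IH2 h1.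
rewrite -natr1; nra.
Qed.

Lemma cheb_geom n t : 0 < t -> cheb n ((t + t^-1) / 2) = (t ^+ n + t ^- n) / 2.
Proof.
move=> t0; elim/nat_two_step_ind: n => [||n IH0 IH1]; first by rewrite !expr0 /=; field.
  by rewrite !expr1.
by rewrite chebSS IH0 IH1 !exprS; field; rewrite expf_neq0// gt_eqF.
Qed.

(** By parity c >= 0. For c > 1 write c = (t + 1/t) / 2 with t > 1; then t <= rho because t + 1/t
    increases, and [cheb_geom] gives the value. *)
Lemma cheb_le n c rho : 1 <= rho -> `|c| <= (rho + rho^-1) / 2 -> `|cheb n c| <= rho ^+ n.
Proof.
move=> r1; wlog c0 : c / 0 <= c.
  move=> W; case: (leP 0 c) => [/W//|c0] hc.
  rewrite -(opprK c) chebN normrM normrX normrN1 expr1n mul1r.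
  by apply: W; rewrite ?normrN// oppr_ge0 ltW.
rewrite (ger0_norm c0) => hc.
case: (leP c 1) => c1.
  apply: (le_trans (cheb_le1 _ _)); first by rewrite ger0_norm.
  exact: exprn_ege1.
pose s := Num.sqrt (c ^+ 2 - 1); pose t := c + s.
have c2 : 0 <= c ^+ 2 - 1 by nra.
have s2 : s ^+ 2 = c ^+ 2 - 1 by rewrite sqr_sqrtr.
have s0 : 0 <= s by exact: sqrtr_ge0.
have t1 : 1 <= t by rewrite /t; lra.
have t0 : 0 < t by lra.
have r0 : 0 < rho by lra.
have tV : t^-1 = c - s.
  apply: (mulfI (x := t)); first by rewrite gt_eqF.
  have -> : t * (c - s) = c ^+ 2 - s ^+ 2 by rewrite /t; ring.
  by rewrite mulfV ?gt_eqF// s2; ring.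
have ct : c = (t + t^-1) / 2 by rewrite tV /t; field.
have tr : t <= rho.
  rewrite leNgt; apply/negP => rt.
  have : (rho + rho^-1) / 2 < c.
    rewrite ct ltr_pM2r// -subr_gt0.
    have -> : t + t^-1 - (rho + rho^-1) = (t - rho) * (1 - t^-1 * rho^-1).
      by field; rewrite !gt_eqF.
    apply: mulr_gt0; first by rewrite subr_gt0.
    rewrite subr_gt0 -invfM invf_lt1 ?mulr_gt0//.
    by apply: (le_lt_trans r1); rewrite ltr_pMl//; lra.
  by rewrite ltNge hc.
rewrite ct cheb_geom//.
have p1 : 1 <= t ^+ n by exact: exprn_ege1.
have p2 : t ^- n <= 1 by rewrite invf_le1// (lt_le_trans _ p1).
have p3 : 0 < t ^- n by rewrite invr_gt0 (lt_le_trans _ p1).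
have p4 : t ^+ n <= rho ^+ n by apply: lerXn2r; rewrite ?nnegrE// ltW.
by rewrite ger0_norm; lra.
Qed.

End Chebyshev.

(** * The l1 norm of the coefficients *)

Section CoefficientNorm.
Variable R : realType.
Implicit Types (p q : {poly R[i]}) (z : R[i]).

Definition l1 p : R := \sum_(0 <= k < size p) nc p`_k.

Lemma l1_wide p n : (size p <= n)%N -> l1 p = \sum_(0 <= k < n) nc p`_k.
Proof.
move=> pn; have z : \sum_(size p <= k < n) nc p`_k = 0.
  by rewrite big_nat big1// => k /andP[pk _]; rewrite nth_default// nc0.
by rewrite (big_cat_nat (n := size p))//= z addr0.
Qed.

Lemma l1_ge0 p : 0 <= l1 p.
Proof. by apply: sumr_ge0 => k _; exact: nc_ge0. Qed.

Lemma l1D p q : l1 (p + q) <= l1 p + l1 q.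
Proof.
rewrite (l1_wide (size_polyD p q)) (l1_wide (leq_maxl _ (size q))) (l1_wide (leq_maxr (size p) _)).
by rewrite -big_split/=; apply: ler_sum => k _; rewrite coefD ncD.
Qed.

Lemma l1C z : l1 z%:P = nc z.
Proof. by rewrite (l1_wide (size_polyC_leq1 z)) big_nat1 coefC. Qed.

Lemma l1MX p : l1 (p * 'X) = l1 p.
Proof.
have h : (size (p * 'X)%R <= (size p).+1)%N.
  by apply: (leq_trans (size_polyMleq _ _)); rewrite size_polyX addn2.
by rewrite (l1_wide h) big_nat_recl//= coefMX eqxx nc0 add0r; apply: eq_bigr => k _; rewrite coefMX.
Qed.

Lemma l1_MXaddC p z : l1 (p * 'X + z%:P) = l1 p + nc z.
Proof.
have h : (size (p * 'X + z%:P)%R <= (size p).+1)%N.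
  apply: (leq_trans (size_polyD _ _)); rewrite geq_max; apply/andP; split.
    by apply: (leq_trans (size_polyMleq _ _)); rewrite size_polyX addn2.
  by apply: (leq_trans (size_polyC_leq1 z)).
rewrite (l1_wide h) big_nat_recl//= coefD coefMX coefC eqxx add0r addrC; congr (_ + _).
by apply: eq_bigr => k _; rewrite coefD coefMX coefC addr0.
Qed.

Lemma l1ZC z q : l1 (z%:P * q) = nc z * l1 q.
Proof.
have h : (size (z%:P * q)%R <= size q)%N by rewrite mul_polyC size_scale_leq.
by rewrite (l1_wide h) /l1 mulr_sumr; apply: eq_bigr => k _; rewrite coefCM ncM.
Qed.

Lemma l1M p q : l1 (p * q) <= l1 p * l1 q.
Proof.
elim/poly_ind: p => [|p z IH].
  have z : l1 (0 : {poly R[i]}) = 0 by rewrite -polyC0 l1C nc0.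
  by rewrite mul0r z mul0r.
rewrite l1_MXaddC mulrDl -mulrA ['X * q]mulrC mulrA mulrDl.
by apply: (le_trans (l1D _ _)); rewrite l1MX l1ZC lerD.
Qed.

Lemma l1X p n : l1 (p ^+ n) <= l1 p ^+ n.
Proof.
elim: n => [|n IH]; first by rewrite !expr0 -[1]/(1%:P) l1C nc1.
rewrite !exprS; apply: (le_trans (l1M _ _)).
by rewrite ler_wpM2l ?l1_ge0.
Qed.

Lemma l1_prod (I : eqType) (s : seq I) (F : I -> {poly R[i]}) :
  (forall i, l1 (F i) <= 1) -> l1 (\prod_(i <- s) F i) <= 1.
Proof.
move=> h; elim: s => [|i s IH]; first by rewrite big_nil -[1]/(1%:P) l1C nc1.
rewrite big_cons; apply: (le_trans (l1M _ _)).
by apply: mulr_ile1; rewrite ?l1_ge0.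
Qed.

Lemma l1Xn n : l1 'X^n = 1.
Proof.
elim: n => [|n IH]; first by rewrite expr0 -[1]/(1%:P) l1C nc1.
by rewrite exprSr l1MX.
Qed.

Lemma nc_coefM_le p q s k : (forall j, nc q`_j <= s) -> nc (p * q)`_k <= l1 p * s.
Proof.
move=> hq; have s0 : 0 <= s := le_trans (nc_ge0 _) (hq 0%N).
elim/poly_ind: p k => [|p z IH] k.
  by rewrite mul0r coef0 nc0 mulr_ge0 ?l1_ge0.
rewrite mulrDl -mulrA ['X * q]mulrC mulrA coefD l1_MXaddC mulrDl.
apply: (le_trans (ncD _ _)); apply: lerD.
  by rewrite coefMX; case: eqP => _; rewrite ?nc0 ?mulr_ge0 ?l1_ge0.
by rewrite coefCM ncM ler_wpM2l ?nc_ge0.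
Qed.

End CoefficientNorm.

(** * The Chebyshev factor as a polynomial in q *)

Section ChebyshevPolynomial.
Variable R : realType.
Variables (lam beta : R) (kappa : nat).

Definition chebU1 : {poly R[i]} :=
  ((lam / 2)%:C)%C%:P * ((cis beta)%:P * 'X^(kappa.*2) + (cis (- beta))%:P).

(** Homogenized recurrence: the powers of 'X clear the negative frequencies of the cosine, so that
    on the circle [chebU n] is a unimodular factor times [cheb n]. *)
Fixpoint chebU (n : nat) : {poly R[i]} :=
  if n is n1.+1 then
    if n1 is n2.+1 then 2%:P * chebU1 * chebU n1 - 'X^(kappa.*2) * chebU n2 else chebU1
  else 1.

Lemma chebUSS n : chebU n.+2 = 2%:P * chebU1 * chebU n.+1 - 'X^(kappa.*2) * chebU n.
Proof. by []. Qed.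

Lemma horner_chebU n phi :
  (chebU n).[cis phi] =
  cis phi ^+ (n * kappa) * ((cheb n (lam * cos (kappa%:R * phi + beta)))%:C)%C.
Proof.
have h1 : (chebU1).[cis phi] = cis phi ^+ kappa * ((lam * cos (kappa%:R * phi + beta))%:C)%C.
  rewrite /chebU1 !hornerE -addnn exprD.
  set q := cis phi ^+ kappa; have qE : q = cis (kappa%:R * phi) by rewrite /q cisX.
  have q0 : q != 0 by rewrite qE cis_neq0.
  have -> : cis beta * (q * q) + cis (- beta) = q * (cis (kappa%:R * phi + beta) + cis (- (kappa%:R * phi + beta))).
    rewrite opprD !cisD -qE [cis (- (_ * phi))]cisN -qE; field.
    by rewrite q0.
  rewrite mulrCA; congr (_ * _).
  by rewrite /cis cosN sinN /= ; apply/eqP; rewrite eq_complex /=; apply/andP; split; apply/eqP; field.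
elim/nat_two_step_ind: n => [||n IH0 IH1]; first by rewrite mul0n expr0 mul1r hornerC.
  by rewrite mul1n h1.
rewrite chebUSS hornerD hornerN (hornerM (2%:P * chebU1)) (hornerM 2%:P chebU1) (hornerM 'X^_) hornerC hornerXn h1 IH0 IH1 chebSS.
move: (cheb n.+1 _) (cheb n _) => A B; set L := lam * _.
rewrite rmorphB !rmorphM rmorph_nat !mulSn -addnn !exprD; ring.
Qed.

Lemma nc_chebU n phi :
  nc (chebU n).[cis phi] = `|cheb n (lam * cos (kappa%:R * phi + beta))|.
Proof. by rewrite horner_chebU ncM ncX nc_cis expr1n mul1r nc_real. Qed.

Lemma size_chebU1 : (size chebU1 <= kappa.*2.+1)%N.
Proof.
apply: (leq_trans (size_polyMleq _ _)).
have h : (size ((cis beta)%:P * 'X^(kappa.*2) + (cis (- beta))%:P : {poly R[i]})%R <= kappa.*2.+1)%N.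
  apply: (leq_trans (size_polyD _ _)); rewrite geq_max; apply/andP; split.
    by rewrite mul_polyC; apply: (leq_trans (size_scale_leq _ _)); rewrite size_polyXn.
  by apply: (leq_trans (size_polyC_leq1 _)).
have := size_polyC_leq1 ((lam / 2)%:C)%C; move: (size _) (size _) h => u v; lia.
Qed.

Lemma size_chebU n : (size (chebU n) <= (n * kappa).*2.+1)%N.
Proof.
elim/nat_two_step_ind: n => [||n IH0 IH1]; first by rewrite size_poly1.
  by rewrite mul1n; exact: size_chebU1.
rewrite chebUSS; apply: (leq_trans (size_polyD _ _)); rewrite size_polyN geq_max.
apply/andP; split.
  apply: (leq_trans (size_polyMleq _ _)).
  have h : (size (2%:P * chebU1)%R <= kappa.*2.+1)%N.
    by rewrite mul_polyC; apply: (leq_trans (size_scale_leq _ _)); exact: size_chebU1.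
  move: IH1 h; rewrite !mulSn; move: (size _) (size _) (n * kappa)%N => u v w; lia.
apply: (leq_trans (size_polyMleq _ _)); rewrite size_polyXn.
move: IH0; rewrite !mulSn; move: (size _) (n * kappa)%N => u w; lia.
Qed.

Lemma l1_chebU n : 1 <= lam -> l1 (chebU n) <= (2 * lam + 1) ^+ n.
Proof.
move=> l1lam.
have h1 : l1 chebU1 <= lam.
  rewrite /chebU1 l1ZC nc_real ger0_norm; last by lra.
  have : l1 ((cis beta)%:P * 'X^(kappa.*2) + (cis (- beta))%:P) <= 2.
    by apply: (le_trans (l1D _ _)); rewrite l1ZC l1Xn l1C !nc_cis; lra.
  by move: (l1 _) => u; nra.
have w1 : 1 <= 2 * lam + 1 by lra.
elim/nat_two_step_ind: n => [||n IH0 IH1]; first by rewrite expr0 -[chebU 0]/(1%:P) l1C nc1.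
  by rewrite expr1 /=; lra.
rewrite chebUSS; apply: (le_trans (l1D _ _)).
have hN p : l1 (- p) = l1 p.
  by rewrite /l1 size_polyN; apply: eq_bigr => k _; rewrite coefN ncN.
have p0 : 0 <= (2 * lam + 1) ^+ n by rewrite exprn_ge0//; lra.
have hA : l1 (2%:P * chebU1 * chebU n.+1) <= 2 * lam * (2 * lam + 1) ^+ n.+1.
  apply: (le_trans (l1M _ _)); apply: ler_pM; rewrite ?l1_ge0//.
  by rewrite l1ZC nc_nat; lra.
have hB : l1 ('X^(kappa.*2) * chebU n) <= (2 * lam + 1) ^+ n.
  by apply: (le_trans (l1M _ _)); rewrite l1Xn mul1r.
rewrite hN; apply: (le_trans (lerD hA hB)).
rewrite !exprS; move: ((2 * lam + 1) ^+ n) p0 => w p0; nra.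
Qed.

End ChebyshevPolynomial.

(** * The peak of the Chebyshev factor at x = 0 *)

Section Peak.
Variable R : realType.
Implicit Types (h aa X x t : R).

Lemma ler_cos_pi x t : 0 <= x -> x <= t -> t <= pi -> cos t <= cos x.
Proof.
move=> x0; rewrite le_eqVlt => /orP[/eqP -> //|xt] tpi.
by apply/ltW; rewrite ltr_cos// in_itv/=; apply/andP; split; lra.
Qed.

Variables (h aa X : R).
Hypothesis h0 : 0 < h.
Hypothesis aa1 : 1 <= aa.
Hypothesis X0 : 0 <= X.
Hypothesis hX : h * (X + 2 * aa) <= 1.

Variable z : R.
Hypothesis zE : z = h * aa.
Let lam := (cos z)^-1.

Lemma peak_z_gt0 : 0 < z. Proof. by rewrite zE; apply: mulr_gt0 => //; apply: lt_le_trans aa1. Qed.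
Lemma peak_z_le : z <= 1 / 2.
Proof.
have p := mulr_ge0 (ltW h0) X0; have q := hX; rewrite mulrDr mulrCA in q.
rewrite zE; lra.
Qed.

Lemma peak_cos_ge : 7 / 8 <= cos z.
Proof.
have z0 := peak_z_gt0; have z1 := peak_z_le.
have zz : z ^+ 2 <= (1 / 2) ^+ 2 by apply: lerXn2r; rewrite ?nnegrE//; exact: ltW.
have := cos_ge_sqr z; lra.
Qed.

Lemma peak_lam_ge1 : 1 <= lam.
Proof. by have cz := peak_cos_ge; rewrite invf_ge1 ?cos_le1//; lra. Qed.

(** For these x the angle lies between z and pi - z, where the cosine is at most cos z = 1/lam in
    modulus. *)
Lemma peak_small x : 1 / 2 <= x <= X -> `|lam * cos (h * x + h * (aa - 1 / 2))| <= 1.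
Proof.
have h0' := h0; have aa1' := aa1; have pi2 := pi_ge2 R; have z0 := peak_z_gt0; have z1 := peak_z_le; have cz := peak_cos_ge.
move=> /andP[x1 x2].
have hx1 : h * (1 / 2) <= h * x by rewrite ler_pM2l.
have hx2 : h * x <= h * X by rewrite ler_pM2l.
have h2 : 0 <= h * (1 / 2) by rewrite mulr_ge0 ?ltW.
have e : h * (aa - 1 / 2) = z - h * (1 / 2) by rewrite zE; ring.
have hX' : h * X + 2 * z <= 1 by move: hX; rewrite zE; lra.
have cn : `|cos (h * x + (z - h * (1 / 2)))| <= cos z.
  rewrite ler_norml; apply/andP; split; last first.
    by apply: ler_cos_pi; [exact: ltW | lra | lra].
  have -> : - cos z = cos (pi - z) by rewrite cosB cospi sinpi; ring.
  by apply: ler_cos_pi; lra.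
have cz0 : 0 < cos z by lra.
have l0 : 0 < lam by rewrite invr_gt0.
have l1 : lam * cos z = 1 by rewrite /lam mulVf// gt_eqF.
by rewrite e normrM (gtr0_norm l0) -[leRHS]l1 ler_pM2l.
Qed.

(** At x = 0 the angle is z - h/2, just inside the peak. The cosine exceeds cos z by at least h^2 aa
    / 16, and [cheb_ge] multiplies this by n^2. *)
Lemma peak_large n : 1 + (n%:R * h) ^+ 2 * aa / 16 <= cheb n (lam * cos (h * (aa - 1 / 2))).
Proof.
have h0' := h0; have aa1' := aa1; have pi2 := pi_ge2 R; have z0 := peak_z_gt0; have z1 := peak_z_le; have cz := peak_cos_ge.
have e : h * (aa - 1 / 2) = z - h / 2 by rewrite zE; field.
have hz : h <= z by rewrite zE ler_peMr// ltW.
have d : h ^+ 2 * aa / 16 <= cos (z - h / 2) - cos z.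
  have -> : cos (z - h / 2) - cos z = 2 * (sin (z - h / 4) * sin (h / 4)).
    have -> : z - h / 2 = (z - h / 4) - h / 4 by field.
    have -> : cos z = cos ((z - h / 4) + h / 4) by congr cos; field.
    by rewrite (cosB (z - h / 4)) (cosD (z - h / 4)); ring.
  have s1 : (z - h / 4) / 2 <= sin (z - h / 4).
    by apply: sin_ge_half; apply/andP; split; lra.
  have s2 : (h / 4) / 2 <= sin (h / 4).
    by apply: sin_ge_half; apply/andP; split; lra.
  have q1 : z / 4 <= sin (z - h / 4) by lra.
  have q2 : h / 8 <= sin (h / 4) by lra.
  have -> : h ^+ 2 * aa / 16 = 2 * (z / 4 * (h / 8)) by rewrite zE; field.
  by rewrite ler_pM2l//; apply: ler_pM => //; lra.
have c1 : h ^+ 2 * aa / 16 <= lam * cos (h * (aa - 1 / 2)) - 1.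
  rewrite e; have -> : lam * cos (z - h / 2) - 1 = (cos (z - h / 2) - cos z) * lam.
    by rewrite /lam; field; rewrite gt_eqF//; lra.
  apply: (le_trans d); rewrite ler_peMr ?peak_lam_ge1//.
  by apply: le_trans d; rewrite divr_ge0// mulr_ge0 ?sqr_ge0//; lra.
have c0 : 0 <= h ^+ 2 * aa / 16 by rewrite divr_ge0// mulr_ge0 ?sqr_ge0//; lra.
apply: le_trans (cheb_ge n _); last by lra.
rewrite lerD2l.
have -> : (n%:R * h) ^+ 2 * aa / 16 = n%:R ^+ 2 * (h ^+ 2 * aa / 16) by ring.
by rewrite ler_wpM2l// sqr_ge0.
Qed.

(** The bound involves only the product n h and [aa], not [X], so [X] can be enlarged with n h
    fixed. *)
Lemma peak_le n t : `|cheb n (lam * cos t)| <= expR (3 * (n%:R * h) * aa).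
Proof.
have h0' := h0; have aa1' := aa1; have pi2 := pi_ge2 R; have z0 := peak_z_gt0; have z1 := peak_z_le; have cz := peak_cos_ge.
(* Chosen so that (rho + 1/rho) / 2 = 1 / cos z = lam. *)
pose rho := (1 + sin z) / cos z.
have sz0 : 0 <= sin z by apply: sin_ge0_pi; apply/andP; split; lra.
have sz : sin z <= z by apply: sin_le_id; exact: ltW.
have czn0 : cos z != 0 by rewrite gt_eqF//; lra.
have r1 : 1 <= rho by rewrite ler_pdivlMr ?mul1r; [have := cos_le1 z; lra | lra].
have rV : rho^-1 = (1 - sin z) / cos z.
  have s1 : 1 + sin z != 0 by rewrite gt_eqF//; lra.
  rewrite /rho invf_div; apply: (mulfI s1); rewrite mulrCA mulfV// mulr1.
  have h2 := cos2Dsin2 z.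
  have -> : (1 + sin z) * ((1 - sin z) / cos z) = (1 - sin z ^+ 2) / cos z by ring.
  by rewrite -h2 addrK expr2 mulfK.
have e : (rho + rho^-1) / 2 = lam by rewrite rV /rho /lam; field.
apply: (@le_trans _ _ (rho ^+ n)).
  apply: cheb_le => //; rewrite e normrM ger0_norm.
    by rewrite ler_piMr ?cos_max// invr_ge0; lra.
  by rewrite invr_ge0; lra.
have -> : 3 * (n%:R * h) * aa = n%:R * (3 * z) by rewrite zE; ring.
rewrite expRM_natl; apply: lerXn2r; rewrite ?nnegrE ?expR_ge0//; first by lra.
apply: le_trans (expR_ge1Dx _); rewrite ler_pdivrMr; last by lra.
have h1 := cos_ge_sqr z.
have h2 : (1 + 3 * z) * (1 - z ^+ 2 / 2) <= (1 + 3 * z) * cos z.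
  by rewrite ler_wpM2l//; lra.
apply: le_trans h2; apply: (@le_trans _ _ (1 + z)); first by lra.
have : z ^+ 2 <= z / 2 by rewrite expr2; nra.
have : z ^+ 2 * z <= z / 4 by rewrite expr2; nra.
nra.
Qed.

End Peak.

(** * Duality between test polynomials and the discrete energy *)

Section Pairing.
Variable R : realType.
Implicit Types (c : {poly R[i]}) (a : nat -> R[i]) (s L H eta : R).

Lemma pairing a N m eta c : (size c <= m)%N ->
  \sum_(0 <= k < m) c`_k * dirpoly a N (k%:R * eta) =
  c.[1] + \sum_(2 <= n < N.+1) a n * ((divw R n)%:C)%C * c.[cis (eta * ln n%:R)].
Proof.
move=> sc.
have hc z : c.[z] = \sum_(0 <= k < m) c`_k * z ^+ k.
  by rewrite (horner_coef_wide _ sc) big_mkord.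
under eq_bigr => k _ do rewrite dirpolyE mulrDr mulr1 mulr_sumr.
rewrite big_split/=; congr (_ + _).
  by rewrite hc; apply: eq_bigr => k _; rewrite expr1n mulr1.
rewrite exchange_big_nat/=; apply: eq_bigr => n _.
rewrite hc mulr_sumr; apply: eq_bigr => k _.
by rewrite cisX -mulrA; rewrite [LHS]mulrCA !mulrA; congr (_ * cis _); ring.
Qed.

Lemma sqr_sum_le m (F : nat -> R) :
  (\sum_(0 <= k < m) F k) ^+ 2 <= m%:R * \sum_(0 <= k < m) F k ^+ 2.
Proof.
case: m => [|m]; first by rewrite !big_geq// expr0n mulr0.
set S1 := bigop _ _ _; set S2 := \sum_(_ <= _ < _) F _ ^+ 2.
have m0 : 0 < m.+1%:R :> R by rewrite ltr0n.
pose q := S1 / m.+1%:R.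
have : 0 <= \sum_(0 <= k < m.+1) (F k - q) ^+ 2 by apply: sumr_ge0 => k _; rewrite sqr_ge0.
have -> : \sum_(0 <= k < m.+1) (F k - q) ^+ 2 = S2 - 2 * q * S1 + m.+1%:R * q ^+ 2.
  have -> : m.+1%:R * q ^+ 2 = \sum_(0 <= k < m.+1) q ^+ 2.
    by rewrite sumr_const_nat subn0 mulr_natl.
  rewrite /S2 /S1 mulr_sumr -sumrB -big_split/=; apply: eq_bigr => k _; ring.
have -> : S2 - 2 * q * S1 + m.+1%:R * q ^+ 2 = (m.+1%:R * S2 - S1 ^+ 2) / m.+1%:R.
  by rewrite /q; field; rewrite gt_eqF.
by rewrite pmulr_lge0 ?invr_gt0// subr_ge0.
Qed.

(** Cauchy-Schwarz with a sup bound on the coefficients: [s] of order 1/m gives a lower bound that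
    does not degenerate with the mesh. *)
Lemma denergy_ge H N a m c s L : 0 < H -> (0 < m)%N -> 0 <= s -> 0 <= L ->
  (forall k, nc c`_k <= s) ->
  L <= nc (\sum_(0 <= k < m) c`_k * dirpoly a N (k%:R * (H / m%:R))) ->
  L ^+ 2 * H <= (s * m%:R) ^+ 2 * denergy H N a m.
Proof.
move=> H0 m0 s0 L0 hc hL; have m0' : 0 < m%:R :> R by rewrite ltr0n.
pose F k := nc (dirpoly a N (k%:R * (H / m%:R))).
have h1 : L <= s * \sum_(0 <= k < m) F k.
  apply: (le_trans hL); rewrite mulr_sumr; apply: (le_trans (nc_sum _ _ _)).
  by apply: ler_sum => k _; rewrite ncM ler_wpM2r ?nc_ge0.
have -> : (s * m%:R) ^+ 2 * denergy H N a m =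
    s ^+ 2 * (m%:R * \sum_(0 <= k < m) F k ^+ 2) * H.
  rewrite /denergy -/(F _) /F.
  by move: (bigop _ _ _) => S; field; rewrite gt_eqF.
rewrite ler_pM2r//; apply: (@le_trans _ _ ((s * \sum_(0 <= k < m) F k) ^+ 2)).
  by apply: lerXn2r => //; rewrite nnegrE ?(le_trans L0).
by rewrite exprMn ler_wpM2l ?sqr_ge0// sqr_sum_le.
Qed.

Lemma size_prod_pred_le (I : eqType) (r : seq I) (F : I -> {poly R[i]}) :
  (size (\prod_(i <- r) F i)%R <= (\sum_(i <- r) (size (F i)).-1).+1)%N.
Proof.
elim: r => [|i r IH]; first by rewrite !big_nil size_poly1.
rewrite !big_cons; apply: (leq_trans (size_polyMleq _ _)).
have aux (u v w : nat) : (u <= w.+1)%N -> ((v + u).-1 <= (v.-1 + w).+1)%N by lia.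
exact: aux IH.
Qed.

Lemma coef_boxpoly_le m k : nc (boxpoly R m)`_k <= m%:R^-1.
Proof.
rewrite /boxpoly coef_poly; case: ifP => _.
  by rewrite nc_real ger0_norm// invr_ge0.
by rewrite nc0 invr_ge0.
Qed.

Lemma l1_boxpoly m : l1 (boxpoly R m) <= 1.
Proof.
case: m => [|m].
  have -> : boxpoly R 0 = 0%:P.
    by apply/polyP => k; rewrite /boxpoly coef_poly coefC; case: k.
  by rewrite l1C nc0.
have h : (size (boxpoly R m.+1) <= m.+1)%N by exact: size_poly.
rewrite (l1_wide h); apply: (@le_trans _ _ (\sum_(0 <= k < m.+1) (m.+1%:R^-1 : R))).
  by apply: ler_sum => k _; exact: coef_boxpoly_le.
by rewrite sumr_const_nat subn0 -[X in X <= _]mulr_natr mulVf// pnatr_eq0.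
Qed.

End Pairing.

(** * Damping by box kernels in the convergent case *)

Section ConvergentCase.
Variables (R : realType) (Phi : nat -> R) (H : R).
Hypothesis Phi_gt0 : forall n : nat, (2 <= n)%N -> 0 < Phi n.
Hypothesis Phi_incr : forall m n : nat, (2 <= m)%N -> (m <= n)%N -> Phi m <= Phi n.
Hypothesis H_gt0 : 0 < H.

Local Notation psi := (Psi Phi).

(** exp (- damping_exp j) compensates [Phi] up to the right end of block j and leaves 8^-(j+1),
    which beats the divisor sum 4^(j+1). *)
Definition damping_exp (j : nat) : nat := ((Num.truncn (psi j.+1)).+1 + 3 * j.+1)%N.

Lemma damping_exp_bounds j : psi j.+1 + 3 * j.+1%:R <= (damping_exp j)%:R <= psi j.+1 + 3 * j%:R + 4.
Proof.
have h0 : 0 <= psi j.+1 by exact: Psi_ge0.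
have /andP[h1 h2] := truncn_itv h0.
rewrite /damping_exp natrD natrM -[j.+1%:R]natr1 -[(Num.truncn _).+1%:R]natr1 in h2 *.
by apply/andP; split; lra.
Qed.

Lemma sum_linear_dyadic J : \sum_(0 <= j < J) (3 * j%:R + 4) / 2 ^+ j <= 14 :> R.
Proof.
suff -> : \sum_(0 <= j < J) (3 * j%:R + 4) / 2 ^+ j = 14 - (6 * J%:R + 14) / 2 ^+ J :> R.
  by rewrite lerBlDr lerDl divr_ge0 ?exprn_ge0// addr_ge0// mulr_ge0.
elim: J => [|J IH]; first by rewrite big_geq// expr0; lra.
rewrite big_nat_recr//= IH exprS -natr1; field.
by rewrite expf_neq0.
Qed.

(** The series of psi_j / 2^j and of j / 2^j both converge, so the total width of the boxes from
    [j0] on becomes as small as desired. *)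
Lemma damping_exp_tail B : (forall J, \sum_(0 <= j < J) psi j / 2 ^+ j <= B) ->
  forall (e : R) b, 0 < e -> exists2 j0, (b <= j0)%N &
    forall J, \sum_(j0 <= j < J) (damping_exp j)%:R / 2 ^+ j <= e.
Proof.
move=> hB e b e0.
pose u j : R := (damping_exp j)%:R / 2 ^+ j.
have u0 j : 0 <= u j by rewrite divr_ge0// exprn_ge0.
have hu J : \sum_(0 <= j < J) u j <= 2 * B + 14.
  apply: (@le_trans _ _ (2 * \sum_(0 <= j < J) psi j.+1 / 2 ^+ j.+1 + \sum_(0 <= j < J) (3 * j%:R + 4) / 2 ^+ j)).
    rewrite mulr_sumr -big_split/=; apply: ler_sum => j _.
    have /andP[_ h] := damping_exp_bounds j.
    have p : 0 < 2 ^+ j :> R by rewrite exprn_gt0.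
    have -> : 2 * (psi j.+1 / 2 ^+ j.+1) + (3 * j%:R + 4) / 2 ^+ j =
        (psi j.+1 + 3 * j%:R + 4) / 2 ^+ j.
      by rewrite exprS; field; rewrite gt_eqF.
    by rewrite /u ler_pM2r ?invr_gt0.
  apply: lerD; last exact: sum_linear_dyadic.
  rewrite ler_pM2l//; apply: le_trans (hB J.+1).
  by rewrite [leRHS]big_nat_recl//= lerDr divr_ge0 ?exprn_ge0// Psi_ge0.
have nd : nondecreasing_seq (series u) by apply: nondecreasing_series.
have cu : cvgn (series u).
  apply: nondecreasing_is_cvgn => //.
  by exists (2 * B + 14) => _ [J _ <-]; rewrite /series/=.
have lu := nondecreasing_cvgn_le nd cu.
have /cvgrPdist_lt/(_ e e0)[k0 _ hk0] := cu.
pose j0 := maxn b k0.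
exists j0; first exact: leq_maxl.
move=> J; case: (leqP J j0) => Jj; first by rewrite big_geq// ltW.
have h1 := hk0 j0 (leq_maxr b k0).
have h2 := lu J; have h3 := ler_norm (limn (series u) - series u j0).
have : series u J = series u j0 + \sum_(j0 <= j < J) u j.
  by rewrite /series/= (big_cat_nat (n := j0))//= ltnW.
rewrite /u => h4; lra.
Qed.

Lemma sum_tower_from (F : nat -> R) j0 J : (j0 <= J)%N ->
  \sum_(tower j0 <= n < tower J) F n = \sum_(j0 <= j < J) \sum_(tower j <= n < tower j.+1) F n.
Proof.
elim: J => [|J IH]; first by rewrite leqn0 => /eqP ->; rewrite !big_geq.
rewrite leq_eqVlt => /orP[/eqP ->|jJ]; first by rewrite !big_geq.
rewrite big_nat_recr//= -IH// (big_cat_nat (n := tower J))//=; exact: tower_mono.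
Qed.

Lemma sum_half_from j0 J : (j0 <= J)%N -> \sum_(j0 <= j < J) ((2 : R) ^- j.+1) <= 2 ^- j0.
Proof.
move=> jJ; suff : \sum_(j0 <= j < J) ((2 : R) ^- j.+1) = 2 ^- j0 - 2 ^- J.
  by move=> ->; rewrite lerBlDr lerDl invr_ge0 exprn_ge0.
elim: J jJ => [|J IH]; first by rewrite leqn0 => /eqP ->; rewrite big_geq// subrr.
rewrite leq_eqVlt => /orP[/eqP ->|jJ]; first by rewrite big_geq// subrr.
rewrite big_nat_recr//= IH// exprS; field.
by rewrite !expf_neq0.
Qed.

Section Damping.
Variables (b r j0 J : nat).
Hypothesis Hb : 32 <= H * 2 ^+ b.
Hypothesis bj0 : (b <= j0)%N.
Hypothesis Jr : (J <= r)%N.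
Hypothesis HJ : H * 2 ^+ J <= 2 ^+ r.
Let eta := H / (2 ^ r)%:R.

(* Factor j has width H 2^(b - j), so it is at most 1/4 on block j; its multiplicity
   outweighs both Phi and the divisor sum there, while the widths still add up to H/2. *)
Definition damping : {poly R[i]} :=
  \prod_(j0 <= j < J) boxpoly R (2 ^ (r - (j - b))) ^+ damping_exp j.

Lemma nc_damping_le1 z : nc z <= 1 -> nc damping.[z] <= 1.
Proof.
move=> z1; rewrite /damping horner_prod nc_prod.
apply: prodr_ile1 => j _; rewrite nc_ge0/= horner_exp ncX.
by rewrite exprn_ile1 ?nc_ge0// nc_boxpoly_le1.
Qed.

Lemma nc_damping1 : nc damping.[1] = 1.
Proof.
rewrite /damping horner_prod nc_prod big1// => j _; rewrite horner_exp ncX.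
have -> : (boxpoly R (2 ^ (r - (j - b)))).[1] = 1.
  rewrite /boxpoly horner_polyN; under eq_bigr => k _ do rewrite expr1n mulr1.
  rewrite sumr_const_nat subn0 -[LHS]mulr_natr fmorphV rmorph_nat mulVf//.
by rewrite nc1 expr1n.
Qed.

(** Only factor [j] is used: its width H 2^(b-j) times log n >= 2^j / 2 is at least 16 by [Hb], so
    the box is at most 1/4 <= exp (-1). *)
Lemma nc_damping_block j n : (j0 <= j < J)%N -> (tower j <= n < tower j.+1)%N ->
  nc damping.[cis (eta * ln n%:R)] <= expR (- psi j.+1) / 8 ^+ j.+1.
Proof.
move=> /andP[j0j jJ] /andP[nj nj1].
set q := cis _; have q1 : nc q <= 1 by rewrite nc_cis.
have H0' := H_gt0.
have p2r : 0 < 2 ^+ r :> R by rewrite exprn_gt0.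
have eta0 : 0 < eta by rewrite divr_gt0// natrX.
have x1 := @ln_ge_tower R j n nj.
have x2 : ln n%:R <= 2 ^+ j.+1 :> R.
  by apply: ln_le_tower; rewrite (ltnW nj1) andbT (leq_trans _ nj)// (leq_trans _ (tower_ge2 j)).
have x0 : 0 < ln n%:R :> R by apply: lt_le_trans x1; rewrite divr_gt0// exprn_gt0.
have hbox : nc (boxpoly R (2 ^ (r - (j - b)))).[q] <= 1 / 4.
  have ex0 : 0 < eta * ln n%:R by rewrite mulr_gt0.
  have hpi : eta * ln n%:R <= pi.
    apply: le_trans (_ : 1 <= pi); last by rewrite (le_trans _ (pi_ge2 R))// ler1n.
    rewrite /eta natrX mulrAC ler_pdivrMr// mul1r; apply: le_trans HJ.
    rewrite ler_pM2l//; apply: (le_trans x2).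
    by apply: ler_weXn2l => //; lra.
  have := @nc_boxpoly_cis R (2 ^ (r - (j - b))) (eta * ln n%:R).
  rewrite expn_gt0/= gtr0_norm// ex0 hpi => /(_ isT isT) h; apply: (le_trans h).
  have Ke : (2 ^ (r - (j - b)))%:R * eta = H * 2 ^+ b / 2 ^+ j.
    have := @exp2_sub_scale R H r (j - b) 0; rewrite addn0 subn0 expr0 divr1 => ->.
      rewrite -{2}(subnK (leq_trans bj0 j0j)) exprD; field.
      by rewrite !expf_neq0.
    by apply: (leq_trans (leq_subr _ _)); exact: (leq_trans (ltnW jJ) Jr).
  rewrite mulrA Ke.
  have h16 : 16 <= H * 2 ^+ b / 2 ^+ j * ln n%:R.
    apply: (@le_trans _ _ (H * 2 ^+ b / 2 ^+ j * (2 ^+ j / 2))).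
      have -> : H * 2 ^+ b / 2 ^+ j * (2 ^+ j / 2) = H * 2 ^+ b / 2.
        by field; rewrite expf_neq0.
      by have := Hb; lra.
    by rewrite ler_pM2l// divr_gt0 ?exprn_gt0// (lt_le_trans _ Hb).
  rewrite ler_pdivrMr; last by apply: lt_le_trans h16.
  lra.
rewrite /damping horner_prod nc_prod (bigD1_seq j) ?iota_uniq//=; last first.
  by rewrite mem_index_iota j0j.
apply: (@le_trans _ _ ((1 / 4) ^+ damping_exp j)).
  rewrite -[leRHS]mulr1; apply: ler_pM; rewrite ?nc_ge0//.
  - by apply: prodr_ge0 => i _; exact: nc_ge0.
  - by rewrite horner_exp ncX; apply: lerXn2r; rewrite ?nnegrE ?nc_ge0.
  - apply: prodr_ile1 => i _; rewrite nc_ge0/= horner_exp ncX.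
    by rewrite exprn_ile1 ?nc_ge0// nc_boxpoly_le1.
have e4 : 1 / 4 <= expR (- 1) :> R.
  have h := expR_half_le R; have p := expR_gt0 (1 / 2 : R).
  have -> : - 1 = - (1 / 2 + 1 / 2) :> R by field.
  rewrite expRN expRD div1r lef_pV2 ?posrE ?mulr_gt0//; nra.
apply: (@le_trans _ _ (expR (- 1) ^+ damping_exp j)).
  by apply: lerXn2r; rewrite ?nnegrE ?expR_ge0.
have e8 : expR (- 3) <= 8^-1 :> R.
  rewrite expRN lef_pV2 ?posrE ?expR_gt0//.
  have h : 1 + 1 <= expR 1 :> R by exact: expR_ge1Dx.
  have -> : 3 = 3%:R * 1 :> R by ring.
  rewrite expRM_natl; have -> : 8 = 2 ^+ 3 :> R by ring.
  by apply: lerXn2r; rewrite ?nnegrE ?expR_ge0//; lra.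
rewrite -expRM_natl; apply: (@le_trans _ _ (expR (- psi j.+1 + j.+1%:R * (- 3)))).
  by rewrite ler_expR; have /andP[h _] := damping_exp_bounds j; lra.
rewrite expRD expRM_natl ler_pM2l ?expR_gt0// -exprVn.
by apply: lerXn2r; rewrite ?nnegrE ?expR_ge0.
Qed.

Lemma sum_damping_block j : (j0 <= j < J)%N ->
  \sum_(tower j <= n < tower j.+1) Phi n * divw R n * nc damping.[cis (eta * ln n%:R)]
  <= Phi 2 * 2 ^- j.+1.
Proof.
move=> hj; have P2 : 0 < Phi 2 by exact: Phi_gt0.
apply: (@le_trans _ _ (\sum_(tower j <= n < tower j.+1) divw R n * (Phi 2 / 8 ^+ j.+1))).
  rewrite !big_nat; apply: ler_sum => n hn; have /andP[nj nj1] := hn.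
  have n2 : (2 <= n)%N by apply: leq_trans nj; exact: tower_ge2.
  rewrite mulrAC mulrC ler_wpM2l ?divw_ge0//.
  have hPhi : Phi n <= Phi 2 * expR (psi j.+1).
    rewrite /Psi expR_lratio ?tower_ge2// mulrCA mulfV ?gt_eqF// mulr1.
    by apply: Phi_incr => //; exact: ltnW.
  apply: (@le_trans _ _ (Phi 2 * expR (psi j.+1) * (expR (- psi j.+1) / 8 ^+ j.+1))).
    by apply: ler_pM; rewrite ?nc_ge0 ?nc_damping_block// ltW// Phi_gt0.
  rewrite -!mulrA ler_pM2l// mulrA expRxMexpNx_1 mul1r.
  by [].
rewrite -mulr_suml; apply: (@le_trans _ _ (4 ^+ j.+1 * (Phi 2 / 8 ^+ j.+1))).
  by rewrite ler_wpM2r ?sum_divw_tower_le// divr_ge0 ?exprn_ge0// ltW.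
have -> : 8 = 4 * 2 :> R by ring.
rewrite exprMn le_eqVlt; apply/orP; left; apply/eqP; field.
by rewrite !expf_neq0.
Qed.

(** The boxes take at most half of the 2^r available degrees; the rest is left to the Chebyshev
    factor. *)
Lemma size_damping : \sum_(j0 <= j < J) (damping_exp j)%:R / 2 ^+ j <= 2 ^- b.+1 :> R ->
  (0 < r)%N -> (size damping <= (2 ^ r.-1).+1)%N.
Proof.
move=> hs r0; apply: (leq_trans (size_prod_pred_le _ _)); rewrite ltnS.
apply: (@leq_trans (\sum_(j0 <= j < J) (2 ^ (r - (j - b)) * damping_exp j))).
  apply: leq_sum => j _.
  have := size_poly_exp_leq (boxpoly R (2 ^ (r - (j - b)))) (damping_exp j).
  have sb : (size (boxpoly R (2 ^ (r - (j - b)))) <= 2 ^ (r - (j - b)))%N by exact: size_poly.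
  have aux (x y : nat) : (x <= y.+1)%N -> (x.-1 <= y)%N by case: x.
  move=> h; apply: (leq_trans (aux _ _ h)).
  by rewrite leq_mul// (leq_trans (leq_pred _)).
rewrite -(ler_nat R) natr_sum.
apply: (@le_trans _ _ (2 ^+ (r + b) * \sum_(j0 <= j < J) (damping_exp j)%:R / 2 ^+ j)).
  rewrite mulr_sumr !big_nat; apply: ler_sum => j /andP[hj jJ].
  have e : (r + b = (r - (j - b)) + j)%N by lia.
  rewrite natrM natrX e exprD le_eqVlt; apply/orP; left; apply/eqP; field.
  by rewrite expf_neq0.
apply: (@le_trans _ _ (2 ^+ (r + b) * 2 ^- b.+1)).
  by rewrite ler_pM2l// exprn_gt0.
by rewrite natrX -{1}(prednK r0) addSn -addnS exprD mulfK.
Qed.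

(** The box set aside is the widest one; its small coefficients survive multiplication by factors of
    bounded l1 norm. *)
Lemma damping_factor : (j0 < J)%N ->
  exists2 D : {poly R[i]}, l1 D <= 1 & damping = D * boxpoly R (2 ^ (r - (j0 - b))).
Proof.
move=> jJ; pose G := boxpoly R (2 ^ (r - (j0 - b))).
exists (G ^+ (damping_exp j0).-1 * \prod_(j0.+1 <= j < J) boxpoly R (2 ^ (r - (j - b))) ^+ damping_exp j).
  have hX m k : l1 (boxpoly R m ^+ k) <= 1.
    apply: (le_trans (l1X _ _)); apply: exprn_ile1; first exact: l1_ge0.
    exact: l1_boxpoly.
  apply: (le_trans (l1M _ _)); apply: mulr_ile1; rewrite ?l1_ge0 ?hX//.
  by apply: l1_prod => i; exact: hX.
rewrite /damping big_ltn// -/G -{1}(prednK (_ : 0 < damping_exp j0)%N)// exprSr.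
by rewrite -!mulrA; congr (_ * _); rewrite mulrC.
Qed.

End Damping.

End ConvergentCase.

(** The Chebyshev factor has degree at most a quarter of 2^r. *)
Lemma exp2_kappa v r : (v + 3 <= r)%N -> ((2 ^ v * 2 ^ (r - v - 3)).*2 = 2 ^ r.-2)%N.
Proof.
move=> vr; rewrite -mul2n -expnD -expnS; congr (2 ^ _)%N; lia.
Qed.

Lemma exp2_split r : (3 <= r)%N -> (2 ^ r = 2 ^ r.-2 + 2 ^ r.-2 + 2 ^ r.-1)%N.
Proof.
case: r => [//|[//|k]] _ /=; rewrite !expnS; lia.
Qed.

Lemma leq_pred_add (x y p q s : nat) :
  (x <= p.+1 -> y <= q.+1 -> s = p + p + q -> 0 < p -> (x + y).-1 <= s)%N.
Proof. lia. Qed.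

(** * The test polynomial and a lower bound uniform in N *)

Section ConvergentCaseBound.
Variables (R : realType) (Phi : nat -> R) (H : R).
Hypothesis Phi_gt0 : forall n : nat, (2 <= n)%N -> 0 < Phi n.
Hypothesis Phi_incr : forall m n : nat, (2 <= m)%N -> (m <= n)%N -> Phi m <= Phi n.
Hypothesis H_gt0 : 0 < H.

Local Notation psi := (Psi Phi).

Section Test.
Variables (b r j0 j1 J v N : nat) (aa B0 : R) (a : nat -> R[i]).
Hypothesis Hb : 32 <= H * 2 ^+ b.
Hypothesis bj0 : (b <= j0)%N.
Hypothesis Jr : (J <= r)%N.
Hypothesis HJ : H * 2 ^+ J <= 2 ^+ r.
Hypothesis j01 : (j0 <= j1)%N.
Hypothesis j1J : (j1 < J)%N.
Hypothesis NJ : (N < tower J)%N.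
Hypothesis vr : (v + 3 <= r)%N.
Let h := H / 2 ^+ 3 / 2 ^+ v.
Hypothesis aa1 : 1 <= aa.
Hypothesis hX : h * (2 ^+ j1 + 2 * aa) <= 1.
Hypothesis hB0 : \sum_(2 <= n < tower j0) Phi n * divw R n <= B0.
Hypothesis hlarge : B0 + Phi 2 + 1 <= (H / 2 ^+ 3) ^+ 2 * aa / 16.
Hypothesis htail : Phi 2 * 2 ^- j1 * expR (3 * (H / 2 ^+ 3) * aa) <= 1.
Hypothesis hsize : \sum_(j0 <= j < J) (damping_exp Phi j)%:R / 2 ^+ j <= 2 ^- b.+1 :> R.
Hypothesis a_adm : admissible Phi N a.

Let eta := H / (2 ^ r)%:R.
Let lam := (cos (h * aa))^-1.
Let beta := h * (aa - 1 / 2).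
Let kappa := (2 ^ (r - v - 3))%N.
Let D := damping Phi b r j0 J.

Definition testpoly : {poly R[i]} := chebU lam beta kappa (2 ^ v) * D.

Let kappa_eta : kappa%:R * eta = h.
Proof. by rewrite /kappa /eta exp2_sub_scale. Qed.

Let h_gt0 : 0 < h. Proof. by rewrite !divr_gt0// exprn_gt0. Qed.

Let vh : (2 ^ v)%:R * h = H / 2 ^+ 3.
Proof. by rewrite /h natrX mulrCA mulfV ?mulr1// expf_neq0. Qed.

Let X_ge0 : 0 <= 2 ^+ j1 :> R. Proof. exact: exprn_ge0. Qed.

Lemma nc_testpoly n : nc testpoly.[cis (eta * ln n%:R)] =
  `|cheb (2 ^ v) (lam * cos (h * ln n%:R + beta))| * nc D.[cis (eta * ln n%:R)].
Proof. by rewrite hornerM ncM nc_chebU mulrA kappa_eta. Qed.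

Lemma nc_testpoly1 : B0 + Phi 2 + 2 <= nc testpoly.[1].
Proof.
rewrite hornerM ncM nc_damping1 mulr1 -{1}(cis0 R) nc_chebU mulr0 add0r.
apply: le_trans (ler_norm _).
apply: le_trans (peak_large h_gt0 aa1 X_ge0 hX (erefl _) _).
by rewrite vh; have := hlarge; lra.
Qed.

Lemma size_testpoly : (size testpoly <= 2 ^ r)%N.
Proof.
apply: (leq_trans (size_polyMleq _ _)).
have r0 : (0 < r)%N by apply: leq_trans vr; rewrite addn3.
have s1 := size_damping H_gt0 Hb bj0 Jr HJ hsize r0.
have s2 := size_chebU lam beta kappa (2 ^ v).
rewrite /kappa (exp2_kappa vr) in s2.
exact: (leq_pred_add s2 s1 (exp2_split (leq_trans (leq_addl v 3) vr)) (expn_gt0 2 r.-2)).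
Qed.

Let Q n := Phi n * divw R n * nc testpoly.[cis (eta * ln n%:R)].

Let Q_ge0 n : (2 <= n)%N -> 0 <= Q n.
Proof. by move=> n2; rewrite !mulr_ge0 ?nc_ge0 ?divw_ge0// ltW// Phi_gt0. Qed.

Let pw_ge0 n : (2 <= n)%N -> 0 <= Phi n * divw R n.
Proof. by move=> n2; rewrite mulr_ge0 ?divw_ge0// ltW// Phi_gt0. Qed.

Let Q_small n : (2 <= n < tower j1)%N -> Q n <= Phi n * divw R n * nc D.[cis (eta * ln n%:R)].
Proof.
move=> /andP[n2 nj]; rewrite /Q ler_wpM2l ?pw_ge0// nc_testpoly.
rewrite ler_piMl ?nc_ge0//; apply: cheb_le1.
apply: (peak_small h_gt0 aa1 X_ge0 hX (erefl _)); apply/andP; split.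
  apply: (le_trans (ln2_ge R)); rewrite ler_ln ?posrE ?ltr0n// ?ler_nat//.
  exact: ltnW.
by apply: ln_le_tower; rewrite (ltnW nj) andbT ltnW.
Qed.

Let Q_large n : (2 <= n)%N ->
  Q n <= expR (3 * (H / 2 ^+ 3) * aa) * (Phi n * divw R n * nc D.[cis (eta * ln n%:R)]).
Proof.
move=> n2; rewrite /Q nc_testpoly [leRHS]mulrCA ler_wpM2l ?pw_ge0//.
rewrite ler_wpM2r ?nc_ge0// -vh.
exact: (peak_le h_gt0 aa1 X_ge0 hX (erefl _)).
Qed.

(** Three ranges: below [tower j0] both factors are at most 1, which costs [B0]; up to [tower j1]
    damping alone leaves [Phi 2]; beyond, damping absorbs the global bound of the Chebyshev factor
    by [htail], which costs 1. *)
Lemma sum_testpoly_le : \sum_(2 <= n < N.+1) Q n <= B0 + Phi 2 + 1.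
Proof.
have P2 : 0 < Phi 2 by exact: Phi_gt0.
have range j k : (j0 <= j)%N -> (j <= k)%N -> (k <= J)%N ->
    \sum_(tower j <= n < tower k) Phi n * divw R n * nc D.[cis (eta * ln n%:R)] <= Phi 2 * 2 ^- j.
  move=> j0j jk kJ; rewrite sum_tower_from//.
  apply: (@le_trans _ _ (\sum_(j <= i < k) Phi 2 * 2 ^- i.+1)).
    rewrite !big_nat; apply: ler_sum => i /andP[ji ik].
    apply: (sum_damping_block Phi_gt0 Phi_incr H_gt0 Hb bj0 Jr HJ).
    by rewrite (leq_trans j0j ji) (leq_trans ik kJ).
  by rewrite -mulr_sumr ler_pM2l// sum_half_from.
apply: (@le_trans _ _ (\sum_(2 <= n < tower J) Q n)).
  case: (leqP 2 N.+1) => N2; last first.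
    rewrite big_geq ?(ltnW N2)// big_nat.
    by apply: sumr_ge0 => n /andP[n2 _]; exact: Q_ge0.
  rewrite [leRHS](big_cat_nat (n := N.+1))//= lerDl big_nat.
  by apply: sumr_ge0 => n /andP[n2 _]; apply: Q_ge0; exact: leq_trans N2 n2.
have j0J : (j0 <= J)%N := leq_trans j01 (ltnW j1J).
rewrite (big_cat_nat (n := tower j1)) ?tower_ge2 ?tower_mono// ?(ltnW j1J)//=.
rewrite (big_cat_nat (n := tower j0)) ?tower_ge2 ?tower_mono//=.
apply: lerD; first apply: lerD.
- apply: le_trans hB0; rewrite !big_nat; apply: ler_sum => n /andP[n2 nj].
  apply: (le_trans (Q_small _)).
    by rewrite n2 (leq_trans nj)// tower_mono.
  by rewrite ler_piMr ?pw_ge0// nc_damping_le1// nc_cis.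
- apply: (@le_trans _ _ (Phi 2 * 2 ^- j0)); last first.
    rewrite ler_piMr ?(ltW P2)// invf_le1 ?exprn_gt0//.
    by rewrite exprn_ege1//; lra.
  apply: le_trans (range j0 j1 _ _ _) => //; last exact: ltnW.
  rewrite !big_nat; apply: ler_sum => n /andP[nj0 nj1]; apply: Q_small.
  by rewrite nj1 (leq_trans _ nj0)// tower_ge2.
- apply: le_trans htail; rewrite [leRHS]mulrC.
  have := range j1 J j01 (ltnW j1J) (leqnn J).
  move=> /(ler_wpM2l (expR_ge0 (3 * (H / 2 ^+ 3) * aa))); apply: le_trans.
  rewrite mulr_sumr !big_nat; apply: ler_sum => n /andP[nj _]; apply: Q_large.
  by rewrite (leq_trans _ nj)// tower_ge2.
Qed.

Lemma pairing_testpoly_ge :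
  1 <= nc (\sum_(0 <= k < 2 ^ r) testpoly`_k * dirpoly a N (k%:R * eta)).
Proof.
rewrite (pairing a N eta size_testpoly).
apply: (le_trans _ (ncD_ge _ _)).
have h1 := nc_testpoly1.
suff : nc (\sum_(2 <= n < N.+1) a n * ((divw R n)%:C)%C * testpoly.[cis (eta * ln n%:R)])
    <= B0 + Phi 2 + 1.
  by move: (nc _) (nc _) h1 => x y h1 h2; lra.
apply: le_trans sum_testpoly_le; apply: (le_trans (nc_sum _ _ _)).
rewrite !big_nat; apply: ler_sum => n hn; rewrite !ncM nc_real ger0_norm ?divw_ge0//.
rewrite /Q -!mulrA ler_wpM2r ?mulr_ge0 ?nc_ge0 ?divw_ge0 ?invr_ge0//.
exact: a_adm.
Qed.

(** With the box [j0] split off, each coefficient is at most A / K. Multiplied by 2^r this is A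
    2^(j0 - b), so [r], [J] and [N] drop out. *)
Lemma denergy_testpoly_ge :
  H / ((2 * lam + 1) ^+ (2 ^ v) * 2 ^+ (j0 - b)) ^+ 2 <= denergy H N a (2 ^ r).
Proof.
have l1lam : 1 <= lam by exact: (peak_lam_ge1 h_gt0 aa1 X_ge0 hX (erefl _)).
pose A := (2 * lam + 1) ^+ (2 ^ v).
have A0 : 0 < A by rewrite exprn_gt0//; lra.
have [G lG eG] := damping_factor Phi b r (leq_ltn_trans j01 j1J).
have jr : (j0 - b <= r)%N.
  by apply: (leq_trans (leq_subr _ _)); exact: leq_trans (leq_trans j01 (ltnW j1J)) Jr.
pose K := (2 ^ (r - (j0 - b)))%N.
have K0 : 0 < K%:R :> R by rewrite ltr0n expn_gt0.
have hc k : nc testpoly`_k <= A * K%:R^-1.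
  rewrite /testpoly /D eG mulrA.
  apply: (le_trans (nc_coefM_le _ k (coef_boxpoly_le R _))).
  rewrite ler_wpM2r ?invr_ge0//; apply: (le_trans (l1M _ _)).
  rewrite -[leRHS]mulr1; apply: ler_pM; rewrite ?l1_ge0//.
  exact: l1_chebU.
have m0 : (0 < 2 ^ r)%N by rewrite expn_gt0.
have s0 : 0 <= A * K%:R^-1 by rewrite divr_ge0// ltW.
have := denergy_ge H_gt0 m0 s0 ler01 hc pairing_testpoly_ge.
rewrite expr1n mul1r.
have -> : A * K%:R^-1 * (2 ^ r)%:R = A * 2 ^+ (j0 - b).
  rewrite /K -{2}(subnK jr) !natrX exprD; field.
  by rewrite expf_neq0.
have den : 0 < (A * 2 ^+ (j0 - b)) ^+ 2 by rewrite exprn_gt0// mulr_gt0// exprn_gt0.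
by rewrite ler_pdivrMr// mulrC.
Qed.

End Test.

Lemma exp2_ge (x : R) : exists n, x <= 2 ^+ n.
Proof.
have /andP[_ h] := truncn_itv (normr_ge0 x).
exists (Num.truncn `|x|).+1; apply: (le_trans (ler_norm x)); apply: (le_trans (ltW h)).
by rewrite -natrX ler_nat ltnW// ltn_expl.
Qed.

Lemma denergy_ge_of_convergent B : (forall J, \sum_(0 <= j < J) psi j / 2 ^+ j <= B) ->
  exists2 c : R, 0 < c & forall N a, admissible Phi N a ->
    exists r0, forall r, (r0 <= r)%N -> c <= denergy H N a (2 ^ r).
Proof.
move=> hB; have P2 : 0 < Phi 2 by exact: Phi_gt0.
have [b hb] := exp2_ge (32 / H).
have Hb : 32 <= H * 2 ^+ b by rewrite mulrC -ler_pdivrMr.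
have e0 : 0 < 2 ^- b.+1 :> R by rewrite invr_gt0 exprn_gt0.
have [j0 bj0 hj0] := damping_exp_tail Phi_gt0 Phi_incr hB b e0.
pose B0 := \sum_(2 <= n < tower j0) Phi n * divw R n.
have B00 : 0 <= B0.
  rewrite /B0 big_nat; apply: sumr_ge0 => n /andP[n2 _].
  by rewrite mulr_ge0 ?divw_ge0// ltW// Phi_gt0.
pose d := (H / 2 ^+ 3) ^+ 2.
have d0 : 0 < d by rewrite exprn_gt0// divr_gt0// exprn_gt0.
(* Large enough that the peak at 0 outweighs all other frequencies together. *)
pose aa := 16 * (B0 + Phi 2 + 1) / d + 1.
have M0 : 0 < B0 + Phi 2 + 1 by lra.
have aa1 : 1 <= aa by rewrite lerDr divr_ge0 ?(ltW d0)// mulr_ge0// ltW.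
have hlarge : B0 + Phi 2 + 1 <= d * aa / 16.
  have -> : d * aa / 16 = (B0 + Phi 2 + 1) + d / 16 by rewrite /aa; field; rewrite gt_eqF.
  by rewrite lerDl divr_ge0// ltW.
have [j1' hj1'] := exp2_ge (Phi 2 * expR (3 * (H / 2 ^+ 3) * aa)).
pose j1 := maxn j0 j1'.
have htail : Phi 2 * 2 ^- j1 * expR (3 * (H / 2 ^+ 3) * aa) <= 1.
  rewrite mulrAC ler_pdivrMr ?exprn_gt0// mul1r; apply: (le_trans hj1').
  by apply: ler_weXn2l; [lra | exact: leq_maxr].
have [v hv] := exp2_ge (H / 2 ^+ 3 * (2 ^+ j1 + 2 * aa)).
have hX : H / 2 ^+ 3 / 2 ^+ v * (2 ^+ j1 + 2 * aa) <= 1.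
  by rewrite mulrAC ler_pdivrMr ?exprn_gt0// mul1r.
pose lam := (cos (H / 2 ^+ 3 / 2 ^+ v * aa))^-1.
have h_gt0 : 0 < H / 2 ^+ 3 / 2 ^+ v by rewrite !divr_gt0// exprn_gt0.
have X_ge0 : 0 <= 2 ^+ j1 :> R by exact: exprn_ge0.
have l1lam : 1 <= lam by exact: (peak_lam_ge1 h_gt0 aa1 X_ge0 hX (erefl _)).
exists (H / ((2 * lam + 1) ^+ (2 ^ v) * 2 ^+ (j0 - b)) ^+ 2).
  rewrite divr_gt0// exprn_gt0// mulr_gt0 ?exprn_gt0//.
  by move: (lam) l1lam => w; lra.
(* The constant is fixed by now through [b], [j0], [aa], [j1] and [v]; only [J] and [r] depend on
   [N]. *)
move=> N a a_adm; pose J := (maxn N j1).+1.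
have [r1 hr1] := exp2_ge (H * 2 ^+ J).
exists (maxn (maxn J r1) (v + 3)) => r; rewrite !geq_max => /andP[/andP[Jr r1r] vr].
have HJ : H * 2 ^+ J <= 2 ^+ r.
  by apply: (le_trans hr1); apply: ler_weXn2l => //; lra.
have j1J : (j1 < J)%N by rewrite ltnS leq_maxr.
have NJ : (N < tower J)%N.
  by apply: leq_ltn_trans (ltn_tower J); rewrite /J ltnW// ltnS leq_maxl.
exact: (denergy_testpoly_ge Hb bj0 Jr HJ (leq_maxl j0 j1') j1J NJ vr aa1 hX (lexx B0)
  hlarge htail (hj0 J) a_adm).
Qed.

End ConvergentCaseBound.

(** * The theorem *)

Section EnergyMinimum.
Variables (R : realType) (Phi : nat -> R) (H : R).
Hypothesis Phi_gt0 : forall n : nat, (2 <= n)%N -> 0 < Phi n.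
Hypothesis H_gt0 : 0 < H.

Lemma ler_addinv (x y K : R) : (forall m, (0 < m)%N -> x <= y + K / m%:R) -> x <= y.
Proof.
move=> h; rewrite leNgt; apply/negP => yx.
have d0 : 0 < x - y by rewrite subr_gt0.
have /andP[_ hm] := truncn_itv (normr_ge0 (K / (x - y))).
set m := (Num.truncn _).+1 in hm.
have m0 : 0 < m%:R :> R by rewrite ltr0n.
have := h m isT; rewrite -lerBlDl ler_pdivlMr// mulrC -ler_pdivlMr// => h2.
by have := lt_le_trans (le_lt_trans (ler_norm _) hm) h2; rewrite ltxx.
Qed.

Lemma coef_mass_ge0 N : 0 <= coef_mass Phi N.
Proof.
rewrite addr_ge0// big_nat; apply: sumr_ge0 => n /andP[n2 _].
by rewrite mulr_ge0 ?divw_ge0// ltW// Phi_gt0.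
Qed.

Lemma denergy_has_min N m : (0 < m)%N -> exists2 a, admissible Phi N a &
  forall b, admissible Phi N b -> denergy H N a m <= denergy H N b m.
Proof.
move=> m0; apply: (@polydisc_min _ _ _ _ (H * (coef_mass Phi N *+ 2)) (divw R)).
- by move=> n /andP[n2 _]; rewrite ltW// Phi_gt0.
- by rewrite mulr_ge0 ?(ltW H_gt0)// mulrn_wge0// coef_mass_ge0.
- exact: divw_ge0.
- by move=> a b ha hb; exact: denergy_lipschitz.
Qed.

Lemma energy_has_min N : exists2 a, admissible Phi N a &
  forall b, admissible Phi N b -> energy H N a <= energy H N b.
Proof.
apply: (@polydisc_min _ _ _ _ (H * (coef_mass Phi N *+ 2)) (divw R)).
- by move=> n /andP[n2 _]; rewrite ltW// Phi_gt0.
- by rewrite mulr_ge0 ?(ltW H_gt0)// mulrn_wge0// coef_mass_ge0.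
- exact: divw_ge0.
- move=> a b ha hb; have [K hK] := denergy_cvg Phi N H_gt0.
  (* The Lipschitz bound of the energy is inherited from the discrete energies as m grows. *)
  apply: (@ler_addinv _ _ (2 * K)) => m m0.
  have h1 := hK a ha m m0; have h2 := hK b hb m m0.
  have h3 := denergy_lipschitz H_gt0 m0 ha hb.
  move: h1 h2 h3; rewrite !ler_norml -[2 * K / _]mulrA.
  move: (K / m%:R) (H * _ * _) => k s /andP[? ?] /andP[? ?] /andP[? ?].
  by apply/andP; split; lra.
Qed.

Lemma energy_ge0 N (a : nat -> R[i]) : 0 <= energy H N a.
Proof. by apply: Rintegral_ge0 => t _; exact: sqr_ge0. Qed.

Lemma energy_le_denergy N (eps : R) : 0 < eps -> exists r0, forall r a, (r0 <= r)%N ->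
  admissible Phi N a -> `|energy H N a - denergy H N a (2 ^ r)| <= eps.
Proof.
move=> eps0; have [K hK] := denergy_cvg Phi N H_gt0.
have [r0 hr0] := exp2_ge (K / eps).
exists r0 => r a r0r ha; have m0 : (0 < 2 ^ r)%N by rewrite expn_gt0.
apply: (le_trans (hK a ha _ m0)).
rewrite ler_pdivrMr ?ltr0n// mulrC -ler_pdivrMr// natrX.
by apply: (le_trans hr0); apply: ler_weXn2l => //; lra.
Qed.

(** Padding with a zero coefficient: a competitor for N is one for N + 1, so the minima decrease. *)
Lemma dirpoly_trunc (a : nat -> R[i]) N t :
  dirpoly (fun n => if (n <= N)%N then a n else 0) N.+1 t = dirpoly a N t.
Proof.
rewrite !dirpolyE; congr (_ + _); case: N => [|N]; first by rewrite !big_geq.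
rewrite big_nat_recr//= ltnn !mul0r addr0; apply: eq_big_nat => n /andP[_ nN].
by rewrite -ltnS nN.
Qed.

End EnergyMinimum.

Theorem corollary2 (R : realType) (Phi : nat -> R) (H : R)
  (Phi_gt0 : forall n : nat, (2 <= n)%N -> 0 < Phi n)
  (Phi_incr : forall m n : nat, (2 <= m)%N -> (m <= n)%N -> Phi m <= Phi n)
  (H_gt0 : 0 < H) :
  exists (mu : nat -> R) (L : R),
    [/\ forall N : nat, (2 <= N)%N ->
          is_minimum (energy H N @` admissible Phi N) (mu N),
        mu N @[N --> \oo] --> L
      & 0 < L <->
        cvgn (fun N : nat =>
          \sum_(2 <= n < N.+1)
             (ndiv n)%:R * ln (Phi n) / (n%:R * ln n%:R ^+ 3))].
Proof.
have /choice[mu mu_min] N : exists m, is_minimum (energy H N @` admissible Phi N) m.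
  have [a ha amin] := energy_has_min Phi_gt0 H_gt0 N.
  exists (energy H N a); split; first by exists a.
  by move=> _ [b hb <-]; exact: amin.
have mu_le N a : admissible Phi N a -> mu N <= energy H N a.
  by move=> ha; case: (mu_min N) => _; apply; exists a.
have mu_ge0 N : 0 <= mu N by case: (mu_min N) => -[a _ <-] _; exact: energy_ge0.
have mu_noninc : nonincreasing_seq mu.
  apply/nonincreasing_seqP => N; case: (mu_min N) => -[a ha <-] _.
  pose b n := if (n <= N)%N then a n else 0.
  have hb : admissible Phi N.+1 b.
    move=> n /andP[n2 _]; rewrite /b; case: ifP => nN; last by rewrite nc0 ltW// Phi_gt0.
    by apply: ha; rewrite n2.
  apply: (le_trans (mu_le _ _ hb)).
  by rewrite /energy; under eq_Rintegral do rewrite dirpoly_trunc.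
have mu_cvg : cvgn mu.
  by apply: nonincreasing_is_cvgn => //; exists 0 => _ [N _ <-].
have L_le := nonincreasing_cvgn_ge mu_noninc mu_cvg.
exists mu, (limn mu); split => //.
rewrite (lratio_cvg_iff Phi_gt0 Phi_incr); split => [L0|[B hB]].
- apply: contrapT => /forallNP nB.
  have unb B : exists J, B < \sum_(0 <= j < J) Psi Phi j / 2 ^+ j.
    apply: contrapT => /forallNP h; apply: (nB B) => J.
    by rewrite leNgt; apply/negP; exact: h.
  (* A quarter of the limit for the discrete minimum and a quarter for the Riemann error give an
     admissible [a] with energy below the limit. *)
  have e0 : 0 < limn mu / 4 by rewrite divr_gt0.
  have [N N2 [r0 hr0]] := denergy_small_of_divergent Phi_gt0 Phi_incr H_gt0 unb e0.
  have [r1 hr1] := energy_le_denergy Phi H_gt0 N e0.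
  pose r := maxn r0 r1.
  have m0 : (0 < 2 ^ r)%N by rewrite expn_gt0.
  have [a ha amin] := denergy_has_min Phi_gt0 H_gt0 N m0.
  have h1 := hr0 r a (leq_maxl _ _) ha amin.
  have h2 := hr1 r a (leq_maxr _ _) ha.
  have h3 := le_trans (L_le N) (mu_le N a ha).
  have h4 := ler_norm (energy H N a - denergy H N a (2 ^ r)).
  lra.
- have [c c0 hc] := denergy_ge_of_convergent Phi_gt0 Phi_incr H_gt0 hB.
  apply: (lt_le_trans c0); apply: limr_ge => //.
  near=> N; case: (mu_min N) => -[a ha <-] _.
  (* The mesh in [hc] may depend on [a]; this is harmless since the minimizer is fixed before the
     mesh is refined. *)
  rewrite leNgt; apply/negP => lt_c.
  have e0 : 0 < (c - energy H N a) / 2 by rewrite divr_gt0// subr_gt0.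
  have [r0 hr0] := hc N a ha; have [r1 hr1] := energy_le_denergy Phi H_gt0 N e0.
  have h1 := hr0 (maxn r0 r1) (leq_maxl _ _).
  have := hr1 (maxn r0 r1) a (leq_maxr _ _) ha; rewrite ler_norml => /andP[h2 _].
  lra.
Unshelve. all: by end_near.
Qed.
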